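(* Let $\mathbb I:so(n)\to so(n)$ be symmetric positive definite, $D>0$, $\mathbf I=\mathbb I+D\mathbb E$, $\epsilon=\sigma/(\sigma\pm\rho)$. The problem of the rubber rolling of a ball over a sphere, i.e. the system $$\dot m=[m,\omega]+\lambda_0,\qquad \dot g=g\cdot\omega,\qquad \dot\gamma=-\epsilon\,\omega\gamma,\qquad m=\mathbf I\omega,$$ on $\mathcal G=\{(m,g,\gamma)\in T^*SO(n)\times S^{n-1}\mid \mathrm{pr}_{\mathfrak h_\gamma}\mathbf I^{-1}m=0\}$, and the reduced system $$\dot m=[m,\omega]+\lambda_0,\qquad \dot\gamma=-\epsilon\,\omega\gamma$$ on $\mathcal G_0=\{(m,\gamma)\in so(n)^*\times S^{n-1}\mid \mathrm{pr}_{\mathfrak h_\gamma}\mathbf I^{-1}m=0\}$, possess the invariant measures $$\mu_\epsilon(\gamma)\,\varOmega^d\wedge\mathrm d\gamma\big|_{\mathcal G},\qquad \mu_\epsilon(\gamma)\,\mathrm dm\wedge\mathrm d\gamma\big|_{\mathcal G_0},$$ respectively, where $$\mu_\epsilon(\gamma)=\big(\det\mathbf I^{-1}|_{\mathfrak h_\gamma}\big)^{\frac1{2\epsilon}} .$$ Here $\lambda_0\in\mathfrak h_\gamma$ is determined by $\mathrm{pr}_{\mathfrak h_\gamma}\mathbf I^{-1}([m,\omega]+\lambda_0)=0$.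
   Context: Vectors of $\mathbb R^n$ are columns, $x\otimes y=xy^T$, $x\wedge y=xy^T-yx^T$. Identify $so(n)\cong so(n)^*$ by $\langle X,Y\rangle=-\frac12\mathrm{tr}(XY)$; $\mathbb E$ is the identity operator on $so(n)$. For $\gamma\in S^{n-1}$, $\mathfrak v_\gamma=\mathbb R^n\wedge\gamma\subset so(n)$, $\mathfrak h_\gamma=\mathfrak v_\gamma^\perp$; orthogonal projections $\mathrm{pr}_{\mathfrak v_\gamma}\xi=\xi\,\gamma\otimes\gamma+\gamma\otimes\gamma\,\xi$, $\mathrm{pr}_{\mathfrak h_\gamma}=\mathbb E-\mathrm{pr}_{\mathfrak v_\gamma}$. $\det\mathbf I^{-1}|_{\mathfrak h_\gamma}$ is the determinant of the restriction of the quadratic form of $\mathbf I^{-1}$ to $\mathfrak h_\gamma$, i.e. of the operator $\mathrm{pr}_{\mathfrak h_\gamma}\circ\mathbf I^{-1}|_{\mathfrak h_\gamma}:\mathfrak h_\gamma\to\mathfrak h_\gamma$; equivalently, $\det(\langle\mathbf e_i\wedge\mathbf e_j,\mathbf I^{-1}(\mathbf e_k\wedge\mathbf e_l)\rangle)_{i<j\le n-1,\,k<l\le n-1}$ for an orthonormal basis $\mathbf e_1,\dots,\mathbf e_{n-1},\gamma$ of $\mathbb R^n$. The constants come from a ball of radius $\rho>0$ and mass $m_b$ ($D=m_b\rho^2$) rolling over a fixed sphere of radius $\sigma>0$: sign $+$ for rolling over the outer surface; sign $-$ for rolling over the inner surface ($\sigma>\rho$) or for a spherical shell rolling around a fixed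 sphere in its interior ($\sigma<\rho$). So $\epsilon$ is a nonzero real constant. $T^*SO(n)\cong so(n)^*\times SO(n)$ by left trivialization, $m$ being the $so(n)^*$-component; $\varOmega$ is the canonical symplectic form on $T^*SO(n)$, $d=\dim SO(n)$; $\mathrm dm$, $\mathrm d\gamma$ are the standard volume forms on $so(n)^*$ and $S^{n-1}$. Meaning of the restrictions: $\mathcal G$ and $\mathcal G_0$ are cut out by $\phi_{ij}=\langle\mathbf I^{-1}m,\mathbf e_i\wedge\mathbf e_j\rangle=0$, $1\le i<j\le n-1$, where $\mathbf e_1,\dots,\mathbf e_{n-1},\gamma$ is a local smooth orthonormal frame depending on $\gamma$. For a volume form $\Theta$ on the ambient space, $\Theta|_{\mathcal G}$ (resp. $\Theta|_{\mathcal G_0}$) is the volume form on the submanifold obtained by restricting any form $\theta$ with $\Theta=\theta\wedge\bigwedge_{i<j}d\phi_{ij}$; up to sign it does not depend on the choice of the frame. Equivalently, up to a constant factor, in the variables $(\omega,\gamma)$, $\omega\in\mathfrak v_\gamma$, $\mathrm dm\wedge\mathrm d\gamma|_{\mathcal G_0}$ is the product of the Euclidean volume on the fibre $\mathfrak v_\gamma$ and $\mathrm d\gamma$. A system ''possesses an invariant measure'' given by a volume form if its flow preserves it. *)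

(* Defs.v *)
From HB Require Import structures.
From mathcomp Require Import all_boot all_order all_algebra all_fingroup.
From mathcomp Require Import sesquilinear.
From mathcomp Require Import all_classical all_reals all_analysis.

Set Implicit Arguments.
Unset Strict Implicit.
Unset Printing Implicit Defensive.

Import Order.TTheory GRing.Theory Num.Theory.
Import numFieldNormedType.Exports.

Local Open Scope classical_set_scope.
Local Open Scope ring_scope.

Section Forms.
Context {R : realType} {V : lmodType R}.

(* A k-form at a point: only its values on tuples of tangent vectors matter. *)
Definition form (k : nat) := ('I_k -> V) -> R.

Definition upd k (v : 'I_k -> V) (i : 'I_k) (u : V) : 'I_k -> V :=
  fun j => if j == i then u else v j.

Definition is_form k (a : form k) : Prop :=
  (forall v i (c : R) u w,
     a (upd v i (c *: u + w)) = c * a (upd v i u) + a (upd v i w)) /\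
  (forall v i j, i != j -> v i = v j -> a v = 0).

(* Normalised so that (l_1 /\ .. /\ l_k)(v_1, .., v_k) = det (l_i (v_j)). *)
Definition fwedge p q (a : form p) (b : form q) : form (p + q) := fun v =>
  ((p`! * q`!)%:R)^-1 *
  \sum_(s : 'S_(p + q)) (-1) ^+ s * a (fun i => v (s (lshift q i)))
                                  * b (fun j => v (s (rshift p j))).

Fixpoint fpow p (a : form p) (k : nat) : form (k * p) :=
  match k with
  | 0 => fun _ => 1
  | k'.+1 => fwedge a (@fpow p a k')
  end.

(* Exterior product of a family of 1-forms, in the order of [enum I]. *)
Definition bigwedge (I : finType) (l : I -> V -> R) : form #|I| := fun v =>
  \det (\matrix_(i < #|I|, j < #|I|) l (enum_val i) (v j)).

Definition fcast p q (e : p = q) (a : form p) : form q :=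
  fun v => a (fun i => v (cast_ord e i)).

(* [theta] restricts to Theta|_M, where M is cut out of a manifold with
   tangent space T by functions whose differentials are [dphi]. *)
Definition restriction (T : set V) (p k : nat) (I : finType)
    (e : p = (k + #|I|)%N) (Theta : form p) (dphi : I -> V -> R)
    (theta : form k) : Prop :=
  is_form theta /\
  forall v : 'I_(k + #|I|) -> V, (forall i, T (v i)) ->
    fcast e Theta v = fwedge theta (bigwedge dphi) v.

End Forms.
Arguments fpow {R V p} a k.
Arguments form {R} V k.

Definition pull (R : realType) (V W : lmodType R) (f : V -> W) k
  (a : form W k) : form V k := fun v => a (fun i => f (v i)).

Section Calculus.
Context {R : realType}.

Fixpoint Ck (V W : normedModType R) (k : nat) (U : set V) (f : V -> W) : Prop :=
  match k with
  | 0 => forall x, U x -> {for x, continuous f}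
  | k'.+1 => (forall x, U x -> differentiable f x) /\
             forall v, Ck k' U (fun x => 'D_v f x)
  end.

Definition smooth (V W : normedModType R) (U : set V) (f : V -> W) : Prop :=
  forall k, Ck k U f.

Definition tangent (V : normedModType R) (M : set V) (x : V) : set V :=
  [set v | exists c : R -> V,
     [/\ forall s, M (c s), c 0 = x & is_derive (0 : R) (1 : R) c v]].

(* Exterior derivative of a 1-form on a vector space, evaluated with constant
   vector fields (whose Lie bracket vanishes). *)
Definition extd (V : normedModType R) (a : V -> V -> R) (x : V) : form V 2 :=
  fun v => 'D_(v ord0) (fun y => a y (v ord_max)) x
           - 'D_(v ord_max) (fun y => a y (v ord0)) x.

(* (Local) flow on the submanifold M of the system "sys x xdot".  The flow
   domain is W `&` (R x M), and [phi] is the restriction of a smooth map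
   defined on the open set W of the ambient space; its values outside R x M
   are irrelevant. *)
Record is_flow (V : normedModType R) (M : set V) (sys : V -> V -> Prop)
    (W : set (R * V)) (phi : R * V -> V) : Prop := IsFlow {
  flow_open : open W ;
  flow_smooth : smooth W phi ;
  flow_dom0 : forall x, M x -> W (0, x) ;
  flow_itv : forall x, M x -> is_interval [set t | W (t, x)] ;
  flow_init : forall x, M x -> phi (0, x) = x ;
  flow_in : forall t x, M x -> W (t, x) -> M (phi (t, x)) ;
  flow_ode : forall t x, M x -> W (t, x) ->
    exists2 u, is_derive t (1 : R) (fun s => phi (s, x)) u & sys (phi (t, x)) u
}.

(* [vol x theta] says that theta represents, up to sign, the volume form at x.
   The measure of the volume form being insensitive to signs, invariance is
   (phi_t)^* |vol| = |vol| on M. *)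
Definition invariant_measure (V : normedModType R) (M : set V)
    (sys : V -> V -> Prop) (k : nat) (vol : V -> form V k -> Prop) : Prop :=
  forall W phi, is_flow M sys W phi ->
  forall t x, M x -> W (t, x) ->
  forall theta theta', vol x theta -> vol (phi (t, x)) theta' ->
  forall v : 'I_k -> V, (forall i, tangent M x (v i)) ->
    `|theta' (fun i => 'D_(v i) (fun y => phi (t, y)) x)| = `|theta v|.

End Calculus.

Section SpecialOrthogonalAlgebra.
Variables (R : realType) (N : nat).

Definition so_space : {vspace 'M[R]_N} :=
  lker (linfun (fun X : 'M[R]_N => X + X^T)).

Lemma so_spaceE (X : 'M[R]_N) : (X \in so_space) = (X^T == - X).
Proof.
have lin : linear (fun X : 'M[R]_N => X + X^T).
  by move=> a A B; apply/matrixP=> i j; rewrite !mxE mulrDr addrACA.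
pose f := GRing.isLinear.Build _ _ _ _ _ lin.
pose F : {linear 'M[R]_N -> 'M[R]_N} := HB.pack (fun X : 'M[R]_N => X + X^T) f.
by rewrite memv_ker (lfunE F) /= addrC addr_eq0.
Qed.

End SpecialOrthogonalAlgebra.

Notation so R N := (subvs_of (so_space R N)).
Notation toso := (vsproj (so_space _ _)).

Section Algebra.
Context {R : realType} {N : nat}.
Implicit Types (X Y : 'M[R]_N) (x y g : 'cV[R]_N) (xi eta : so R N).

Definition lie X Y : 'M[R]_N := X *m Y - Y *m X.

Definition pairing X Y : R := - (2^-1 * \tr (X *m Y)).

Definition so_dot xi eta : R := pairing (vsval xi) (vsval eta).

Lemma so_dot_sym xi eta : so_dot xi eta = so_dot eta xi.
Proof. by rewrite /so_dot /pairing mxtrace_mulC. Qed.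

Lemma so_dot_linr xi : linear_for *%R (so_dot xi).
Proof.
move=> a eta1 eta2; rewrite /so_dot /pairing (linearP (@vsval _ _ (so_space R N))) mulmxDr -scalemxAr mxtraceD mxtraceZ.
by rewrite mulrDr opprD mulrN mulrCA.
Qed.

Lemma so_dot_bilinear :
  bilinear_for (GRing.Scale.Law.clone _ _ *%R _)
    (GRing.Scale.Law.clone _ _ (idfun \; *%R) _) so_dot.
Proof.
split=> [xi|eta] a u v /=; last exact: so_dot_linr.
by rewrite so_dot_sym so_dot_linr !(so_dot_sym xi).
Qed.

HB.instance Definition _ :=
  bilinear_isBilinear.Build R (so R N) (so R N) R *%R (idfun \; *%R)
    so_dot so_dot_bilinear.

Lemma so_dot_hermitian xi eta :
  so_dot xi eta = (-1) ^+ false * idfun (so_dot eta xi).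
Proof. by rewrite mul1r so_dot_sym. Qed.

HB.instance Definition _ :=
  isHermitianSesquilinear.Build R (so R N) false idfun so_dot so_dot_hermitian.

Definition vwedge x y : so R N := toso (x *m y^T - y *m x^T).

Definition v_space g : {vspace so R N} := limg (linfun (fun x => vwedge x g)).

Definition h_space g : {vspace so R N} := orthov so_dot (v_space g).

Definition pr_v g xi : so R N :=
  toso (vsval xi *m (g *m g^T) + (g *m g^T) *m vsval xi).

Definition pr_h g xi : so R N := xi - pr_v g xi.

(* Determinant of an endomorphism f of U. *)
Definition det_on (vT : vectType R) (U : {vspace vT}) (f : vT -> vT) : R :=
  \det (\matrix_(i < \dim U, j < \dim U)
          coord (vbasis U) j (f (tnth (vbasis U) i))).

Definition so_symmetric (A : 'End(so R N)) : Prop :=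
  forall xi eta, so_dot (A xi) eta = so_dot xi (A eta).

Definition so_posdef (A : 'End(so R N)) : Prop :=
  forall xi, xi != 0 -> 0 < so_dot (A xi) xi.

(* In the following bI : so -> so is the modified inertia operator. *)

Definition ang_vel (bI : 'End(so R N)) (m : 'M[R]_N) : so R N :=
  (bI^-1)%VF (toso m).

Definition mu (bI : 'End(so R N)) (eps : R) g : R :=
  det_on (h_space g) (fun xi => pr_h g ((bI^-1)%VF xi)) `^ (2 * eps)^-1.

Definition sphere : set 'cV[R]_N := [set g | g^T *m g = 1%:M].

Definition SO : set 'M[R]_N := [set g | g^T *m g = 1%:M /\ \det g = 1].

End Algebra.

Notation ltpair n := {ij : 'I_n * 'I_n | (ij.1 < ij.2)%N}.

Lemma card_ltpair n : #|{: ltpair n}| = 'C(n, 2).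
Proof.
rewrite card_sig -sum1_card.
rewrite -(pair_big_dep xpredT (fun i j : 'I_n => i < j)%N (fun _ _ => 1%N)) /=.
rewrite (exchange_big_dep xpredT) //= -bin2_sum big_mkord.
apply: eq_bigr => j _.
rewrite -[RHS]card_ord -sum1_card (big_ord_widen_cond n xpredT (fun=> 1%N)) //.
exact: ltnW.
Qed.

Lemma card_ltpairS n : #|{: ltpair n.+1}| = (n + #|{: ltpair n}|)%N.
Proof. by rewrite !card_ltpair binS bin1 addnC. Qed.

(* The ambient Euclidean space is R^(n+1), so that n is the dimension of the
   sphere and the frames completing gamma are indexed by 'I_n. *)
Section RubberRolling.
Context {R : realType} {n : nat}.
Local Notation N := n.+1.
Variables (bI : 'End(so R N)) (eps : R).

(* (m, gamma) *)
Local Notation E0 := ('M[R]_N * 'cV[R]_N)%type.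
(* ((m, g), gamma), T^*SO being left-trivialised *)
Local Notation E := ('M[R]_N * 'M[R]_N * 'cV[R]_N)%type.

Definition red (x : E) : E0 := (x.1.1, x.2).

Definition ambient0 : set E0 := [set x | x.1 \in so_space R N /\ sphere x.2].

Definition ambient : set E := [set x | ambient0 (red x) /\ SO x.1.2].

Definition G0 : set E0 :=
  [set x | ambient0 x /\ pr_h x.2 (ang_vel bI x.1) = 0].

Definition G : set E :=
  [set x | ambient x /\ pr_h x.2 (ang_vel bI x.1.1) = 0].

Definition reduced_system (x u : E0) : Prop :=
  let: (m, g) := x in
  let w := vsval (ang_vel bI m) in
  exists lambda0 : so R N,
    [/\ lambda0 \in h_space g,
        pr_h g ((bI^-1)%VF (toso (lie m w) + lambda0)) = 0,
        u.1 = lie m w + vsval lambda0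
      & u.2 = - eps *: (w *m g)].

Definition full_system (x u : E) : Prop :=
  reduced_system (red x) (red u) /\
  u.1.2 = x.1.2 *m vsval (ang_vel bI x.1.1).

Definition local_frame (g0 : 'cV[R]_N) (e : 'I_n -> 'cV[R]_N -> 'cV[R]_N) :
    Prop :=
  exists U : set 'cV[R]_N,
    [/\ open U, U g0, forall i, smooth U (e i)
      & forall g, U g -> sphere g ->
          (forall i j, (e i g)^T *m e j g = (i == j)%:R%:M) /\
          (forall i, (e i g)^T *m g = 0)].

Definition phi_c (e : 'I_n -> 'cV[R]_N -> 'cV[R]_N) (ij : ltpair n)
    (x : E0) : R :=
  so_dot (ang_vel bI x.1)
         (vwedge (e (val ij).1 x.2) (e (val ij).2 x.2)).

(* Coordinates m_ij, i < j, are orthonormal for the pairing. *)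
Definition dm : form 'M[R]_N #|{: ltpair N}| :=
  bigwedge (fun (ij : ltpair N) a => a (val ij).1 (val ij).2).

Definition dgamma (g : 'cV[R]_N) : form 'cV[R]_N n := fun v =>
  \det (row_mx g (\matrix_(i < N, j < n) v j i 0) : 'M[R]_N).

(* Canonical 1-form of T^*SO: (a, b) |-> <m, g^-1 b>. *)
Definition liouville (x v : 'M[R]_N * 'M[R]_N) : R :=
  pairing x.1 (x.2^T *m v.2).

Definition Omega (x : 'M[R]_N * 'M[R]_N) : form ('M[R]_N * 'M[R]_N)%type 2 :=
  extd liouville x.

Definition Theta0 (x : E0) : form E0 (#|{: ltpair N}| + n) := fun v =>
  mu bI eps x.2 * fwedge (pull fst dm) (pull snd (dgamma x.2)) v.

(* dim SO = #|ltpair N| *)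
Definition Theta (x : E) : form E (#|{: ltpair N}| * 2 + n) := fun v =>
  mu bI eps x.2 *
  fwedge (pull fst (fpow (Omega x.1) #|{: ltpair N}|))
         (pull snd (dgamma x.2)) v.

Lemma deg0 : (#|{: ltpair N}| + n = (n + n) + #|{: ltpair n}|)%N.
Proof. by rewrite card_ltpairS addnAC. Qed.

Lemma deg : (#|{: ltpair N}| * 2 + n =
             (#|{: ltpair N}| + (n + n)) + #|{: ltpair n}|)%N.
Proof. by rewrite muln2 -addnn -addnA deg0 addnA. Qed.

Definition vol_G0 (x : E0) (theta : form E0 (n + n)) : Prop :=
  exists2 e, local_frame x.2 e &
    restriction (tangent ambient0 x) deg0 (Theta0 x)
      (fun ij v => 'D_v (phi_c e ij) x) theta.

Definition vol_G (x : E) (theta : form E (#|{: ltpair N}| + (n + n))) : Prop :=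
  exists2 e, local_frame x.2 e &
    restriction (tangent ambient x) deg (Theta x)
      (fun ij v => 'D_v (phi_c e ij \o red) x) theta.

End RubberRolling.

(* Main.v *)
(** Restricted to tuples of tangent vectors of the constraint manifold, the volume
    form is determined up to sign by its square: pairing it with the normal
    directions I(e_i /\ e_j) and using a Schur complement, one finds that
    theta(v_1, .., v_k)^2 is a universal constant times mu(gamma)^2 times the Gram
    determinant of the vectors (g^-1 dg, z, c), where c = dgamma,
    z = (I^-1 dm) gamma, and the first component is absent for the reduced system.

    Along the flow, the rows of these vectors, completed by (0, gamma, 0) and
    (0, 0, gamma), solve a linear equation W' = W B.  The multiplier is eliminated
    by applying the equation of motion to gamma, because an element of so(n) lies
    in h_gamma iff it kills gamma.  Write A for the matrix of I, J for
    z |-> z /\ gamma, a for ad omega, and H = J A J^T + gamma gamma^T.  Then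
    tr B = - tr (J A a J^T H^-1), whereas
    (det H)' / det H = 2 eps tr (J A a J^T H^-1).  Since Sylvester's identity gives
    det (I^-1 restricted to h_gamma) = det H / det A, the product of mu and det W
    is constant. *)

From HB Require Import structures.
From mathcomp Require Import all_boot all_order all_algebra all_fingroup.
From mathcomp Require Import ring.
From mathcomp Require Import all_classical all_reals all_analysis.
Require Import Defs.
Set Implicit Arguments.
Unset Strict Implicit.
Unset Printing Implicit Defensive.
Import Order.TTheory GRing.Theory Num.Theory.
Import numFieldNormedType.Exports.
Local Open Scope classical_set_scope.
Local Open Scope ring_scope.

(** * Alternating forms *)

(** The system is a relation known only on the constraint manifold, so there is no vector field on
    the ambient space whose Jacobian could be taken. The variational equation comes instead from
    following a curve inside the manifold that realises the tangent vector, and from exchanging the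
    time and space derivatives of the flow, which is smooth on an ambient open set. The spaces
    h_gamma and v_gamma move with gamma, and a basis chosen along the flow would bring its own
    derivative into the equation. Hence z and c stay in R^N, where both are orthogonal to gamma, and
    two extra rows fill the missing directions. The local frames at the two ends of a trajectory are
    unrelated, so their orientations cannot be compared; squares remove this sign. The universal
    constants are values of fixed forms on standard basis vectors. They occur identically at both
    ends and are never evaluated. The group component beta = g^-1 dg is driven by the reduced
    variables and has the traceless diagonal block - ad omega, so one computation serves both
    systems. *)

Section Forms.
Context {R : realType} {V : lmodType R}.
Implicit Types (p q k : nat).

Lemma updE k (v : 'I_k -> V) i u j : upd v i u j = if j == i then u else v j.
Proof. by []. Qed.

Lemma upd_reindex k k' (v : 'I_k -> V) (h : 'I_k' -> 'I_k) (i : 'I_k) u (j : 'I_k') :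
  injective h -> h j = i -> (fun x => upd v i u (h x)) = upd (fun x => v (h x)) j u.
Proof.
move=> hI <-; apply/funext => x; rewrite /upd; congr (if _ then _ else _).
exact: (inj_eq hI).
Qed.

Lemma upd_reindexN k k' (v : 'I_k -> V) (h : 'I_k' -> 'I_k) (i : 'I_k) u :
  (forall j, h j != i) -> (fun x => upd v i u (h x)) = (fun x => v (h x)).
Proof. by move=> hi; apply/funext => x; rewrite /upd (negbTE (hi x)). Qed.

Lemma form0 k (a : form V k) v i : is_form a -> v i = 0 -> a v = 0.
Proof.
move=> [al _] vi0; have := al v i (-1) 0 0.
have -> : upd v i 0 = v by apply/funext=> j; rewrite /upd; case: eqP => // ->.
rewrite scaleN1r oppr0 add0r.
have -> : upd v i 0 = v by apply/funext=> j; rewrite /upd; case: eqP => // ->.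
by rewrite mulN1r addNr.
Qed.

Lemma form_sum k (a : form V k) v i (I : finType) (c : I -> R) (w : I -> V) :
  is_form a ->
  a (upd v i (\sum_j c j *: w j)) = \sum_j c j * a (upd v i (w j)).
Proof.
move=> fa; have [al _] := fa.
elim/big_rec2: _ => [|j x y _ IH]; last by rewrite al IH.
by apply: (form0 (i := i) fa); rewrite updE eqxx.
Qed.

Lemma form_pull (W : lmodType R) (f : {linear W -> V}) k (a : form V k) :
  is_form a -> is_form (pull f a).
Proof.
move=> [al aa]; split=> [v i c u w|v i j ij vij]; last first.
  by rewrite /pull (aa _ i j) // vij.
have E x : (fun j => f (upd v i x j)) = upd (fun j => f (v j)) i (f x).
  by apply/funext => j; rewrite /upd; case: eqP.
by rewrite /pull !E linearP al.
Qed.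

(** Linearity in slot i: for each [s] exactly one factor reads that slot, according to the block of
    s^-1 i. Alternation: when v i = v j, composing [s] with the transposition of i and j changes
    only the sign, so the sum is its own opposite. *)
Lemma fwedge_is_form p q (a : form V p) (b : form V q) :
  is_form a -> is_form b -> is_form (fwedge a b).
Proof.
move=> fa fb; have [al aa] := fa; have [bl ba] := fb.
split=> [v i c u w|v i j ij vij].
  rewrite /fwedge mulrCA -mulrDr; congr (_ * _).
  rewrite mulr_sumr -big_split /=; apply: eq_bigr => s _.
  have sl : injective (fun i => s (lshift q i)) by move=> x y /perm_inj/lshift_inj.
  have sr : injective (fun i => s (rshift p i)) by move=> x y /perm_inj/rshift_inj.
  case: (split_ordP (s^-1 i)%g) => k Ek; have /esym sk : i = s (s^-1 i)%g by rewrite permKV.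
    rewrite Ek in sk; rewrite !(upd_reindex _ _ sl sk).
    have N x : s (rshift p x) != i by rewrite -sk (inj_eq perm_inj) eq_rlshift.
    by rewrite !(upd_reindexN _ _ N) al mulrDr mulrDl mulrCA -!mulrA.
  rewrite Ek in sk; rewrite !(upd_reindex _ _ sr sk).
  have N x : s (lshift q x) != i by rewrite -sk (inj_eq perm_inj) eq_lrshift.
  by rewrite !(upd_reindexN _ _ N) bl mulrDr mulrCA.
rewrite /fwedge; set S := \sum_s _.
suff : S = - S by move/eqP; rewrite -addr_eq0 -mulr2n mulrn_eq0 /= => /eqP ->; rewrite mulr0.
rewrite {1}/S (reindex_inj (mulIg (tperm i j))) /= -sumrN; apply: eq_bigr => s _.
rewrite odd_permM odd_tperm ij addbT signrN !mulNr.
have E x : v ((s * tperm i j)%g x) = v (s x).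
  by rewrite permM; case: tpermP => // ->.
by congr (- (_ * a _ * b _)); apply/funext => x; rewrite E.
Qed.

(** Polarising the vanishing on repeated arguments at u i + u j gives the sign of one transposition;
    a permutation is a product of transpositions. *)
Lemma form_perm k (a : form V k) (w : 'I_k -> V) (s : 'S_k) :
  is_form a -> a (fun i => w (s i)) = (-1) ^+ s * a w.
Proof.
move=> [al aa].
  have anti_tperm (u : 'I_k -> V) i j : i != j -> a (fun x => u (tperm i j x)) = - a u.
    move=> ij; pose F x y := a (upd (upd u i x) j y).
    have Fxx x : F x x = 0.
      apply: (aa _ i j ij); by rewrite /upd !eqxx (negbTE ij).
    have ji : j != i by rewrite eq_sym.
    have Fr x y y' : F x (y + y') = F x y + F x y'.
      by have := al (upd u i x) j 1 y y'; rewrite scale1r mul1r.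
    have swap x y : upd (upd u i x) j y = upd (upd u j y) i x.
      apply/funext => z; rewrite /upd; have [->|//] := eqVneq z j.
      by rewrite (negbTE ji).
    have Fl x x' y : F (x + x') y = F x y + F x' y.
      by rewrite /F !swap; have := al (upd u j y) i 1 x x'; rewrite scale1r mul1r.
    have := Fxx (u i + u j); rewrite Fl !Fr !Fxx addr0 add0r => /eqP.
    rewrite addrC addr_eq0 => /eqP E.
    have -> : (fun x => u (tperm i j x)) = upd (upd u i (u j)) j (u i).
      apply/funext => x; rewrite /upd; case: tpermP => [->|->|].
      - by rewrite (negbTE ij) eqxx.
      - by rewrite eqxx.
      by move=> /eqP/negbTE ni /eqP/negbTE nj; rewrite ni nj.
    rewrite -[LHS]/(F (u j) (u i)) E; congr (- a _).
    apply/funext => x; rewrite /upd; have [->|_] // := eqVneq x j.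
    by have [->|] := eqVneq x i.
  have [ts -> /allP tsP] := prod_tpermP s.
  elim: ts tsP w => [_ u|t ts IH tsP u].
    rewrite big_nil odd_perm1 mul1r; congr a.
    by apply/funext => i; rewrite perm1.
  rewrite big_cons odd_mul_tperm.
  have td : t.1 != t.2 by apply: tsP; rewrite inE eqxx.
  rewrite td signr_addb.
  have {}IH : forall u, _ := IH (fun t' t's => tsP t' (@mem_behead _ (t :: ts) t' t's)).
  have -> : (fun i => u ((tperm t.1 t.2 * \prod_(j <- ts) tperm j.1 j.2)%g i)) =
     (fun i => (fun x => u ((\prod_(j <- ts) tperm j.1 j.2)%g x)) (tperm t.1 t.2 i)).
    by apply/funext => i; rewrite permM.
  by rewrite (anti_tperm (fun x => u ((\prod_(j <- ts) tperm j.1 j.2)%g x))) // IH expr1 mulN1r mulNr.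
Qed.

(* Expand every argument; only the terms indexed by permutations survive. *)
Lemma form_det k (a : form V k) (M : 'M[R]_k) (w : 'I_k -> V) :
  is_form a -> a (fun i => \sum_j M i j *: w j) = \det M * a w.
Proof.
move=> fa; have [al aa] := fa.
pose v0 := fun i => \sum_j M i j *: w j.
(* Only the arguments in [s] are expanded. Requiring [f] to be the identity outside [s] counts each
   choice of indices once. *)
have expand (s : seq 'I_k) : uniq s ->
    forall v, a (fun i => if i \in s then v0 i else v i) =
    \sum_(f : {ffun 'I_k -> 'I_k} | [forall i, (i \in s) || (f i == i)])
       (\prod_(i <- s) M i (f i)) * a (fun i => if i \in s then w (f i) else v i).
  elim: s => [_ v|x s IHs /= /andP[xs us] v].
    rewrite (big_pred1 [ffun i => i]) => [|f].
      by rewrite big_nil mul1r.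
    apply/forallP/eqP => [fi|-> i]; last by rewrite ffunE eqxx.
    by apply/ffunP => i; rewrite ffunE; apply/eqP; have := fi i.
  have E : (fun i => if i \in x :: s then v0 i else v i) =
      upd (fun i => if i \in s then v0 i else v i) x (\sum_j M x j *: w j).
    apply/funext => i; rewrite /upd inE.
    by have [->|] := eqVneq i x.
  rewrite E form_sum //.
  transitivity (\sum_j \sum_(f : {ffun 'I_k -> 'I_k} | [forall i, (i \in s) || (f i == i)])
     M x j * (\prod_(i <- s) M i (f i)) *
     a (fun i => if i \in s then w (f i) else upd v x (w j) i)).
    apply: eq_bigr => j _.
    have -> : upd (fun i => if i \in s then v0 i else v i) x (w j) =
      (fun i => if i \in s then v0 i else upd v x (w j) i).
      apply/funext => i; rewrite /upd.
      by have [->|//] := eqVneq i x; rewrite (negbTE xs).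
    by rewrite IHs // mulr_sumr; apply: eq_bigr => f _; rewrite mulrA.
  rewrite (partition_big (fun f : {ffun 'I_k -> 'I_k} => f x) xpredT) //=.
  apply: eq_bigr => j _.
  (* A map with value j at x corresponds to the same map reset to the identity at x. *)
  rewrite (reindex_onto (fun f : {ffun 'I_k -> 'I_k} => [ffun i => if i == x then x else f i])
     (fun f : {ffun 'I_k -> 'I_k} => [ffun i => if i == x then j else f i])) /=; last first.
    move=> f /forallP fP; apply/ffunP => i; rewrite !ffunE.
    have [->|//] := eqVneq i x.
    by have := fP x; rewrite (negbTE xs) /= => /eqP.
  apply: eq_big => [f|f /andP[_ /eqP fj]].
    apply/idP/idP => [/andP[/forallP fP /eqP fj]|/andP[/forallP fP /eqP fj]].
      apply/andP; split; last first.
        by rewrite -fj !ffunE eqxx.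
      apply/forallP => i; have := fP i; rewrite !ffunE inE.
      by have [->|] := eqVneq i x.
    apply/andP; split; last first.
      apply/eqP/ffunP => i; rewrite !ffunE; have [->|//] := eqVneq i x.
      by rewrite fj.
    apply/forallP => i; have := fP i; rewrite !ffunE inE.
    by have [->|] := eqVneq i x; rewrite ?eqxx ?orbT.
  rewrite big_cons; have -> : f x = j by rewrite -fj !ffunE eqxx.
  congr (_ * _ * a _).
    apply: eq_big_seq => i si; rewrite ffunE.
    by case: eqP => // ix; rewrite -ix si in xs.
  apply/funext => i; rewrite /upd inE ffunE.
  have [->|] := eqVneq i x; last by [].
  by rewrite (negbTE xs) -fj !ffunE eqxx.
have := expand (enum 'I_k) (enum_uniq _) v0.
have -> : (fun i => if i \in enum 'I_k then v0 i else v0 i) = v0.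
  by apply/funext => i; case: ifP.
move=> ->; rewrite /determinant mulr_suml.
transitivity (\sum_(f : {ffun 'I_k -> 'I_k} | injectiveb f)
    (\prod_i M i (f i)) * a (fun i => w (f i))).
  rewrite [LHS](bigID (fun f : {ffun 'I_k -> 'I_k} => injectiveb f)) /=.
  rewrite [X in _ + X]big1 => [|f /andP[_ /injectivePn[i [j ij fij]]]].
    rewrite addr0; apply: eq_big => f.
      by rewrite andb_idl // => _; apply/forallP => i; rewrite mem_enum.
    move=> _; rewrite big_enum; congr (_ * a _).
    by apply/funext => i; rewrite mem_enum.
  by rewrite (aa _ i j) ?mulr0 // !mem_enum /= fij.
rewrite (reindex (fun s : 'S_k => pval s)) /=; last first.
  exists (fun f => insubd (1%g : 'S_k) f) => [s _|f fi].
    by rewrite valKd.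
  by rewrite insubdK.
apply: eq_big => [s|s _]; first by rewrite (valP s).
by rewrite pvalE (form_perm w s fa) mulrCA mulrA.
Qed.

(** Transfers a wedge product between two spaces by comparing values on subfamilies only. The factor
    [c] will carry the determinant of an orthonormal frame. *)
Lemma fwedge_ext (W : lmodType R) p q (a : form V p) (b : form V q)
    (a' : form W p) (b' : form W q) (c : R) (v : 'I_(p + q) -> V) (w : 'I_(p + q) -> W) :
  (forall h, a (fun i => v (h i)) = a' (fun i => w (h i))) ->
  (forall h, b (fun i => v (h i)) = c * b' (fun i => w (h i))) ->
  fwedge a b v = c * fwedge a' b' w.
Proof.
move=> ea eb; rewrite /fwedge mulrCA; congr (_ * _); rewrite mulr_sumr.
by apply: eq_bigr => s _; rewrite ea eb !mulrA (mulrC c) -!mulrA (mulrCA c).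
Qed.

Lemma fpow_ext (W : lmodType R) p (a : form V p) (a' : form W p) k
    (v : 'I_(k * p) -> V) (w : 'I_(k * p) -> W) :
  (forall h, a (fun i => v (h i)) = a' (fun i => w (h i))) ->
  fpow a k v = fpow a' k w.
Proof.
elim: k v w => [//|k IH] v w H /=.
rewrite -[RHS]mul1r; apply: fwedge_ext => h; first exact: H.
by rewrite mul1r; apply: IH => h'; exact: H.
Qed.

Lemma fpow_is_form p (a : form V p) k : is_form a -> is_form (fpow a k).
Proof.
move=> fa; elim: k => [|k IH] /=; last exact: fwedge_is_form.
by split=> [v []|v []].
Qed.

Lemma bigwedge_is_form (I : finType) (l : I -> V -> R) :
  (forall i, linear (l i : V -> R^o)) -> is_form (bigwedge l).
Proof.
move=> ll; split=> [v i c u w|v i j ij vij]; rewrite /bigwedge -det_tr; last first.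
  by apply: (determinant_alternate ij) => k; rewrite !mxE vij.
rewrite -[in RHS]det_tr -[X in _ = _ + X]det_tr -[X in _ = _ + X]mul1r.
apply: (determinant_multilinear (i0 := i)).
- by apply/rowP => k; rewrite !mxE mul1r /upd eqxx ll.
- by apply/matrixP => k m; rewrite !mxE /upd eq_sym (negbTE (neq_lift _ _)).
by apply/matrixP => k m; rewrite !mxE /upd eq_sym (negbTE (neq_lift _ _)).
Qed.

Definition joinf p q (v : 'I_p -> V) (u : 'I_q -> V) (i : 'I_(p + q)) : V :=
  match fintype.split i with inl j => v j | inr j => u j end.

Lemma joinfl p q (v : 'I_p -> V) (u : 'I_q -> V) i : joinf v u (lshift q i) = v i.
Proof. by rewrite /joinf (unsplitK (inl i)). Qed.

Lemma joinfr p q (v : 'I_p -> V) (u : 'I_q -> V) i : joinf v u (rshift p i) = u i.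
Proof. by rewrite /joinf (unsplitK (inr i)). Qed.

Definition stable_right p q (s : 'S_(p + q)) :=
  [forall j : 'I_q, exists k : 'I_q, s (rshift p j) == rshift p k].

(** By injectivity and counting, [s] maps the right block onto itself, so no index of the left block
    can land there. *)
Lemma stable_rightP p q (s : 'S_(p + q)) :
  stable_right s -> forall i : 'I_p, exists k : 'I_p, s (lshift q i) = lshift q k.
Proof.
move=> /forallP sR i.
pose A := [set rshift p j | j : 'I_q]%SET.
have AE x : (x \in A) = [exists j, x == rshift p j].
  by apply/imsetP/existsP => [[j _ ->]|[j /eqP ->]]; exists j.
have sA : s @: A = A.
  apply/eqP; rewrite eqEcard (card_imset _ (@perm_inj _ s)) leqnn andbT.
  apply/fintype.subsetP => _ /imsetP[x + ->]; rewrite !AE => /existsP[j /eqP ->].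
  exact: sR.
case: (split_ordP (s (lshift q i))) => [k ->|k E]; first by exists k.
have : s (lshift q i) \in A by rewrite AE E; apply/existsP; exists k.
rewrite -sA (mem_imset _ _ (@perm_inj _ s)) AE.
by case/existsP => j; rewrite eq_lrshift.
Qed.

(* The number of block-preserving permutations is [p! * q!], but all that matters
   is that it is nonzero. *)
Definition wedge_const p q : R :=
  ((p`! * q`!)%:R)^-1 * #|@stable_right p q|%:R.

Lemma wedge_const_neq0 p q : wedge_const p q != 0.
Proof.
rewrite mulf_neq0 // ?invr_eq0 pnatr_eq0 -lt0n ?muln_gt0 ?fact_gt0 //.
apply/card_gt0P; exists 1%g; apply/forallP => j.
by apply/existsP; exists j; rewrite perm1.
Qed.

(* Only the permutations that preserve the two blocks contribute, and all of
   them contribute the same. *)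
Lemma fwedge_joinf p q (a : form V p) (b : form V q) (v : 'I_p -> V) (u : 'I_q -> V) :
  is_form a -> is_form b ->
  (forall w j i, w j = v i -> b w = 0) ->
  fwedge a b (joinf v u) = wedge_const p q * (a v * b u).
Proof.
move=> fa fb b0; rewrite /fwedge /wedge_const -mulrA; congr (_ * _).
rewrite (bigID (@stable_right p q)) /= [X in _ + X]big1 => [|s]; last first.
  rewrite negb_forall => /existsP[j /existsPn sj].
  case: (split_ordP (s (rshift p j))) => [k E|k E].
    by rewrite [b _](b0 _ j k) ?mulr0 // E joinfl.
  by have := sj k; rewrite E eqxx.
(* The permutation matrix of [s] is block diagonal. Applying [form_det] to each block gives two
   determinants whose product is the sign of [s], which cancels. *)
have E s : stable_right s -> (-1) ^+ s * a (fun i => joinf v u (s (lshift q i))) *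
    b (fun j => joinf v u (s (rshift p j))) = a v * b u.
  move=> sR; have sL := stable_rightP sR.
  have ulE : ursubmx (perm_mx s : 'M[R]_(p + q)) = 0.
    apply/matrixP => i j; rewrite !mxE; have [k ->] := sL i.
    by rewrite eq_lrshift.
  have dlE : dlsubmx (perm_mx s : 'M[R]_(p + q)) = 0.
    apply/matrixP => i j; rewrite !mxE; have /existsP[k /eqP ->] := forallP sR i.
    by rewrite eq_rlshift.
  have sE : \det (ulsubmx (perm_mx s)) * \det (drsubmx (perm_mx s)) = (-1) ^+ s :> R.
    by rewrite -det_perm -[in RHS](submxK (perm_mx s)) ulE det_lblock.
  have -> : (fun i => joinf v u (s (lshift q i))) =
     (fun i => \sum_j (ulsubmx (perm_mx s)) i j *: v j).
    apply/funext => i; have [k E] := sL i; rewrite E joinfl (bigD1 k) //= big1 => [|j jk].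
      by rewrite !mxE E eqxx scale1r addr0.
    by rewrite !mxE E (inj_eq (@lshift_inj _ _)) eq_sym (negbTE jk) scale0r.
  have -> : (fun i => joinf v u (s (rshift p i))) =
     (fun i => \sum_j (drsubmx (perm_mx s)) i j *: u j).
    apply/funext => i; have /existsP[k /eqP E] := forallP sR i.
    rewrite E joinfr (bigD1 k) //= big1 => [|j jk].
      by rewrite !mxE E eqxx scale1r addr0.
    by rewrite !mxE E (inj_eq (@rshift_inj _ _)) eq_sym (negbTE jk) scale0r.
  by rewrite !form_det // -!mulrA (mulrCA (a v)) (mulrA (\det _)) sE signrMK.
rewrite (eq_bigr (fun=> a v * b u)) => [|s sR]; last exact: E.
rewrite sumr_const addr0 -[LHS]mulr_natl; congr (_%:R * _).
Qed.

(** Squaring turns the change-of-basis determinant into a Gram determinant, which typechecks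
    although [M] is square only up to a cast. *)
Lemma form_gram p p' p0 (e : p = p') (e0 : p = p0) (a : form V p)
    (M : 'M[R]_(p', p0)) (v : 'I_p' -> V) (w : 'I_p0 -> V) :
  is_form a -> (forall i, v i = \sum_j M i j *: w j) ->
  (fcast e a v) ^+ 2 = \det (M *m M^T) * (fcast e0 a w) ^+ 2.
Proof.
case: p' / e M v; case: p0 / e0 w => w M v fa vE.
have castE (x : 'I_p -> V) : (fun i => x (cast_ord (erefl p) i)) = x.
  by apply/funext => i; rewrite cast_ord_id.
rewrite /fcast !castE; have -> : v = (fun i => \sum_j M i j *: w j) by exact/funext.
by rewrite form_det // det_mulmx det_tr exprMn expr2.
Qed.

End Forms.

(** * Differentiation of matrix-valued functions *)

Section MatrixDerivative.
Context {R : realType}.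

Lemma derD (f g : R -> R) t a b : is_derive t (1 : R) f a -> is_derive t (1 : R) g b ->
  is_derive t (1 : R) (fun s => f s + g s) (a + b).
Proof. by move=> fa gb; apply: is_deriveD. Qed.

Lemma derM (f g : R -> R) t a b : is_derive t (1 : R) f a -> is_derive t (1 : R) g b ->
  is_derive t (1 : R) (fun s => f s * g s) (a * g t + f t * b).
Proof.
move=> fa gb; have fgd := is_deriveM fa gb; apply: is_derive_eq fgd _.
by rewrite addrC /GRing.scale /= mulrC.
Qed.

Lemma derC (c : R) t : is_derive t (1 : R) (fun=> c) 0.
Proof. exact: is_derive_cst. Qed.

Lemma der_sum (I : Type) (r : seq I) (P : pred I) (f : I -> R -> R) (f' : I -> R) t :
  (forall i, is_derive t (1 : R) (f i) (f' i)) ->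
  is_derive t (1 : R) (fun s => \sum_(i <- r | P i) f i s) (\sum_(i <- r | P i) f' i).
Proof.
move=> fd; elim: r => [|i r IH].
  rewrite big_nil; have -> : (fun s => \sum_(i <- [::] | P i) f i s) = (fun=> 0).
    by apply/funext => s; rewrite big_nil.
  exact: derC.
rewrite big_cons; case: (boolP (P i)) => Pi.
  have -> : (fun s => \sum_(i <- i :: r | P i) f i s) =
      (fun s => f i s + \sum_(i <- r | P i) f i s).
    by apply/funext => s; rewrite big_cons Pi.
  exact: derD.
have -> : (fun s => \sum_(i <- i :: r | P i) f i s) = (fun s => \sum_(i <- r | P i) f i s) => //.
by apply/funext => s; rewrite big_cons (negbTE Pi).
Qed.

Lemma der_prod (I : eqType) (r : seq I) (f : I -> R -> R) (f' : I -> R) t :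
  uniq r -> (forall i, is_derive t (1 : R) (f i) (f' i)) ->
  is_derive t (1 : R) (fun s => \prod_(i <- r) f i s)
    (\sum_(i <- r) f' i * \prod_(j <- r | j != i) f j t).
Proof.
move=> + fd; elim: r => [_|i r IH /= /andP[ir ur]].
  rewrite big_nil; have -> : (fun s => \prod_(i <- [::]) f i s) = (fun=> 1).
    by apply/funext => s; rewrite big_nil.
  exact: derC.
have -> : (fun s => \prod_(i <- i :: r) f i s) = (fun s => f i s * \prod_(i <- r) f i s).
  by apply/funext => s; rewrite big_cons.
apply: is_derive_eq; first exact: (derM (fd i) (IH ur)).
rewrite big_cons big_cons eqxx mulr_sumr; congr (_ * _ + _).
  rewrite big_seq [RHS]big_seq_cond; apply: eq_bigl => j.
  by apply/idP/andP => [jr|[]//]; split=> //; apply: contraNneq ir => <-.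
apply: eq_big_seq => j jr; rewrite big_cons.
have -> : i != j by apply: contraNneq ir => ->.
by rewrite mulrCA.
Qed.

Definition mxder p q (X : R -> 'M[R]_(p, q)) (t : R) (X' : 'M[R]_(p, q)) :=
  forall i j, is_derive t (1 : R) (fun s => X s i j) (X' i j).

Lemma mxder_eq p q (X : R -> 'M[R]_(p, q)) t X' X'' :
  mxder X t X' -> X' = X'' -> mxder X t X''.
Proof. by move=> ? <-. Qed.

Lemma mxder_near p q (X Y : R -> 'M[R]_(p, q)) t X' :
  (\forall s \near t, X s = Y s) -> mxder X t X' -> mxder Y t X'.
Proof.
move=> XY dX i j; apply: near_eq_is_derive (dX i j).
by apply: filterS XY => s /= ->.
Qed.

Lemma mxder_unique p q (X : R -> 'M[R]_(p, q)) t X' X'' :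
  mxder X t X' -> mxder X t X'' -> X' = X''.
Proof.
move=> d d'; apply/matrixP => i j.
by have [_ <-] := d i j; have [_ <-] := d' i j.
Qed.

Lemma mxderC p q (A : 'M[R]_(p, q)) t : mxder (fun=> A) t 0.
Proof. by move=> i j; rewrite mxE; exact: derC. Qed.

Lemma mxderD p q (X Y : R -> 'M[R]_(p, q)) t X' Y' :
  mxder X t X' -> mxder Y t Y' -> mxder (fun s => X s + Y s) t (X' + Y').
Proof.
move=> dX dY i j; rewrite mxE.
have -> : (fun s => (X s + Y s) i j) = (fun s => X s i j + Y s i j).
  by apply/funext => s; rewrite mxE.
exact: derD.
Qed.

Lemma mxderM p q r (X : R -> 'M[R]_(p, q)) (Y : R -> 'M[R]_(q, r)) t X' Y' :
  mxder X t X' -> mxder Y t Y' ->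
  mxder (fun s => X s *m Y s) t (X' *m Y t + X t *m Y').
Proof.
move=> dX dY i j; rewrite !mxE.
have -> : (fun s => (X s *m Y s) i j) = (fun s => \sum_k X s i k * Y s k j).
  by apply/funext => s; rewrite mxE.
rewrite -big_split /=; apply: der_sum => k.
exact: derM.
Qed.

Lemma mxderZ p q (c : R) (X : R -> 'M[R]_(p, q)) t X' :
  mxder X t X' -> mxder (fun s => c *: X s) t (c *: X').
Proof.
move=> dX i j; rewrite mxE.
have -> : (fun s => (c *: X s) i j) = (fun s => c * X s i j).
  by apply/funext => s; rewrite mxE.
by apply: is_derive_eq; [exact: (derM (derC c t) (dX i j))|rewrite mul0r add0r].
Qed.

Lemma mxderN p q (X : R -> 'M[R]_(p, q)) t X' :
  mxder X t X' -> mxder (fun s => - X s) t (- X').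
Proof.
move=> dX; apply: mxder_eq (_ : - 1 *: X' = _); last by rewrite scaleN1r.
have -> : (fun s => - X s) = (fun s => -1 *: X s).
  by apply/funext => s; rewrite scaleN1r.
exact: mxderZ.
Qed.

Lemma mxderB p q (X Y : R -> 'M[R]_(p, q)) t X' Y' :
  mxder X t X' -> mxder Y t Y' -> mxder (fun s => X s - Y s) t (X' - Y').
Proof. by move=> dX dY; apply: mxderD => //; exact: mxderN. Qed.

Lemma mxderT p q (X : R -> 'M[R]_(p, q)) t X' :
  mxder X t X' -> mxder (fun s => (X s)^T) t X'^T.
Proof.
move=> dX i j; rewrite mxE.
have -> : (fun s => (X s)^T i j) = (fun s => X s j i); last exact: dX.
by apply/funext => s; rewrite mxE.
Qed.

(** In the basis [delta_mx], [f] is a finite combination of entries with constant coefficients. *)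
Lemma mxder_lin p q p' q' (f : 'M[R]_(p, q) -> 'M[R]_(p', q')) X t X' :
  linear f -> mxder X t X' -> mxder (fun s => f (X s)) t (f X').
Proof.
move=> lf dX; pose F : {linear 'M[R]_(p, q) -> 'M[R]_(p', q')} :=
  HB.pack f (GRing.isLinear.Build _ _ _ _ _ lf).
have fE Y i j : f Y i j = \sum_k \sum_l Y k l * f (delta_mx k l) i j.
  rewrite -[f]/(F : _ -> _) {1}(matrix_sum_delta Y) linear_sum summxE.
  apply: eq_bigr => k _; rewrite linear_sum summxE.
  by apply: eq_bigr => l _; rewrite linearZ mxE.
move=> i j; rewrite fE.
have -> : (fun s => f (X s) i j) = (fun s => \sum_k \sum_l X s k l * f (delta_mx k l) i j).
  by apply/funext => s; rewrite fE.
apply: der_sum => k; apply: der_sum => l.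
apply: is_derive_eq; first exact: (derM (dX k l) (derC _ t)).
by rewrite mulr0 addr0.
Qed.

(** Jacobi's formula: differentiating the Leibniz sum replaces one row at a time, and expanding
    along that row produces the cofactors. *)
Lemma der_det p (X : R -> 'M[R]_p) t X' :
  mxder X t X' -> is_derive t (1 : R) (fun s => \det (X s)) (\tr (X' *m \adj (X t))).
Proof.
move=> dX.
apply: is_derive_eq.
  apply: (@der_sum _ _ _ (fun (s : 'S_p) u => (-1) ^+ s * \prod_i X u i (s i))) => s.
  apply: (derM (derC ((-1) ^+ s) t)).
  by apply: der_prod => [|i]; [exact: index_enum_uniq|exact: dX].
pose Y i := \matrix_(k, l) (if k == i then X' k l else X t k l).
transitivity (\sum_i \det (Y i)).
  rewrite exchange_big /=; apply: eq_bigr => s _.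
  rewrite mul0r add0r mulr_sumr; apply: eq_bigr => i _.
  congr (_ * _); rewrite [RHS](bigD1 i) //= mxE eqxx; congr (_ * _).
  by apply: eq_bigr => j ji; rewrite mxE (negbTE ji).
rewrite /mxtrace; apply: eq_bigr => i _; rewrite (expand_det_row _ i) mxE.
apply: eq_bigr => j _; rewrite !mxE eqxx; congr (_ * (_ * \det _)).
by apply/matrixP => k l; rewrite !mxE eq_sym (negbTE (neq_lift _ _)).
Qed.

(** Liouville's formula for the linear equation X' = X B. *)
Lemma der_det_mulr p (X : R -> 'M[R]_p) t B :
  mxder X t (X t *m B) ->
  is_derive t (1 : R) (fun s => \det (X s)) (\tr B * \det (X t)).
Proof.
move=> dX; apply: is_derive_eq; first exact: (der_det dX).
by rewrite -mulmxA mxtrace_mulC -mulmxA mul_adj_mx mul_mx_scalar mxtraceZ mulrC.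
Qed.

Lemma der_det_cast p q (e : q = p) (X : R -> 'M[R]_(p, q)) t B :
  mxder X t (X t *m B) ->
  is_derive t (1 : R) (fun s => \det (castmx (erefl p, e) (X s)))
    (\tr B * \det (castmx (erefl p, e) (X t))).
Proof. by case: p / e X => X; exact: der_det_mulr. Qed.

Lemma det_cast_sqr p q (e : q = p) (X : 'M[R]_(p, q)) :
  \det (castmx (erefl p, e) X) ^+ 2 = \det (X *m X^T).
Proof. by case: p / e X => X; rewrite castmx_id det_mulmx det_tr expr2. Qed.

Lemma der_const_itv (J : set R) (f : R -> R) (a b : R) :
  is_interval J -> (forall t, J t -> is_derive t (1 : R) f 0) -> J a -> J b -> f a = f b.
Proof.
move=> Ji Jf; wlog ab : a b / a <= b => [H Ja Jb|Ja Jb].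
  by have [ab|/ltW ba] := leP a b; [exact: H|apply/esym/H].
have d x : x \in `[a, b]%R -> is_derive x (1 : R) f 0.
  by rewrite in_itv => xab; apply: Jf; apply: (Ji a b).
have dI x : x \in `]a, b[%R -> is_derive x (1 : R) f ((fun=> 0) x).
  by move=> xab; apply: d; apply: subset_itv_oo_cc xab.
have fc : {within `[a, b], continuous f}.
  by apply: derivable_within_continuous => x xab; have [] := d x xab.
have [c _] := MVT_segment ab dI fc.
by rewrite mul0r => /eqP; rewrite subr_eq0 => /eqP.
Qed.

End MatrixDerivative.

(** * Symmetry of second derivatives and the variational equation *)

Section Calculus.
Context {R : realType}.

Lemma is_derive_line (V W : normedModType R) (f : V -> W) (u q : V) (s : R) d :
  is_derive (s *: u + q) u f d -> is_derive s (1 : R) (fun r => f (r *: u + q)) d.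
Proof.
have E : (fun h : R => h^-1 *: (f ((h *: (1 : R) + s) *: u + q) - f (s *: u + q))) =
         (fun h : R => h^-1 *: (f (h *: u + (s *: u + q)) - f (s *: u + q))).
  by apply/funext => h; rewrite scalerDl -addrA [h *: (1 : R)]mulr1.
case=> fd fE; apply: DeriveDef; first by rewrite /derivable /= E.
by rewrite /derive /= E.
Qed.

Lemma is_derive_chain (V W : normedModType R) (f : V -> W) (c : R -> V) (s : R) v :
  differentiable f (c s) -> is_derive s (1 : R) c v ->
  is_derive s (1 : R) (fun r => f (c r)) ('D_v f (c s)).
Proof.
move=> fd [cd cE].
have cd' : differentiable c s by apply/derivable1_diffP.
have fcd : differentiable (f \o c) s by exact: differentiable_comp.
apply: DeriveDef; first exact: diff_derivable.
by rewrite -[LHS]/('D_1 (f \o c) s) deriveE // diff_comp //= -(deriveE (1 : R) cd') cE -deriveE.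
Qed.

(** The mean value theorem needs real values, so the symmetry of second derivatives of a
    vector-valued map is tested against such functionals; in use they are matrix entries. *)
Definition functional (V : normedModType R) (l : V -> R) :=
  (forall a x y, l (a *: x + y) = a * l x + l y) /\ continuous l.

Lemma is_derive_functional (V : normedModType R) (l : V -> R) (W : normedModType R)
    (f : W -> V) x v d :
  functional l -> is_derive x v f d -> is_derive x v (fun y => l (f y)) (l d).
Proof.
move=> [ll lc] [fd fE].
have l0 : l 0 = 0 by have := ll (-1) 0 0; rewrite scaleN1r addr0 oppr0 mulN1r addNr.
have E : (fun h : R => h^-1 *: (l (f (h *: v + x)) - l (f x))) =
    l \o (fun h : R => h^-1 *: (f (h *: v + x) - f x)).
  apply/funext => h /=.
  have := ll h^-1 (f (h *: v + x) - f x) 0; rewrite !addr0 l0 addr0 => ->.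
  have -> : f (h *: v + x) - f x = -1 *: f x + f (h *: v + x) by rewrite scaleN1r addrC.
  by rewrite ll mulN1r [in RHS]addrC.
have C : l (h^-1 *: (f (h *: v + x) - f x)) @[h --> 0^'] --> l d.
  apply: (@cvg_comp _ _ _ _ l); last exact: lc.
  by rewrite -fE; exact: fd.
apply: DeriveDef.
  by apply/cvg_ex; exists (l d) => /=; rewrite E.
by apply/cvg_lim => //; rewrite /= E.
Qed.

(* The mean value theorem twice, once in each direction. *)
Lemma second_difference (V : normedModType R) (U : set V) (f : V -> R) (u v p : V) (h : R) :
  0 < h ->
  (forall x, U x -> derivable f x u) ->
  (forall x, U x -> derivable (fun y => 'D_u f y) x v) ->
  (forall s t, 0 <= s <= h -> 0 <= t <= h -> U (s *: u + (t *: v + p))) ->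
  exists s t, [/\ 0 <= s <= h, 0 <= t <= h &
    f (h *: u + (h *: v + p)) - f (h *: u + p) - f (h *: v + p) + f p =
    h * (h * 'D_v (fun y => 'D_u f y) (s *: u + (t *: v + p)))].
Proof.
move=> h0 fu fuv inU.
have I0 : 0 <= (0 : R) <= h by rewrite lexx ltW.
have Ih : 0 <= h <= h by rewrite lexx ltW.
have inU0 s : 0 <= s <= h -> U (s *: u + p).
  by move=> sh; have := inU s 0 sh I0; rewrite scale0r add0r.
pose g (s : R) := f (s *: u + (h *: v + p)) - f (s *: u + p).
have gd s : 0 <= s <= h ->
    is_derive s (1 : R) g ('D_u f (s *: u + (h *: v + p)) - 'D_u f (s *: u + p)).
  move=> sh; apply: is_deriveB; apply: is_derive_line; apply/derivableP; apply: fu.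
    exact: inU.
  exact: inU0.
have gI s : s \in `]0, h[%R ->
    is_derive s (1 : R) g ('D_u f (s *: u + (h *: v + p)) - 'D_u f (s *: u + p)).
  by move=> /subset_itv_oo_cc sh; apply: gd; rewrite in_itv in sh.
have gc : {within `[0, h], continuous g}.
  by apply: derivable_within_continuous => s; rewrite in_itv => /gd[].
have [s sh gE] := MVT_segment (ltW h0) gI gc.
rewrite in_itv /= in sh.
pose k (t : R) := 'D_u f (t *: v + (s *: u + p)).
have kd t : 0 <= t <= h ->
    is_derive t (1 : R) k ('D_v (fun y => 'D_u f y) (t *: v + (s *: u + p))).
  move=> th; apply: (@is_derive_line _ _ (fun y => 'D_u f y)); apply/derivableP; apply: fuv.
  by rewrite addrCA; exact: inU.
have kI t : t \in `]0, h[%R ->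
    is_derive t (1 : R) k ('D_v (fun y => 'D_u f y) (t *: v + (s *: u + p))).
  by move=> /subset_itv_oo_cc th; apply: kd; rewrite in_itv in th.
have kc : {within `[0, h], continuous k}.
  by apply: derivable_within_continuous => t; rewrite in_itv => /kd[].
have [t th kE] := MVT_segment (ltW h0) kI kc.
rewrite in_itv /= in th.
exists s, t; split=> //.
have -> : s *: u + (t *: v + p) = t *: v + (s *: u + p) by rewrite addrCA.
move: gE kE; rewrite /g /k !scale0r !add0r !subr0 => gE kE.
rewrite (addrCA (s *: u)) kE in gE.
by rewrite mulrA [RHS]mulrC mulrA -gE opprB [RHS]addrA [RHS]addrAC.
Qed.

Lemma ler_dist_half (a b c e : R) : `|a - c| <= e / 2 -> `|b - c| <= e / 2 -> `|a - b| <= e.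
Proof.
move=> ac bc; apply: (le_trans (ler_distD c a b)).
by rewrite [e]splitr lerD // distrC.
Qed.

(** Read in the two orders, the same second difference equals h^2 times either mixed derivative at
    some point of a small parallelogram at [p]; by continuity both are close to their values at
    [p]. *)
Lemma derive_comm (V : normedModType R) (U : set V) (f : V -> R) (u v p : V) :
  open U -> U p ->
  (forall w x, U x -> derivable f x w) ->
  (forall w w' x, U x -> derivable (fun y => 'D_w f y) x w') ->
  (forall w w', {for p, continuous (fun x => 'D_w' (fun y => 'D_w f y) x)}) ->
  'D_v (fun y => 'D_u f y) p = 'D_u (fun y => 'D_v f y) p.
Proof.
move=> oU Up fd fdd fc.
apply/eqP; rewrite -subr_eq0 -normr_le0; apply/ler_addgt0Pl => e e0; rewrite addr0.
have e20 : 0 < e / 2 by rewrite divr_gt0.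
have /cvgrPdist_le/(_ _ e20) F1 := fc u v.
have /cvgrPdist_le/(_ _ e20) F2 := fc v u.
have F3 : \forall x \near p, U x by exact: open_nbhs_nbhs.
pose P x := [/\ U x, `|'D_v (fun y => 'D_u f y) p - 'D_v (fun y => 'D_u f y) x| <= e / 2
   & `|'D_u (fun y => 'D_v f y) p - 'D_u (fun y => 'D_v f y) x| <= e / 2].
have /nbhs_ballP[r /= r0 Pr] : \forall x \near p, P x.
  apply: filterS3 F3 F1 F2 => x Ux H1 H2.
  by split; [exact: Ux|exact: H1|exact: H2].
(* The parallelogram of side [h] then stays within r / 2 of [p]; the summand 1 keeps the divisor
   positive when u = v = 0. *)
pose h := r / 2 / (`|u| + `|v| + 1).
have d0 : 0 < `|u| + `|v| + 1 by rewrite ltr_wpDl // addr_ge0.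
have h0 : 0 < h by rewrite !divr_gt0.
have inP s t : 0 <= s <= h -> 0 <= t <= h -> P (s *: u + (t *: v + p)).
  move=> /andP[s0 sh] /andP[t0 th]; apply: Pr; rewrite -ball_normE /ball_ /=.
  rewrite addrA opprD addrCA subrr addr0 normrN.
  apply: (@le_lt_trans _ _ (h * `|u| + h * `|v|)).
    by rewrite (le_trans (ler_normD _ _)) // !normrZ !ger0_norm // lerD // ler_wpM2r.
  rewrite -mulrDr; apply: (@le_lt_trans _ _ (h * (`|u| + `|v| + 1))).
    by rewrite ler_pM2l // lerDl.
  by rewrite /h divfK ?gt_eqF // ltr_pdivrMr // ltr_pMr // ltr1n.
have inU s t : 0 <= s <= h -> 0 <= t <= h -> U (s *: u + (t *: v + p)).
  by move=> sh th; have [] := inP s t sh th.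
have inU' t s : 0 <= t <= h -> 0 <= s <= h -> U (t *: v + (s *: u + p)).
  by move=> th sh; rewrite addrCA; exact: inU.
have [s [t [sh th E1]]] := second_difference h0 (fd u) (fdd u v) inU.
have [t' [s' [th' sh' E2]]] := second_difference h0 (fd v) (fdd v u) inU'.
rewrite [t' *: v + _]addrCA in E2.
have E : 'D_v (fun y => 'D_u f y) (s *: u + (t *: v + p)) =
   'D_u (fun y => 'D_v f y) (s' *: u + (t' *: v + p)).
  have hn : h != 0 by rewrite gt_eqF.
  have : h * (h * 'D_v (fun y => 'D_u f y) (s *: u + (t *: v + p))) =
      h * (h * 'D_u (fun y => 'D_v f y) (s' *: u + (t' *: v + p))).
    apply: (etrans (esym E1)); apply: (etrans _ E2).
    by rewrite (addrCA (h *: v)) [in RHS](addrAC (f _) (- f (h *: v + p))).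
  by move=> /(mulfI hn)/(mulfI hn).
have [_ H1 _] := inP s t sh th; have [_ _ H2] := inP s' t' sh' th'.
by rewrite E in H1; exact: ler_dist_half H1 H2.
Qed.

Lemma derive_comm_smooth (V W : normedModType R) (U : set V) (f : V -> W)
    (l : W -> R) (u v p : V) :
  functional l -> open U -> U p -> smooth U f ->
  l ('D_v (fun y => 'D_u f y) p) = l ('D_u (fun y => 'D_v f y) p).
Proof.
move=> lc oU Up fs.
have [fd /= fd1] := fs 2; have fd2 w := (fd1 w).1; have fd3 w w' := (fd1 w).2 w'.
have lD w x : U x -> is_derive x w (fun y => l (f y)) (l ('D_w f x) : R).
  by move=> Ux; apply: is_derive_functional => //; exact/derivableP/diff_derivable/fd.
have lDE w x : U x -> 'D_w (fun y => l (f y)) x = l ('D_w f x) by move=> /(lD w)[].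
have lDD w w' x : U x ->
   is_derive x w' (fun y => 'D_w (fun z => l (f z)) y : R) (l ('D_w' (fun y => 'D_w f y) x) : R).
  move=> Ux; apply: (@near_eq_is_derive _ _ _ (fun y => l ('D_w f y) : R)).
    have : \forall y \near x, U y by exact: open_nbhs_nbhs.
    by apply: filterS => y Uy; rewrite lDE.
  by apply: is_derive_functional => //; exact/derivableP/diff_derivable/fd2.
have E w w' x : U x -> 'D_w' (fun y => 'D_w (fun z => l (f z)) y : R) x = l ('D_w' (fun y => 'D_w f y) x).
  by move=> /(lDD w w')[].
apply: (etrans (esym (E u v p Up))); apply: (etrans _ (E v u p Up)).
apply: (@derive_comm _ U (fun y => l (f y)) u v p oU Up).
- by move=> w x Ux; case: (lD w x Ux).
- by move=> w w' x Ux; case: (lDD w w' x Ux).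
move=> w w'.
have C : {for p, continuous (fun x => l ('D_w' (fun y => 'D_w f y) x))}.
  by apply: (@cvg_comp _ _ _ _ l); [exact: fd3|exact: lc.2].
have Ep : \forall y \near p, l ('D_w' (fun y => 'D_w f y) y) =
    'D_w' (fun y => 'D_w (fun z => l (f z)) y) y.
  have : \forall y \near p, U y by exact: open_nbhs_nbhs.
  by apply: filterS => y Uy; rewrite (E w w' y Uy).
have := nbhs_singleton Ep; rewrite /prop_for /continuous_at => <-.
by apply: cvg_trans C; apply: near_eq_cvg.
Qed.

Lemma functional_coord m n (i : 'I_m) (j : 'I_n) :
  functional (fun X : 'M[R]_(m, n) => X i j).
Proof. by split=> [a x y|]; [rewrite !mxE|exact: coord_continuous]. Qed.

Lemma functional_fst (V W : normedModType R) (l : V -> R) :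
  functional l -> functional (fun x : V * W => l x.1).
Proof.
move=> [ll lc]; split=> [a x y|]; first exact: ll.
by move=> x; apply: (@continuous_comp _ _ _ fst l); [exact: cvg_fst|exact: lc].
Qed.

Lemma functional_snd (V W : normedModType R) (l : W -> R) :
  functional l -> functional (fun x : V * W => l x.2).
Proof.
move=> [ll lc]; split=> [a x y|]; first exact: ll.
by move=> x; apply: (@continuous_comp _ _ _ snd l); [exact: cvg_snd|exact: lc].
Qed.

(** * Variation of a flow along its submanifold *)

Section Flow.
Variables (V : normedModType R) (M : set V) (sys : V -> V -> Prop).
Variables (W : set (R * V)) (phi : R * V -> V).
Hypothesis fl : is_flow M sys W phi.
Variables (x : V) (Mx : M x).

Definition velocity (y : R * V) : V := 'D_((1 : R), 0 : V) phi y.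
Definition tangent_map (t : R) (v : V) : V := 'D_v (fun y => phi (t, y)) x.

Lemma flow_differentiable y : W y -> differentiable phi y.
Proof. by move=> Wy; have [d _] := flow_smooth fl 1%N; exact: d. Qed.

Lemma velocity_differentiable y : W y -> differentiable velocity y.
Proof. by move=> Wy; have [_ d] := flow_smooth fl 2%N; have [d' _] := d (1, 0); exact: d'. Qed.

Lemma differentiable_slice (U : normedModType R) (f : R * V -> U) t y :
  differentiable f (t, y) -> differentiable (fun z => f (t, z)) y.
Proof.
by move=> fd; apply: (@differentiable_comp _ _ _ _ (fun z => (t, z)) f).
Qed.

Lemma derive_slice (U : normedModType R) (f : R * V -> U) t y v :
  'D_v (fun z => f (t, z)) y = 'D_(0, v) f (t, y).
Proof.
have E : (fun h : R => h^-1 *: (f (t, h *: v + y) - f (t, y))) =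
    (fun h : R => h^-1 *: (f (h *: ((0, v) : R * V) + (t, y)) - f (t, y))).
  apply/funext => h; congr (_ *: (f _ - _)).
  by rewrite -[RHS]/(h *: (0 : R) + t, h *: v + y) scaler0 add0r.
by rewrite /derive /= E.
Qed.

Lemma flow_velocity t y : M y -> W (t, y) ->
  is_derive t (1 : R) (fun s => phi (s, y)) (velocity (t, y)) /\
  sys (phi (t, y)) (velocity (t, y)).
Proof.
move=> My Wty.
have D : is_derive t (1 : R) (fun s => phi (s, y)) (velocity (t, y)).
  have := @is_derive_line _ _ phi (1, 0) (0, y) t (velocity (t, y)).
  have E s : s *: ((1, 0) : R * V) + (0, y) = (s, y).
  by rewrite -[LHS]/(s *: (1 : R) + 0, s *: 0 + y) scaler0 add0r addr0 [_ *: _]mulr1.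
  have -> : (fun s => phi (s *: ((1, 0) : R * V) + (0, y))) = (fun s => phi (s, y)).
    by apply/funext => s; rewrite E.
  apply; rewrite E; apply/derivableP/diff_derivable.
  exact: flow_differentiable.
split=> //; have [u [_ <-] su] := flow_ode fl My Wty.
by case: D su => _ ->.
Qed.

(** The time derivative of D_v phi is D_v of the velocity, by symmetry of the second derivatives in
    the directions (1, 0) and (0, v). *)
Lemma tangent_map_der l t v : functional l -> W (t, x) ->
  is_derive t (1 : R) (fun s => l (tangent_map s v)) (l ('D_(0, v) velocity (t, x))).
Proof.
move=> lf Wtx.
have -> : l ('D_(0, v) velocity (t, x)) = l ('D_(1, 0) (fun y => 'D_(0, v) phi y) (t, x)).
  exact: (derive_comm_smooth _ _ lf (flow_open fl) Wtx (flow_smooth fl)).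
apply: is_derive_functional; first exact: lf.
have := @is_derive_line _ _ (fun y => 'D_(0, v) phi y) (1, 0) (0, x) t
   ('D_(1, 0) (fun y => 'D_(0, v) phi y) (t, x)).
have E s : s *: ((1, 0) : R * V) + (0, x) = (s, x).
  by rewrite -[LHS]/(s *: (1 : R) + 0, s *: 0 + x) scaler0 add0r addr0 [_ *: _]mulr1.
have -> : (fun s => 'D_(0, v) phi (s *: ((1, 0) : R * V) + (0, x))) =
    (fun s => tangent_map s v).
  by apply/funext => s; rewrite E /tangent_map derive_slice.
apply; rewrite E; apply/derivableP/diff_derivable.
by have [_ d] := flow_smooth fl 2%N; have [d' _] := d (0, v); exact: d'.
Qed.

(** [sys] may be used on [M] only, hence the curve [X] is the image under the flow of a curve in [M]
    with velocity v. It remains in the flow domain for s near 0 only, since that domain is open. *)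
Lemma variation t v : W (t, x) -> tangent M x v ->
  exists X U : R -> V,
  [/\ X 0 = phi (t, x) /\ U 0 = velocity (t, x),
      \forall s \near (0 : R), M (X s) /\ sys (X s) (U s),
      is_derive (0 : R) (1 : R) X (tangent_map t v) &
      is_derive (0 : R) (1 : R) U ('D_(0, v) velocity (t, x))].
Proof.
move=> Wtx [c [Mc c0 dc]].
exists (fun s => phi (t, c s)), (fun s => velocity (t, c s)); split.
- by rewrite c0.
- have Wc : \forall s \near (0 : R), W (t, c s).
    have C : {for 0, continuous (fun s => (t, c s))}.
      have [/derivable1_diffP cd _] := dc; apply: differentiable_continuous.
      by apply: differentiable_pair; [exact: differentiable_cst|exact: cd].
    apply: C; rewrite c0; apply: open_nbhs_nbhs; split=> //.
    exact: (flow_open fl).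
  apply: filterS Wc => s Ws; split; first exact: (flow_in fl (Mc s) Ws).
  exact: (flow_velocity (Mc s) Ws).2.
- have := @is_derive_chain _ _ (fun y => phi (t, y)) c 0 v; rewrite c0; apply=> //.
  exact/differentiable_slice/flow_differentiable.
have := @is_derive_chain _ _ (fun y => velocity (t, y)) c 0 v; rewrite c0 derive_slice.
apply=> //; exact/differentiable_slice/velocity_differentiable.
Qed.

Lemma tangent_map0 v : tangent M x v -> tangent_map 0 v = v.
Proof.
move=> [c [Mc c0 dc]].
have D : is_derive (0 : R) (1 : R) (fun s => phi (0, c s)) (tangent_map 0 v).
  have := @is_derive_chain _ _ (fun y => phi (0, y)) c 0 v; rewrite c0; apply=> //.
  exact/differentiable_slice/flow_differentiable/(flow_dom0 fl Mx).
have E : (fun s => phi (0, c s)) = c by apply/funext => s; rewrite (flow_init fl (Mc s)).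
by rewrite E in D; have [_ <-] := D; have [_ <-] := dc.
Qed.

Lemma tangent_map_tangent t v : W (t, x) -> tangent M x v ->
  tangent M (phi (t, x)) (tangent_map t v).
Proof.
move=> Wtx vT; have [X [U [[X0 _] MX dX _]]] := variation Wtx vT.
(* [tangent] asks for a curve lying in [M] at all parameters, while [X] is known to do so near 0;
   elsewhere it is patched by the base point. *)
exists (fun s => if pselect (M (X s)) then X s else phi (t, x)); split.
- by move=> s; case: pselect => [//|Ms] /=; exact: (flow_in fl Mx Wtx).
- by case: pselect.
apply: near_eq_is_derive dX; apply: filterS MX => s [Ms _].
by case: pselect.
Qed.

End Flow.

End Calculus.

(** * The linearised equations in matrix form *)

Section MatrixLemmas.
Context {R : realType}.

Lemma tr_anti p (X : 'M[R]_p) : X^T = - X -> \tr X = 0.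
Proof.
move=> XT; have := mxtrace_tr X; rewrite XT linearN /= => /eqP.
by rewrite eq_sym -addr_eq0 -mulr2n mulrn_eq0 /= => /eqP.
Qed.

Lemma tr_anti_sym p (X S : 'M[R]_p) : X^T = - X -> S^T = S -> \tr (X *m S) = 0.
Proof.
move=> XT ST; have := mxtrace_tr (X *m S).
rewrite trmx_mul XT ST mulmxN linearN /= mxtrace_mulC => /eqP.
by rewrite eq_sym -addr_eq0 -mulr2n mulrn_eq0 /= => /eqP.
Qed.

Lemma mx11_anti (X : 'M[R]_1) : X^T = - X -> X = 0.
Proof. by move=> /tr_anti; rewrite trace_mx11 => X0; rewrite [X]mx11_scalar X0 raddf0. Qed.

Lemma mul_rV_self_ge0 p (u : 'rV[R]_p) : 0 <= (u *m u^T) 0 0.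
Proof. by rewrite mxE sumr_ge0 // => i _; rewrite mxE -expr2 sqr_ge0. Qed.

Lemma mul_rV_self_eq0 p (u : 'rV[R]_p) : (u *m u^T) 0 0 = 0 -> u = 0.
Proof.
rewrite mxE => /eqP; rewrite psumr_eq0 => [/allP u0|i _]; last by rewrite mxE -expr2 sqr_ge0.
apply/rowP => i; rewrite mxE; have := u0 i (mem_index_enum i).
by rewrite mxE -expr2 sqrf_eq0 => /eqP.
Qed.

Definition posdef p (S : 'M[R]_p) := forall u : 'rV_p, u != 0 -> 0 < (u *m S *m u^T) 0 0.

Lemma posdef_unit p (S : 'M[R]_p) : posdef S -> S \in unitmx.
Proof.
move=> Sp; rewrite -row_free_unit; apply/inj_row_free => u uS.
by apply/eqP; apply: contraT => /Sp; rewrite uS mul0mx mxE ltxx.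
Qed.

(* Along the segment from 1 to S the determinant never vanishes. *)
Lemma posdef_det p (S : 'M[R]_p) : posdef S -> 0 < \det S.
Proof.
move=> Sp.
pose q : {poly R} := \det (\matrix_(i, j) ((1 - 'X) * (1%:M i j)%:P + 'X * (S i j)%:P)).
have qE (s : R) : q.[s] = \det ((1 - s)%:M + s *: S).
  rewrite -horner_evalE -det_map_mx; congr (\det _); apply/matrixP => i j.
  by rewrite !mxE /= horner_evalE !hornerE mulr_natr.
have q0 : q.[0] = 1 by rewrite qE subr0 scale0r addr0 det1.
have q1 : q.[1] = \det S by rewrite qE subrr scale1r raddf0 add0r.
rewrite -q1 ltNge; apply/negP => q1le.
have ivt : (- q).[0] <= 0 <= (- q).[1] by rewrite !hornerN q0 oppr_le0 ler01 oppr_ge0.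
have [s /andP[s0 s1] rs] := poly_ivt ler01 ivt.
move: rs; rewrite rootN /root qE => /eqP D0.
suff : posdef ((1 - s)%:M + s *: S).
  by move=> /posdef_unit; rewrite unitmxE D0 unitr0.
move=> u u0; rewrite mulmxDr mulmxDl mul_mx_scalar -scalemxAr -!scalemxAl mxE [X in X + _]mxE [X in _ + X]mxE.
have uu : 0 < (u *m u^T) 0 0.
  rewrite lt_def mul_rV_self_ge0 andbT; apply: contraNneq u0.
  by move=> /mul_rV_self_eq0 ->.
have [->|sn0] := eqVneq s 0; first by rewrite subr0 mul1r mul0r addr0.
by rewrite ltr_wpDl ?mulr_ge0 ?mulr_gt0 ?subr_ge0 ?(ltW uu) ?Sp // lt_def sn0.
Qed.

(** The matrix with blocks 1, -X, Y, 1 has two triangular factorisations, one for each side. *)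
Lemma sylvester p q (X : 'M[R]_(p, q)) (Y : 'M[R]_(q, p)) :
  \det (1%:M + X *m Y) = \det (1%:M + Y *m X).
Proof.
have E1 : block_mx 1%:M (- X) Y 1%:M = block_mx 1%:M 0 Y 1%:M *m block_mx 1%:M (- X) 0 (1%:M + Y *m X).
  rewrite mulmx_block !mul0mx !mulmx0 !mul1mx !mulmx1 !addr0 mulmxN.
  by rewrite addrC addrK.
have E2 : block_mx 1%:M (- X) Y 1%:M = block_mx (1%:M + X *m Y) (- X) 0 1%:M *m block_mx 1%:M 0 Y 1%:M.
  rewrite mulmx_block !mul0mx !mulmx0 !mul1mx !mulmx1 !add0r mulNmx.
  by rewrite addrK.
have := congr1 determinant E1; rewrite {1}E2 !det_mulmx !det_ublock !det_lblock !det1.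
by rewrite !mulr1 !mul1r.
Qed.

Definition linmx p q (f : 'rV[R]_p -> 'rV[R]_q) : 'M[R]_(p, q) := \matrix_(i < p) f (delta_mx 0 i).

Lemma mul_linmx p q (f : 'rV[R]_p -> 'rV[R]_q) u : linear f -> u *m linmx f = f u.
Proof.
move=> lf; pose F : {linear 'rV[R]_p -> 'rV[R]_q} := HB.pack f (GRing.isLinear.Build _ _ _ _ _ lf).
rewrite -[RHS]/(F u) {2}(row_sum_delta u) linear_sum.
rewrite mulmx_sum_row; apply: eq_bigr => i _.
by rewrite linearZ rowK.
Qed.

Lemma rV_ext p q (X Y : 'M[R]_(p, q)) : (forall u : 'rV_p, u *m X = u *m Y) -> X = Y.
Proof. by move=> XY; apply/row_matrixP => i; rewrite !rowE. Qed.

End MatrixLemmas.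

(** * The generator of the linearised flow and its trace *)

Section Core.
Context {R : realType} {N d r : nat}.
(** In the application [a] and [b] are the matrices of ad omega and ad m, [w] is omega, [g] is
    gamma, and [J], [Jy] are the matrices of z |-> z /\ gamma and z |-> z /\ y with y = omega gamma.
    The hypotheses retain what the trace computation needs from so(N). *)
Variables (eps : R) (A a b : 'M[R]_d) (J Jy : 'M[R]_(N, d)) (w : 'M[R]_N) (g y : 'cV[R]_N).
Hypotheses (AT : A^T = A) (Ap : posdef A) (aT : a^T = - a) (bT : b^T = - b) (wT : w^T = - w).
Hypotheses (gg : g^T *m g = 1%:M) (yE : y = w *m g) (JyE : Jy = J *m a + w *m J).
Hypotheses (JJ : J *m J^T = 1%:M - g *m g^T) (gJ : g^T *m J = 0) (gJy : g^T *m Jy = - (y^T *m J)).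

(* The block of the inertia on [v_gamma], completed by 1 on [gamma]; inverting it
   avoids choosing a basis of [v_gamma]. *)
Definition Hmx : 'M[R]_N := J *m A *m J^T + g *m g^T.

Lemma gy : g^T *m y = 0.
Proof. by apply: mx11_anti; rewrite yE !trmx_mul trmxK wT mulmxN mulNmx mulmxA. Qed.

Lemma yg : y^T *m g = 0.
Proof. by rewrite -[LHS]trmxK trmx_mul trmxK gy trmx0. Qed.

Lemma gw : g^T *m w = - y^T.
Proof. by rewrite yE trmx_mul wT mulmxN opprK. Qed.

Lemma JTg : J^T *m g = 0.
Proof. by rewrite -[LHS]trmxK trmx_mul trmxK gJ trmx0. Qed.

Lemma HT : Hmx^T = Hmx.
Proof. by rewrite /Hmx raddfD /= !trmx_mul !trmxK AT mulmxA. Qed.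

Lemma posdef_Hmx : posdef Hmx.
Proof.
move=> z z0; rewrite /Hmx mulmxDr mulmxDl mxE.
have E1 : z *m (J *m A *m J^T) *m z^T = (z *m J) *m A *m (z *m J)^T.
  by rewrite trmx_mul !mulmxA.
have E2 : z *m (g *m g^T) *m z^T = (z *m g) *m (z *m g)^T.
  by rewrite trmx_mul !mulmxA.
rewrite E1 E2; have [zJ|zJ] := eqVneq (z *m J) 0; last first.
  by rewrite ltr_wpDr ?mul_rV_self_ge0 ?Ap.
rewrite zJ !mul0mx mxE add0r lt_def mul_rV_self_ge0 andbT.
apply: contraNneq z0 => /mul_rV_self_eq0 zg.
have := congr1 (mulmx z) JJ; rewrite mulmxA zJ mul0mx mulmxBr mulmxA zg mul0mx subr0.
by rewrite mulmx1 => <-.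
Qed.

Lemma Hunit : Hmx \in unitmx. Proof. exact/posdef_unit/posdef_Hmx. Qed.

(** Since gamma /\ gamma = 0, gamma is an eigenvector of H with eigenvalue 1. *)
Lemma gHV : g^T *m invmx Hmx = g^T.
Proof.
have gH : g^T *m Hmx = g^T.
  by rewrite /Hmx mulmxDr !mulmxA gJ !mul0mx add0r gg mul1mx.
by rewrite -[X in X *m _]gH mulmxK ?Hunit.
Qed.

Lemma HVT : (invmx Hmx)^T = invmx Hmx.
Proof. by rewrite trmx_inv HT. Qed.

Definition sigma : R := \tr (J *m A *m a *m J^T *m invmx Hmx).

Lemma tr_outer p (x : 'cV[R]_p) (z : 'rV[R]_p) : \tr (x *m z) = (z *m x) 0 0.
Proof. by rewrite mxtrace_mulC trace_mx11. Qed.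

(** The time derivative of [Hmx] when gamma' = - eps y, so that J' = - eps Jy by linearity of J in
    gamma. *)
Definition Hmx' : 'M[R]_N :=
  - eps *: (Jy *m A *m J^T + J *m A *m Jy^T + y *m g^T + g *m y^T).

(** Substitute Jy = J a + omega J. Since J A J^T = H - gamma gamma^T and H^-1 fixes gamma, the omega
    part contributes tr omega - y . gamma = 0; the rest, J a A J^T H^-1, is minus [sigma] after
    transposition. *)
Lemma tr_Hmx' : \tr (Hmx' *m invmx Hmx) = 2 * eps * sigma.
Proof.
have t1 : \tr (Jy *m A *m J^T *m invmx Hmx) = - sigma.
  have JAJ : J *m A *m J^T = Hmx - g *m g^T by rewrite /Hmx addrK.
  have -> : Jy *m A *m J^T *m invmx Hmx =
      J *m a *m A *m J^T *m invmx Hmx + (w - w *m g *m g^T *m invmx Hmx).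
    rewrite JyE !mulmxDl -!mulmxA (mulmxA J A) (mulmxA (J *m A)) JAJ.
    by rewrite mulmxBl mulmxV ?Hunit // mulmxBr mulmx1 !mulmxA.
  rewrite raddfD raddfB /= (tr_anti wT) sub0r -[w *m g *m _ *m _]mulmxA gHV -yE.
  rewrite tr_outer gy mxE subr0 /sigma -[in RHS]mxtrace_tr !trmx_mul trmxK HVT AT aT.
  by rewrite !(mulmxN, mulNmx) linearN opprK [RHS]mxtrace_mulC !mulmxA.
have t2 : \tr (J *m A *m Jy^T *m invmx Hmx) = - sigma.
  by rewrite -t1 -mxtrace_tr !trmx_mul trmxK HVT AT [LHS]mxtrace_mulC !mulmxA.
have t3 : \tr (y *m g^T *m invmx Hmx) = 0.
  by rewrite -mulmxA gHV tr_outer gy mxE.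
have t4 : \tr (g *m y^T *m invmx Hmx) = 0.
  by rewrite -mxtrace_tr !trmx_mul trmxK HVT mxtrace_mulC t3.
rewrite /Hmx' -scalemxAl mxtraceZ !mulmxDl !raddfD /= t1 t2 t3 t4; ring.
Qed.

(** [L] stands for the multiplier term, [N1] for the c-dependent part of the differentiated
    constraint, [B0] and [Q] for the equation of the group component. In [Bmx] the matrices [L],
    [N1] and [Q] occupy off-diagonal blocks. *)
Variables (L : 'M[R]_N) (N1 : 'M[R]_(N, d)) (B0 : 'M[R]_r) (Q : 'M[R]_(d, r)).
Hypothesis (B0tr : \tr B0 = 0).

Let P : 'M[R]_N := 1%:M - g *m g^T.

(* The terms in [eps] make the completing rows [(0, g, 0)] and [(0, 0, g)] solve
   the same equation as the tangent vectors. *)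
Definition Bzz := ((J *m b - J *m A *m a) *m J^T + eps *: (y *m g^T)) *m invmx Hmx
  - eps *: (g *m y^T).
Definition Bcz := P *m ((Jy *m A *m a - Jy *m b) *m J^T + L + N1 *m A *m J^T) *m invmx Hmx.

Definition Bmx : 'M[R]_(r + (N + N)) :=
  block_mx B0 0 (col_mx (J *m Q) (- (P *m Jy *m Q)))
    (block_mx Bzz (- eps *: P) Bcz (eps *: w)).

(** J b J^T is antisymmetric and H^-1 symmetric, so ad m drops out of the trace; the two rank-one
    terms have trace a multiple of y . gamma = 0. *)
Lemma tr_Bmx : \tr Bmx = - sigma.
Proof.
rewrite /Bmx !mxtrace_block B0tr add0r mxtraceZ (tr_anti wT) mulr0 addr0.
rewrite /Bzz raddfB /= mxtraceZ tr_outer yg mxE mulr0 subr0.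
rewrite !mulmxDl -scalemxAl !raddfD /= mxtraceZ -[y *m _ *m _]mulmxA gHV tr_outer gy mxE mulr0 addr0.
rewrite !mulNmx raddfN /=.
rewrite [X in X - _](_ : _ = 0) ?sub0r //.
apply: tr_anti_sym HVT.
by rewrite !trmx_mul trmxK bT !(mulmxN, mulNmx) !mulmxA.
Qed.

Lemma gP : g^T *m P = 0.
Proof. by rewrite /P mulmxBr mulmx1 mulmxA gg mul1mx subrr. Qed.

Lemma Bmx_z : row_mx (0 : 'rV_r) (row_mx g^T 0) *m Bmx = row_mx 0 (row_mx (- eps *: y^T) 0).
Proof.
rewrite /Bmx mul_row_block !mul0mx add0r mul_row_col mul_row_block !mul0mx !addr0 add0r.
rewrite mulmxA gJ mul0mx -scalemxAr gP scaler0; congr (row_mx _ (row_mx _ _)).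
rewrite /Bzz mulmxBr !mulmxA mulmxDr !mulmxA mulmxBr !mulmxA gJ !mul0mx subrr mul0mx add0r.
rewrite -!scalemxAr !mulmxA gy gg !mul0mx mul1mx scaler0 mul0mx sub0r.
by rewrite scaleNr.
Qed.

Lemma Bmx_c : row_mx (0 : 'rV_r) (row_mx 0 g^T) *m Bmx = row_mx 0 (row_mx 0 (- eps *: y^T)).
Proof.
rewrite /Bmx mul_row_block !mul0mx add0r mul_row_col mul_row_block !mul0mx !add0r.
rewrite mulmxN /Bcz !mulmxA gP !mul0mx oppr0.
by rewrite -scalemxAr gw scaleNr scalerN.
Qed.

(** The unknown [u'] satisfies two equations: the differentiated constraint recovers it from its
    z-part, and the force equation gives its image under A J^T. Together they express zT' H in known
    terms, and H is invertible. *)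
Lemma Bmx_row (be be' : 'rV[R]_r) (u u' : 'rV[R]_d) (c : 'cV[R]_N) :
  u = u *m J^T *m J - c^T *m Jy -> c^T *m g = 0 ->
  u' = (u' *m J^T - eps *: (u *m Jy^T)) *m J - c^T *m N1 ->
  u' *m A *m J^T = (u *m b - u *m A *m a) *m J^T + c^T *m L ->
  be' = be *m B0 + u *m Q ->
  row_mx be (row_mx (u *m J^T) c^T) *m Bmx =
  row_mx be' (row_mx (u' *m J^T - eps *: (u *m Jy^T)) (- eps *: (u *m J^T) + eps *: (c^T *m w))).
Proof.
move=> uE cg u'E mE ->.
set zT := u *m J^T in uE u'E mE *; set zT' := u' *m J^T - _ in u'E *.
have cP : c^T *m P = c^T by rewrite /P mulmxBr mulmx1 mulmxA cg mul0mx subr0.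
have zg : zT *m g = 0 by rewrite /zT -mulmxA JTg mulmx0.
have zP : zT *m P = zT by rewrite /P mulmxBr mulmx1 mulmxA zg mul0mx subr0.
rewrite /Bmx mul_row_block mulmx0 add0r mul_row_col mul_row_block.
congr (row_mx _ (row_mx _ _)).
- congr (_ + _); rewrite [in RHS]uE (mulmxBl (zT *m J)) (mulmxA zT) mulmxN.
  by rewrite (mulmxA c^T) (mulmxA c^T) cP.
(* As gamma moves, [zT'] is not orthogonal to it: zT . gamma = 0 differentiates to this
   component. *)
- have z'g : zT' *m g = eps *: (zT *m y).
    have JyTg : Jy^T *m g = - (J^T *m y).
      by rewrite -[LHS]trmxK trmx_mul trmxK gJy raddfN /= trmx_mul trmxK.
    rewrite /zT' mulmxBl -mulmxA JTg mulmx0 sub0r -scalemxAl -mulmxA JyTg.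
    by rewrite mulmxN scalerN opprK mulmxA.
  have z'H : zT' *m Hmx = zT *m ((J *m b - J *m A *m a) *m J^T + eps *: (y *m g^T)) +
      c^T *m ((Jy *m A *m a - Jy *m b) *m J^T + L + N1 *m A *m J^T).
    have -> : zT' *m Hmx = zT' *m J *m A *m J^T + zT' *m g *m g^T.
      by rewrite /Hmx mulmxDr !mulmxA.
    have -> : zT' *m J = u' + c^T *m N1 by rewrite {1}u'E subrK.
    have -> : (u' + c^T *m N1) *m A *m J^T = u' *m A *m J^T + c^T *m N1 *m A *m J^T.
      by rewrite !mulmxDl.
    rewrite z'g mE uE; clearbody zT zT'.
    rewrite !(mulmxDl, mulmxDr, mulmxN, mulNmx, mulmxA, =^~ scalemxAl, =^~ scalemxAr).
    set x1 := zT *m J *m b *m J^T; set x2 := c^T *m Jy *m b *m J^T.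
    set x3 := zT *m J *m A *m a *m J^T; set x4 := c^T *m Jy *m A *m a *m J^T.
    set x5 := c^T *m L; set x6 := c^T *m N1 *m A *m J^T; set x7 := eps *: _.
    clearbody x1 x2 x3 x4 x5 x6 x7; apply/matrixP => i j; rewrite !mxE; ring.
  have -> : zT' = zT' *m Hmx *m invmx Hmx by rewrite mulmxK // Hunit.
  rewrite z'H mulmxDl; congr (_ + _); last by rewrite /Bcz (mulmxA c^T) (mulmxA c^T P) cP.
  by rewrite /Bzz (mulmxBr zT) -(scalemxAr eps zT) (mulmxA zT g) zg mul0mx scaler0 subr0 mulmxA.
- by rewrite -!scalemxAr zP.
Qed.

End Core.

(** * Coordinates on so(N) *)

Section Pairs.

Lemma sum_ltpair (V : nmodType) n (G : 'I_n -> 'I_n -> V) :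
  \sum_i \sum_j G i j =
  \sum_(p : ltpair n) (G (val p).1 (val p).2 + G (val p).2 (val p).1) + \sum_i G i i.
Proof.
have E (F : 'I_n -> 'I_n -> V) : \sum_(p : ltpair n) F (val p).1 (val p).2 =
    \sum_(i < n) \sum_(j < n | (i < j)%N) F i j.
  rewrite pair_big_dep /= (reindex_omap (val : ltpair n -> _) insub) /=; last first.
    by move=> p lt; rewrite insubT.
  by apply: eq_bigl => p; rewrite valK eqxx andbT (valP p).
rewrite big_split /= (E G) (E (fun i j => G j i)).
rewrite [X in _ + X + _](exchange_big_dep xpredT) //= -!big_split /=.
apply: eq_bigr => i _.
rewrite (bigD1 i) //= addrC; congr (_ + _).
rewrite (bigID (fun j : 'I_n => (i < j)%N)) /=; congr (_ + _); apply: eq_bigl => j.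
  by rewrite -(inj_eq val_inj) /= neq_ltn andb_idl // => ->; rewrite orbT.
by rewrite -(inj_eq val_inj) /= neq_ltn -leqNgt; case: ltngtP.
Qed.

End Pairs.

Section Coordinates.
Context {R : realType} {N : nat}.
Local Notation d := #|{: ltpair N}|.
Implicit Types (X Y : 'M[R]_N) (x y g : 'cV[R]_N) (u : 'rV[R]_d).

(** The entries above the diagonal are orthonormal coordinates for [pairing]: its factor 1/2
    compensates for each entry occurring twice in the trace. *)
Definition crd X : 'rV[R]_d := \row_k X (val (enum_val k)).1 (val (enum_val k)).2.

Definition uncrd u : 'M[R]_N :=
  \sum_k u 0 k *: (delta_mx (val (enum_val k)).1 (val (enum_val k)).2
                 - delta_mx (val (enum_val k)).2 (val (enum_val k)).1).

Definition skew X := X^T = - X.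

Lemma crd_linear : linear crd.
Proof. by move=> a X Y; apply/rowP => k; rewrite !mxE. Qed.

Lemma uncrd_linear : linear uncrd.
Proof.
move=> a u v; rewrite /uncrd scaler_sumr -big_split; apply: eq_bigr => k _ /=.
by rewrite !mxE scalerDl scalerA.
Qed.

HB.instance Definition _ := GRing.isLinear.Build R _ _ _ crd crd_linear.
HB.instance Definition _ := GRing.isLinear.Build R _ _ _ uncrd uncrd_linear.

Lemma skewE X i j : skew X -> X j i = - X i j.
Proof. by move=> /matrixP/(_ i j); rewrite !mxE. Qed.

Lemma skew_diag X i : skew X -> X i i = 0.
Proof. by move=> /(skewE i i) /eqP; rewrite -addr_eq0 -mulr2n mulrn_eq0 => /eqP. Qed.

Lemma skew_uncrd u : skew (uncrd u).
Proof.
rewrite /skew /uncrd linear_sum -sumrN; apply: eq_bigr => k _ /=.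
by rewrite linearZ linearB /= !trmx_delta -scalerN opprB.
Qed.

Lemma crdK u : crd (uncrd u) = u.
Proof.
apply/rowP => k; rewrite mxE summxE (bigD1 k) //= big1 => [|l lk].
  rewrite !mxE !eqxx /=; have := valP (enum_val k); set p := val _ => lt.
  by rewrite -!(inj_eq val_inj) (ltn_eqF lt) (gtn_eqF lt) subr0 mulr1 addr0.
rewrite !mxE; have ltk := valP (enum_val k); have ltl := valP (enum_val l).
have -> : ((val (enum_val k)).1 == (val (enum_val l)).1) &&
          ((val (enum_val k)).2 == (val (enum_val l)).2) = false.
  apply: contraNF lk => /andP[/eqP e1 /eqP e2]; apply/eqP/enum_val_inj/val_inj.
  by rewrite [LHS]surjective_pairing [RHS]surjective_pairing e1 e2.
have -> : ((val (enum_val k)).1 == (val (enum_val l)).2) &&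
          ((val (enum_val k)).2 == (val (enum_val l)).1) = false.
  apply/negP => /andP[/eqP e1 /eqP e2]; move: ltk; rewrite e1 e2 => /ltn_trans /(_ ltl).
  by rewrite ltnn.
by rewrite subr0 mulr0.
Qed.

Lemma sum_enum_val (V : nmodType) (F : ltpair N -> V) :
  \sum_(k < d) F (enum_val k) = \sum_p F p.
Proof. by rewrite [RHS](reindex (fun k : 'I_d => enum_val k)) //=; exact/onW_bij/enum_val_bij. Qed.

Lemma uncrdK X : skew X -> uncrd (crd X) = X.
Proof.
move=> sX; rewrite /uncrd [RHS]matrix_sum_delta.
rewrite (sum_ltpair (fun i j => X i j *: delta_mx i j)) [X in _ + X]big1 => [|i _]; last first.
  by rewrite skew_diag // scale0r.
rewrite addr0 -sum_enum_val; apply: eq_bigr => k _.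
by rewrite mxE (skewE (val (enum_val k)).1 (val (enum_val k)).2 sX) scaleNr scalerBr.
Qed.

Lemma pairingE X Y : skew X -> skew Y -> pairing X Y = (crd X *m (crd Y)^T) 0 0.
Proof.
move=> sX sY; rewrite /pairing /mxtrace.
under eq_bigr do rewrite mxE.
rewrite (sum_ltpair (fun i j => X i j * Y j i)) [X in _ + X]big1 => [|i _]; last first.
  by rewrite skew_diag // mul0r.
rewrite addr0 -sum_enum_val mxE mulr_sumr -sumrN; apply: eq_bigr => k _.
rewrite !mxE (skewE (val (enum_val k)).1 (val (enum_val k)).2 sX).
rewrite (skewE (val (enum_val k)).1 (val (enum_val k)).2 sY).
by rewrite mulrN mulNr -opprD -mulr2n -[X in _ * - X]mulr_natl mulrN opprK mulrA mulVf ?mul1r.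
Qed.

Definition wdg x y : 'M[R]_N := x *m y^T - y *m x^T.

Lemma skew_wdg x y : skew (wdg x y).
Proof. by rewrite /skew /wdg linearB /= !trmx_mul !trmxK opprB. Qed.

Lemma wdg_linearl y : linear (wdg^~ y).
Proof.
move=> a x z; rewrite /wdg linearP /= mulmxDl mulmxDr -!scalemxAl -!scalemxAr scalerBr.
by rewrite opprD addrACA.
Qed.

Lemma wdgC x y : wdg y x = - wdg x y.
Proof. by rewrite /wdg opprB. Qed.

Definition Jm x : 'M[R]_(N, d) := linmx (fun z : 'rV_N => crd (wdg z^T x)).

Lemma mul_Jm (z : 'rV_N) x : z *m Jm x = crd (wdg z^T x).
Proof.
rewrite /Jm mul_linmx // => a z1 z2.
by rewrite linearP /= wdg_linearl linearP.
Qed.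

Lemma mulT_Jm x y : x^T *m Jm y = crd (wdg x y).
Proof. by rewrite mul_Jm trmxK. Qed.

Lemma Jm_linear : linear Jm.
Proof.
move=> a x y; apply: rV_ext => z; rewrite mulmxDr -scalemxAr !mul_Jm.
by rewrite wdgC wdg_linearl opprD -scalerN -!wdgC linearP.
Qed.

Lemma JmC x y : x^T *m Jm y = - (y^T *m Jm x).
Proof. by rewrite !mulT_Jm wdgC linearN. Qed.

(** The adjoint of z |-> z /\ x is X |-> X x, because the pairing of X with e /\ x is e . X x. *)
Lemma crd_mul_Jm X x : skew X -> crd X *m (Jm x)^T = (X *m x)^T.
Proof.
move=> sX; apply/rowP => k.
have -> : (crd X *m (Jm x)^T) 0 k = pairing X (wdg (delta_mx k 0 : 'cV_N) x).
  rewrite pairingE //; last exact: skew_wdg.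
  rewrite [LHS]mxE [RHS]mxE; apply: eq_bigr => l _; congr (_ * _).
  rewrite ![_^T _ _]mxE -mulT_Jm trmx_delta -rowE.
  by rewrite [RHS]mxE.
have -> : (X *m x)^T 0 k = ((delta_mx k 0 : 'cV_N)^T *m (X *m x)) 0 0.
  by rewrite trmx_delta -rowE !mxE.
move: (delta_mx k 0 : 'cV_N) => e; rewrite /pairing /wdg mulmxBr raddfB /= !mulmxA.
rewrite (mxtrace_mulC (X *m e)) (mxtrace_mulC (X *m x)) !trace_mx11.
have -> : (x^T *m (X *m e)) 0 0 = - (e^T *m (X *m x)) 0 0.
  rewrite -[LHS]trace_mx11 -mxtrace_tr !trmx_mul trmxK sX mulmxN mulNmx.
  by rewrite linearN /= trace_mx11 mulmxA.
rewrite -opprD mulrN opprK -mulr2n -[X in _ * X]mulr_natl mulrA mulVf ?mul1r //.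
by rewrite mulmxA.
Qed.

Lemma Jm_JmT x y : Jm x *m (Jm y)^T = (x^T *m y) 0 0 *: 1%:M - y *m x^T.
Proof.
apply: rV_ext => z; rewrite mulmxA mul_Jm crd_mul_Jm; last exact: skew_wdg.
rewrite /wdg mulmxBl trmxK -!mulmxA mulmxBr -scalemxAr mulmx1 [in RHS]mulmxA.
rewrite [in LHS](mx11_scalar (x^T *m y)) (mx11_scalar (z *m y)).
by rewrite !mul_mx_scalar mul_scalar_mx linearB linearZ linearZ /= trmxK.
Qed.

Lemma lie_linearr X : linear (lie X).
Proof.
move=> a Y Z; rewrite /lie mulmxDr mulmxDl -scalemxAr -scalemxAl scalerBr.
by rewrite opprD addrACA.
Qed.

Lemma skew_lie X Y : skew X -> skew Y -> skew (lie X Y).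
Proof.
move=> sX sY; rewrite /skew /lie linearB /= !trmx_mul sX sY !mulmxN !mulNmx !opprK.
by rewrite opprB.
Qed.

Definition adm X : 'M[R]_d := linmx (fun u => crd (lie X (uncrd u))).

Lemma mul_adm X Y : skew Y -> crd Y *m adm X = crd (lie X Y).
Proof.
move=> sY; rewrite /adm mul_linmx ?uncrdK // => a u v.
by rewrite linearP lie_linearr linearP.
Qed.

(** Invariance of the trace form under ad. *)
Lemma adm_anti X : skew X -> (adm X)^T = - adm X.
Proof.
move=> sX; suff E (u v : 'rV_d) : u *m adm X *m v^T = - (v *m adm X *m u^T).
  apply/matrixP => i j; have := E (delta_mx 0 j) (delta_mx 0 i).
  rewrite !trmx_delta -!rowE -!colE => /matrixP/(_ 0 0).
  by rewrite !mxE.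
have sl w : skew (lie X (uncrd w)) by apply: skew_lie sX (skew_uncrd w).
have P w z : w *m adm X *m z^T = (pairing (lie X (uncrd w)) (uncrd z))%:M.
  rewrite pairingE ?crdK //; last exact: skew_uncrd.
  by rewrite -[w in LHS]crdK mul_adm ?uncrdK -?mx11_scalar //; exact: skew_uncrd.
rewrite !P -raddfN /=; congr (_%:M); rewrite /pairing /lie !mulmxBl !linearB /= opprK.
move: (uncrd u) (uncrd v) => U V.
have -> : \tr (U *m X *m V) = \tr (X *m V *m U) by rewrite -mulmxA mxtrace_mulC.
have -> : \tr (V *m X *m U) = \tr (X *m U *m V) by rewrite -mulmxA mxtrace_mulC.
ring.
Qed.

(** ad X is a derivation of the wedge: z /\ X x = [X, z /\ x] - X z /\ x. The sign of the last term
    flips because X acts on rows from the right. *)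
Lemma Jm_adm X x : skew X -> Jm (X *m x) = Jm x *m adm X + X *m Jm x.
Proof.
move=> sX; apply: rV_ext => z; rewrite mulmxDr !mulmxA !mul_Jm mul_adm; last exact: skew_wdg.
rewrite -linearD; congr crd; rewrite /wdg /lie !trmxK !trmx_mul sX !mulNmx !mulmxN.
rewrite !(mulmxBr, mulmxBl, mulmxN, mulNmx, mulmxA).
by apply/matrixP => i j; rewrite !mxE; ring.
Qed.

End Coordinates.

(** * Elements and endomorphisms of so(N) in coordinates *)

Section Operators.
Context {R : realType} {N : nat}.
Local Notation d := #|{: ltpair N}|.
Implicit Types (xi eta : so R N) (g : 'cV[R]_N).

Definition scrd xi : 'rV[R]_d := crd (vsval xi).

Lemma scrd_linear : linear scrd.
Proof. by move=> a x y; rewrite /scrd (linearP (@vsval _ _ (so_space R N))) linearP. Qed.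

HB.instance Definition _ := GRing.isLinear.Build R _ _ _ scrd scrd_linear.

Lemma so_skew xi : skew (vsval xi).
Proof. by apply/eqP; rewrite -so_spaceE; exact: subvsP. Qed.

Lemma tosoK (X : 'M[R]_N) : skew X -> vsval (toso X : so R N) = X.
Proof. by move=> /eqP sX; rewrite vsprojK // so_spaceE. Qed.

Lemma scrd_toso (X : 'M[R]_N) : skew X -> scrd (toso X) = crd X.
Proof. by move=> sX; rewrite /scrd tosoK. Qed.

Lemma scrd_uncrd u : scrd (toso (uncrd u)) = u.
Proof. by rewrite scrd_toso ?crdK //; exact: skew_uncrd. Qed.

Lemma uncrd_scrd xi : uncrd (scrd xi) = vsval xi.
Proof. by rewrite /scrd uncrdK //; exact: so_skew. Qed.

Lemma scrdK xi : toso (uncrd (scrd xi)) = xi.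
Proof. by rewrite uncrd_scrd vsvalK. Qed.

Lemma scrd_inj : injective scrd.
Proof. exact: (can_inj (g := fun u => toso (uncrd u)) scrdK). Qed.

Lemma so_dotE xi eta : so_dot xi eta = (scrd xi *m (scrd eta)^T) 0 0.
Proof. by rewrite /so_dot pairingE //; exact: so_skew. Qed.

Lemma vwedgeE x y : vsval (vwedge x y : so R N) = wdg x y.
Proof. by rewrite /vwedge tosoK //; exact: skew_wdg. Qed.

Definition opmx (f : so R N -> so R N) : 'M[R]_d :=
  linmx (fun u => scrd (f (toso (uncrd u)))).

Lemma mul_opmx (f : {linear so R N -> so R N}) xi : scrd xi *m opmx f = scrd (f xi).
Proof.
rewrite /opmx mul_linmx ?scrdK // => a u v.
by rewrite uncrd_linear (linearP (@vsproj _ _ (so_space R N))) (linearP f) scrd_linear.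
Qed.

Lemma vwedge_linearl (g : 'cV[R]_N) : linear (fun x => vwedge x g : so R N).
Proof.
move=> a x y; apply: scrd_inj.
by rewrite scrd_linear /scrd !vwedgeE wdg_linearl crd_linear.
Qed.

Lemma mem_h_space g xi : xi \in h_space g <-> vsval xi *m g = 0.
Proof.
have E x : so_dot xi (vwedge x g) = (x^T *m (vsval xi *m g)) 0 0.
  rewrite so_dotE /scrd vwedgeE -mulT_Jm trmx_mul trmxK mulmxA.
  rewrite crd_mul_Jm; last exact: so_skew.
  by rewrite -[LHS]trace_mx11 -mxtrace_tr trmx_mul trmxK trace_mx11.
pose F := GRing.isLinear.Build _ _ _ _ (fun x => vwedge x g) (vwedge_linearl g).
pose f : {linear 'cV[R]_N -> so R N} := HB.pack (fun x => vwedge x g) F.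
have vE eta : eta \in v_space g <-> exists x, eta = vwedge x g.
  split=> [/memv_imgP[x _ ->]|[x ->]]; first by exists x; rewrite (lfunE f).
  by apply/memv_imgP; exists x; rewrite ?memvf ?(lfunE f).
split=> [/mem_orthovP H|xg]; last first.
  by apply/mem_orthovP => _ /vE[x ->]; apply: (etrans (E x)); rewrite xg mulmx0 mxE.
apply/matrixP => i j; rewrite (ord1 j) mxE.
have /H : vwedge (delta_mx i 0) g \in v_space g by apply/vE; exists (delta_mx i 0).
by move=> /(etrans (esym (E _))); rewrite trmx_delta -rowE !mxE.
Qed.

Lemma scrd_pr_v g xi : scrd (pr_v g xi) = scrd xi *m ((Jm g)^T *m Jm g).
Proof.
rewrite mulmxA crd_mul_Jm; last exact: so_skew.
rewrite mulT_Jm scrd_toso; last first.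
  rewrite /skew linearD /= !trmx_mul so_skew trmxK !mulmxN mulNmx -opprD addrC.
  by [].
by congr crd; rewrite /wdg trmx_mul so_skew !mulmxN opprK !mulmxA.
Qed.

Lemma scrd_pr_h g xi : scrd (pr_h g xi) = scrd xi *m (1%:M - (Jm g)^T *m Jm g).
Proof. by rewrite /pr_h linearB /= scrd_pr_v mulmxBr mulmx1. Qed.

End Operators.

(** * The inertia matrix and the determinant on h_gamma *)

Section Inertia.
Context {R : realType} {N : nat}.
Local Notation d := #|{: ltpair N}|.
Variable bI : 'End(so R N).
Hypotheses (bIs : so_symmetric bI) (bIp : so_posdef bI).
Implicit Types (xi eta : so R N) (g : 'cV[R]_N).

Definition Am : 'M[R]_d := opmx bI.

Lemma mul_Am xi : scrd xi *m Am = scrd (bI xi).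
Proof. exact: mul_opmx. Qed.

Lemma Am_sym : Am^T = Am.
Proof.
apply: rV_ext => u; apply/rowP => k.
have E (v w : 'rV[R]_d) : (v *m Am *m w^T) 0 0 = (w *m Am *m v^T) 0 0.
  rewrite -[v]scrd_uncrd -[w]scrd_uncrd !mul_Am -!so_dotE bIs.
  by rewrite so_dot_sym.
have := E (delta_mx 0 k) u; rewrite trmx_delta -rowE -colE.
rewrite -[LHS]trace_mx11 -mxtrace_tr trmx_mul trmxK trace_mx11 => EE.
have -> : (u *m Am^T) 0 k = (u *m (row k Am)^T) 0 0.
  by rewrite !mxE; apply: eq_bigr => i _; rewrite !mxE.
by rewrite EE !mxE.
Qed.

Lemma Am_posdef : posdef Am.
Proof.
move=> u u0; rewrite -[u]scrd_uncrd mul_Am -so_dotE; apply: bIp.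
by apply: contraNneq u0 => E; rewrite -[u]scrd_uncrd E linear0.
Qed.

Lemma bI_inj : lker bI == 0%VS.
Proof.
rewrite -subv0; apply/subvP => x; rewrite memv_ker memv0 => /eqP x0.
apply: contraT => /bIp; rewrite x0 so_dotE linear0 mul0mx mxE ltxx.
by [].
Qed.

Lemma bIK xi : (bI^-1)%VF (bI xi) = xi.
Proof. by rewrite lker0_lfunK // bI_inj. Qed.

Lemma scrd_bIV xi : scrd ((bI^-1)%VF xi) = scrd xi *m invmx Am.
Proof.
have Au := posdef_unit Am_posdef.
have /(canRL (mulmxK Au)) <- // : scrd ((bI^-1)%VF xi) *m Am = scrd xi.
rewrite mul_Am; congr scrd.
pose x := toso (uncrd (scrd xi *m invmx Am)) : so R N.
have -> : xi = bI x; last by rewrite bIK.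
by apply: scrd_inj; rewrite -mul_Am scrd_uncrd mulmxKV.
Qed.

Definition Hm g := Hmx Am (Jm g) g.

Lemma sphereJ g : g^T *m g = 1%:M -> Jm g *m (Jm g)^T = 1%:M - g *m g^T.
Proof. by move=> gg; rewrite Jm_JmT gg mxE eqxx scale1r. Qed.

Lemma gJm g : g^T *m Jm g = 0.
Proof. by rewrite mulT_Jm /wdg subrr linear0. Qed.

(** The left matrix is 1 + ((A - 1) J^T) J. Sylvester's identity moves J to the front, where J J^T =
    1 - g g^T. *)
Lemma det_Hm g : g^T *m g = 1%:M ->
  \det (1%:M - (Jm g)^T *m Jm g + Am *m ((Jm g)^T *m Jm g)) = \det (Hm g).
Proof.
move=> gg; set J := Jm g.
have -> : 1%:M - J^T *m J + Am *m (J^T *m J) = 1%:M + ((Am - 1%:M) *m J^T) *m J.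
  by rewrite !mulmxBl mul1mx -addrA; congr (_ + _); rewrite addrC mulmxA.
rewrite sylvester mulmxA mulmxBr mulmxBl mulmx1 (sphereJ gg) /Hm /Hmx.
by congr (\det _); rewrite addrCA opprB [X in _ + X]addrCA subrr addr0.
Qed.

(* [vbasis h] need not be orthonormal: with [C] the matrix of its coordinates, the
   matrix of the restriction is [C X C^T (C C^T)^-1], and [C^T (C C^T)^-1 C] is the
   projection [1 - P]. *)
Lemma det_h_space g : g^T *m g = 1%:M ->
  det_on (h_space g) (fun xi => pr_h g ((bI^-1)%VF xi)) = \det (Hm g) / \det Am.
Proof.
move=> gg; set h := h_space g; set f := fun xi => _.
pose P : 'M[R]_d := (Jm g)^T *m Jm g; pose k := \dim h.
pose C : 'M[R]_(k, d) := \matrix_(i < k) scrd (tnth (vbasis h) i).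
have PP : P *m P = P.
  rewrite /P mulmxA -(mulmxA (Jm g)^T) (sphereJ gg) mulmxBr mulmx1 mulmxBl.
  by rewrite -!mulmxA gJm !mulmx0 subr0.
have PT : P^T = P by rewrite /P trmx_mul trmxK.
have h_scrd xi : xi \in h <-> scrd xi *m P = 0.
  rewrite mem_h_space /P mulmxA crd_mul_Jm; last exact: so_skew.
  split=> [->|]; first by rewrite trmx0 mul0mx.
  move=> /(congr1 (mulmx^~ (Jm g)^T)); rewrite mul0mx -mulmxA (sphereJ gg) mulmxBr mulmx1.
  have -> : (vsval xi *m g)^T *m (g *m g^T) = 0.
    rewrite mulmxA [X in X *m _](_ : _ = 0) ?mul0mx //.
    by apply: mx11_anti; rewrite trmx_mul trmxK trmx_mul so_skew mulmxN mulNmx opprK mulmxA.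
  by rewrite subr0 => /(congr1 trmx); rewrite trmxK trmx0.
have b_h i : tnth (vbasis h) i \in h by rewrite vbasis_mem // mem_tnth.
have CP : C *m P = 0.
  by apply/row_matrixP => i; rewrite row_mul rowK row0; apply/h_scrd.
have h_C xi : xi \in h -> scrd xi = (\row_i coord (vbasis h) i xi) *m C.
  move=> xh; rewrite {1}(coord_vbasis xh) linear_sum mulmx_sum_row; apply: eq_bigr => i _.
  by rewrite linearZ /= mxE rowK (tnth_nth 0).
have C_free (u : 'rV_k) : u *m C = 0 -> u = 0.
  rewrite mulmx_sum_row => uC; apply/rowP => i; rewrite mxE.
  have /freeP := basis_free (vbasisP h); apply.
  apply: scrd_inj; rewrite linear_sum linear0 -[RHS]uC; apply: eq_bigr => j _.
  by rewrite linearZ /= rowK (tnth_nth 0).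
pose Gm := C *m C^T.
have Gu : Gm \in unitmx.
  apply: posdef_unit => u u0; rewrite /Gm mulmxA -mulmxA -trmx_mul lt_def mul_rV_self_ge0 andbT.
  by apply: contraNneq u0 => /mul_rV_self_eq0/C_free ->.
pose Q := C^T *m invmx Gm *m C.
have QT : Q^T = Q by rewrite /Q !trmx_mul trmxK trmx_inv /Gm trmx_mul trmxK mulmxA.
(* The rows of 1 - P lie in h, so 1 - P factors through [C] and (1 - P) Q = 1 - P; from C P = 0 also
   Q (1 - P) = Q. Both matrices are symmetric, hence equal. *)
have QE : Q = 1%:M - P.
  pose Y : 'M[R]_(d, k) := \matrix_(i < d, j < k) coord (vbasis h) j (pr_h g (toso (uncrd (delta_mx 0 i)))).
  have YC : 1%:M - P = Y *m C.
    apply/row_matrixP => i; rewrite row_mul.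
    have -> : row i (1%:M - P) = scrd (pr_h g (toso (uncrd (delta_mx 0 i)))).
      by rewrite scrd_pr_h scrd_uncrd rowE.
    rewrite h_C; first by congr (_ *m _); apply/rowP => j; rewrite !mxE.
    by apply/h_scrd; rewrite scrd_pr_h -mulmxA mulmxBl mul1mx PP subrr mulmx0.
  have E : (1%:M - P) *m Q = 1%:M - P.
    by rewrite YC /Q !mulmxA -(mulmxA Y) mulmxK.
  have E' : Q *m (1%:M - P) = Q by rewrite mulmxBr mulmx1 /Q -(mulmxA _ C P) CP mulmx0 subr0.
  by rewrite -E' -[in LHS]QT -[in LHS](trmxK (1%:M - P)) -trmx_mul linearB /= trmx1 PT E linearB /= trmx1 PT.
pose F : 'M[R]_k := \matrix_(i < k, j < k) coord (vbasis h) j (f (tnth (vbasis h) i)).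
pose X := invmx Am *m (1%:M - P).
have FC : C *m X = F *m C.
  apply/row_matrixP => i; rewrite !row_mul rowK /X mulmxA -scrd_bIV -scrd_pr_h.
  rewrite h_C; first by congr (_ *m _); apply/rowP => j; rewrite !mxE.
  by apply/h_scrd; rewrite scrd_pr_h -mulmxA mulmxBl mul1mx PP subrr mulmx0.
(* Written in this way, [F] is ready for Sylvester's identity, which replaces its size k = dim h by
   the size of so(N). *)
have FE : F = 1%:M + C *m ((X - 1%:M) *m C^T *m invmx Gm).
  rewrite !mulmxA mulmxBr FC mulmx1 mulmxBl mulmxBl -(mulmxA F) mulmxK // mulmxV //.
  by rewrite addrC subrK.
have Au := posdef_unit Am_posdef.
rewrite /det_on -[\matrix_(i, j) _]/F FE sylvester -!mulmxA (mulmxA C^T) -/Q QE.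
have -> : 1%:M + (X - 1%:M) *m (1%:M - P) = invmx Am *m (1%:M - P + Am *m P).
  rewrite [in RHS]mulmxDr mulKmx // mulmxBl mul1mx /X -mulmxA.
  have -> : (1%:M - P) *m (1%:M - P) = 1%:M - P by rewrite mulmxBr mulmx1 mulmxBl mul1mx PP subrr subr0.
  by rewrite opprB addrCA [X in _ + X]addrCA subrr addr0.
by rewrite det_mulmx det_Hm // det_inv mulrC.
Qed.

Lemma mu_Hm eps g : g^T *m g = 1%:M -> mu bI eps g = (\det (Hm g) / \det Am) `^ (2 * eps)^-1.
Proof. by move=> gg; rewrite /mu det_h_space. Qed.

End Inertia.

(** * Evolution of the tangent vectors *)

Section Linearization.
Context {R : realType} {n : nat}.
Local Notation N := n.+1.
Local Notation d := #|{: ltpair N}|.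
Variables (bI : 'End(so R N)) (eps : R).
Hypotheses (bIs : so_symmetric bI) (bIp : so_posdef bI).
Local Notation A := (Am bI).

Lemma mxder_fst (V : normedModType R) p q (X : R -> 'M[R]_(p, q) * V) t v :
  is_derive t (1 : R) X v -> mxder (fun s => (X s).1) t v.1.
Proof.
move=> dX i j; apply: (@is_derive_functional _ ('M[R]_(p, q) * V)%type (fun x => x.1 i j) R X t 1 v _ dX).
exact: (@functional_fst _ _ V _ (functional_coord i j)).
Qed.

Lemma mxder_snd (V : normedModType R) p q (X : R -> V * 'M[R]_(p, q)) t v :
  is_derive t (1 : R) X v -> mxder (fun s => (X s).2) t v.2.
Proof.
move=> dX i j; apply: (@is_derive_functional _ (V * 'M[R]_(p, q))%type (fun x => x.2 i j) R X t 1 v _ dX).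
exact: (@functional_snd _ V _ _ (functional_coord i j)).
Qed.

(* Agrees with [ang_vel] on skew matrices; unlike [toso], which is an unspecified
   projection outside so(N), it has a known matrix. *)
Definition angm (m : 'M[R]_N) : 'M[R]_N := uncrd (crd m *m invmx A).

Lemma angm_linear : linear angm.
Proof. by move=> a x y; rewrite /angm crd_linear mulmxDl -scalemxAl uncrd_linear. Qed.

Lemma skew_angm m : skew (angm m). Proof. exact: skew_uncrd. Qed.

Lemma angmE m : skew m -> vsval (ang_vel bI m) = angm m.
Proof.
by move=> sm; rewrite /angm -uncrd_scrd /ang_vel scrd_bIV // scrd_toso.
Qed.

Lemma crd_angm m : crd (angm m) = crd m *m invmx A.
Proof. exact: crdK. Qed.

Lemma crd_angm_Am m : crd m = crd (angm m) *m A.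
Proof. by rewrite crd_angm mulmxKV //; exact/posdef_unit/Am_posdef. Qed.

(* The reduced equations with the multiplier eliminated. *)
Record on_shell (m : 'M[R]_N) (g : 'cV[R]_N) (m1 : 'M[R]_N) (g1 : 'cV[R]_N) : Prop := OnShell {
  os_skew : skew m ;
  os_sphere : g^T *m g = 1%:M ;
  os_constraint : angm m = wdg (angm m *m g) g ;
  os_skew1 : skew m1 ;
  os_force : (m1 - lie m (angm m)) *m g = 0 ;
  os_gamma : g1 = - eps *: (angm m *m g) }.

Lemma constraintE g (w : so R N) : pr_h g w = 0 <-> vsval w = wdg (vsval w *m g) g.
Proof.
have E : vsval (pr_v g w) = wdg (vsval w *m g) g.
  rewrite -uncrd_scrd scrd_pr_v mulmxA crd_mul_Jm; last exact: so_skew.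
  by rewrite mulT_Jm uncrdK //; exact: skew_wdg.
rewrite -E; split=> [H|H]; first by congr vsval; exact: subr0_eq H.
by apply/eqP; rewrite subr_eq0; apply/eqP/val_inj.
Qed.

Lemma on_shellP x u : G0 bI x -> reduced_system bI eps x u -> on_shell x.1 x.2 u.1 u.2.
Proof.
case: x => m g [[/= mso gS] prh] [l [lh _ u1 u2]].
have sm : skew m by apply/eqP; rewrite -so_spaceE.
rewrite angmE // in u1 u2; split=> //.
- by have /constraintE := prh; rewrite angmE.
- rewrite u1 /skew linearD /= so_skew opprD; congr (_ + _).
  exact: skew_lie sm (skew_angm m).
by rewrite u1 addrC addKr; apply/mem_h_space.
Qed.

(** Variations of the fields of [on_shell], with [c] the variation of gamma. The unknown is the
    variation of omega, and [dm] is replaced by A times it; thus [dm, omega] becomes the term with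
    [adm (angm m)]. In the constraint, - c /\ y is the variation of the second factor of y /\
    gamma. *)
Record linearized (m : 'M[R]_N) (g : 'cV[R]_N) (m1 dm : 'M[R]_N) (c : 'cV[R]_N)
    (dm1 : 'M[R]_N) (dc1 : 'cV[R]_N) : Prop := Linearized {
  ln_skew : skew dm ;
  ln_skew1 : skew dm1 ;
  ln_sphere : c^T *m g = 0 ;
  ln_constraint : crd (angm dm) =
    crd (angm dm) *m (Jm g)^T *m Jm g - c^T *m Jm (angm m *m g) ;
  ln_force : crd dm1 *m (Jm g)^T =
    (crd (angm dm) *m adm m - crd (angm dm) *m A *m adm (angm m)) *m (Jm g)^T
    - c^T *m (m1 - lie m (angm m))^T ;
  ln_gamma : dc1^T = - eps *: (crd (angm dm) *m (Jm g)^T) + eps *: (c^T *m angm m) }.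

Lemma mxder_skew p (X : R -> 'M[R]_p) t X' :
  (\forall s \near t, (X s)^T = - X s) -> mxder X t X' -> X'^T = - X'.
Proof.
move=> sX dX; apply: (mxder_unique (mxderT dX)); apply: mxder_near (mxderN dX).
by apply: filterS sX => s ->.
Qed.

Lemma mxder_orth p q (X : R -> 'M[R]_(p, q)) t X' :
  (\forall s \near t, (X s)^T *m X s = 1%:M) -> mxder X t X' ->
  X'^T *m X t + (X t)^T *m X' = 0.
Proof.
move=> oX dX; apply: (mxder_unique (mxderM (mxderT dX) dX)).
by apply: mxder_near (mxderC 1%:M t); apply: filterS oX => s ->.
Qed.

Lemma mxder_sphere p (X : R -> 'cV[R]_p) t X' :
  (\forall s \near t, (X s)^T *m X s = 1%:M) -> mxder X t X' -> X'^T *m X t = 0.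
Proof.
move=> oX dX; have := mxder_orth oX dX.
have -> : (X t)^T *m X' = X'^T *m X t.
  by rewrite [LHS]mx11_scalar -[(_ *m _) 0 0]trace_mx11 -mxtrace_tr trmx_mul trmxK trace_mx11 -mx11_scalar.
by rewrite -mulr2n -scaler_nat => /eqP; rewrite scaler_eq0 pnatr_eq0 => /eqP.
Qed.

(** Both sides of each equation agree along the curve near 0, so their derivatives at 0 coincide. *)
Lemma linearize (m : R -> 'M[R]_N) (g : R -> 'cV[R]_N) (m1 : R -> 'M[R]_N) (g1 : R -> 'cV[R]_N)
    dm c dm1 dc1 :
  (\forall s \near (0 : R), on_shell (m s) (g s) (m1 s) (g1 s)) ->
  mxder m 0 dm -> mxder g 0 c -> mxder m1 0 dm1 -> mxder g1 0 dc1 ->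
  linearized (m 0) (g 0) (m1 0) dm c dm1 dc1.
Proof.
move=> os Dm Dg Dm1 Dg1; have os0 := nbhs_singleton os.
have Dw : mxder (fun s => angm (m s)) 0 (angm dm) by apply: mxder_lin Dm; exact: angm_linear.
set w := angm (m 0); set y := w *m g 0; set u := angm dm.
have wE : w = wdg y (g 0) by exact: os_constraint os0.
have gg := os_sphere os0.
have sdm : skew dm by apply: mxder_skew Dm; apply: filterS os => s [].
have sdm1 : skew dm1 by apply: mxder_skew Dm1; apply: filterS os => s [].
have su : skew u by exact: skew_angm.
have cg : c^T *m g 0 = 0 by apply: mxder_sphere Dg; apply: filterS os => s [].
have lieD (X Y : R -> 'M[R]_N) X' Y' : mxder X 0 X' -> mxder Y 0 Y' ->
    mxder (fun s => lie (X s) (Y s)) 0 (lie X' (Y 0) + lie (X 0) Y').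
  move=> dX dY; apply: mxder_eq; first exact: (mxderB (mxderM dX dY) (mxderM dY dX)).
  by rewrite /lie [X in _ - X]addrC opprD addrACA.
split=> //.
- have D1 := mxderM Dw Dg.
  have D2 : mxder (fun s => wdg (angm (m s) *m g s) (g s)) 0
      (wdg (u *m g 0 + w *m c) (g 0) + wdg y c).
    apply: mxder_eq.
      exact: (mxderB (mxderM D1 (mxderT Dg)) (mxderM Dg (mxderT D1))).
    by rewrite /wdg -/w -/u -/y [X in _ - X]addrC opprD addrACA.
  have D3 : mxder (fun s => wdg (angm (m s) *m g s) (g s)) 0 u.
    apply: (mxder_near _ Dw); apply: filterS os => s oss; exact: os_constraint oss.
  transitivity (crd (wdg (u *m g 0 + w *m c) (g 0) + wdg y c)).
    by congr crd; exact: (mxder_unique D3 D2).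
  (* As omega = y /\ gamma and c is orthogonal to gamma, omega c is a multiple of gamma, and its
     wedge with gamma vanishes. *)
  have wc : (w *m c)^T *m Jm (g 0) = 0.
    have -> : w *m c = - (g 0 *m (y^T *m c)).
      rewrite {1}wE /wdg mulmxBl -(mulmxA y) -(mulmxA (g 0)).
      have -> : (g 0)^T *m c = 0 by rewrite -[LHS]trmxK trmx_mul trmxK cg trmx0.
      by rewrite [y *m 0]mulmx0 sub0r.
    by rewrite linearN /= trmx_mul mulNmx -mulmxA gJm mulmx0 oppr0.
  rewrite linearD /= -mulT_Jm linearD /= mulmxDl wc addr0 crd_mul_Jm //.
  by rewrite -[crd (wdg y c)]mulT_Jm (JmC y c).
- have D := mxderM (mxderB Dm1 (lieD _ _ _ _ Dm Dw)) Dg.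
  have D0 : mxder (fun s => (m1 s - lie (m s) (angm (m s))) *m g s) 0 0.
    apply: mxder_near (mxderC 0 0).
    by apply: filterS os => s [_ _ _ _ -> _].
  have F : dm1 *m g 0 = lie dm w *m g 0 + lie (m 0) u *m g 0 - (m1 0 - lie (m 0) w) *m c.
    have /eqP := mxder_unique D D0; rewrite mulmxBl mulmxDl addr_eq0 subr_eq => /eqP ->.
    by rewrite addrC.
  have sm := os_skew os0; have sw := skew_angm (m 0).
  rewrite crd_mul_Jm // F linearB linearD /=.
  rewrite -(crd_mul_Jm (g 0) (skew_lie sdm sw)) -(crd_mul_Jm (g 0) (skew_lie sm su)).
  rewrite trmx_mul mulmxBl; congr (_ - _); rewrite [LHS]addrC -(mul_adm (m 0) su); congr (_ + _).
  rewrite -[RHS]mulNmx; congr (_ *m _); rewrite -crd_angm_Am mul_adm // -linearN.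
  by rewrite /lie opprB.
have D : mxder g1 0 (- eps *: (u *m g 0 + w *m c)).
  apply: (mxder_near _ (mxderZ (- eps) (mxderM Dw Dg))).
  by apply: filterS os => s [_ _ _ _ _ ->].
rewrite (mxder_unique Dg1 D) crd_mul_Jm // linearZ linearD /= scalerDr; congr (_ + _).
by rewrite trmx_mul (skew_angm (m 0) : w^T = - w) mulmxN scalerN scaleNr opprK.
Qed.

End Linearization.

(** * Transport of the completed frame and the conserved product *)

Section Evolution.
Context {R : realType} {n r k : nat}.
Local Notation N := n.+1.
Local Notation d := #|{: ltpair N}|.
Variables (bI : 'End(so R N)) (eps : R).
Hypotheses (bIs : so_symmetric bI) (bIp : so_posdef bI) (eps0 : eps != 0).
Local Notation A := (Am bI).

(** Data common to both systems: [r] is 0 for the reduced one, and dim SO for the full one, with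
    [be] the left-trivialised variation g^-1 dg. *)
Variables (T : set R) (m m1 : R -> 'M[R]_N) (g g1 : R -> 'cV[R]_N).
Variables (dm dm1 : 'I_k -> R -> 'M[R]_N) (c c1 : 'I_k -> R -> 'cV[R]_N).
Variables (be : 'I_k -> R -> 'rV[R]_r) (B0 : R -> 'M[R]_r) (Q : R -> 'M[R]_(d, r)).
Hypotheses (Topen : open T) (Titv : is_interval T).
Hypothesis shell : forall t, T t -> on_shell bI eps (m t) (g t) (m1 t) (g1 t).
Hypothesis lin : forall t i, T t ->
  linearized bI eps (m t) (g t) (m1 t) (dm i t) (c i t) (dm1 i t) (c1 i t).
Hypotheses (Dm : forall t, T t -> mxder m t (m1 t)) (Dg : forall t, T t -> mxder g t (g1 t)).
Hypotheses (Ddm : forall t i, T t -> mxder (dm i) t (dm1 i t)).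
Hypotheses (Dc : forall t i, T t -> mxder (c i) t (c1 i t)).
Hypothesis Dbe : forall t i, T t ->
  mxder (be i) t (be i t *m B0 t + crd (angm bI (dm i t)) *m Q t).
Hypothesis B0tr : forall t, T t -> \tr (B0 t) = 0.

Let w t := angm bI (m t).
Let y t := w t *m g t.
Let y1 t := angm bI (m1 t) *m g t + w t *m g1 t.
Let u i t := crd (angm bI (dm i t)).
Let Jy t := Jm (y t).

Lemma near_T t : T t -> \forall s \near t, T s.
Proof. by move=> Tt; apply: open_nbhs_nbhs; split. Qed.

Let Dw t : T t -> mxder w t (angm bI (m1 t)).
Proof. by move=> Tt; apply: mxder_lin (Dm Tt); exact: angm_linear. Qed.

Let Dy t : T t -> mxder y t (y1 t).
Proof. by move=> Tt; exact: mxderM (Dw Tt) (Dg Tt). Qed.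

Let g1E t : T t -> g1 t = - eps *: y t.
Proof. by move=> /shell[]. Qed.

Let DJ t : T t -> mxder (fun s => Jm (g s)) t (- eps *: Jy t).
Proof.
move=> Tt; apply: mxder_eq; first by apply: mxder_lin (Dg Tt); exact: Jm_linear.
rewrite (g1E Tt) /Jy; have := Jm_linear (- eps) (y t) 0; rewrite !addr0 => ->.
suff -> : Jm (0 : 'cV[R]_N) = 0 by rewrite addr0.
by have := Jm_linear (-1) (0 : 'cV[R]_N) 0; rewrite scaler0 addr0 scaleN1r addNr.
Qed.

Let DJy t : T t -> mxder Jy t (Jm (y1 t)).
Proof. by move=> Tt; apply: mxder_lin (Dy Tt); exact: Jm_linear. Qed.

Definition evol_mx t : 'M[R]_(r + (N + N)) :=
  Bmx eps A (adm (w t)) (adm (m t)) (Jm (g t)) (Jy t) (w t) (g t) (y t)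
    (- (m1 t - lie (m t) (w t))^T) (eps *: (w t *m Jy t) + Jm (y1 t)) (B0 t) (Q t).

Definition tangent_row i t : 'rV[R]_(r + (N + N)) :=
  row_mx (be i t) (row_mx (u i t *m (Jm (g t))^T) (c i t)^T).

Lemma mxder_row p q (X : R -> 'rV[R]_p) (Y : R -> 'rV[R]_q) t X' Y' :
  mxder X t X' -> mxder Y t Y' -> mxder (fun s => row_mx (X s) (Y s)) t (row_mx X' Y').
Proof.
move=> dX dY i j; rewrite mxE.
have -> : (fun s => row_mx (X s) (Y s) i j) =
   (fun s => match fintype.split j with inl l => X s i l | inr l => Y s i l end).
  by apply/funext => s; rewrite mxE.
by case: fintype.split.
Qed.

Lemma mxder_col p q l (X : R -> 'M[R]_(p, l)) (Y : R -> 'M[R]_(q, l)) t X' Y' :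
  mxder X t X' -> mxder Y t Y' -> mxder (fun s => col_mx (X s) (Y s)) t (col_mx X' Y').
Proof.
move=> dX dY i j; rewrite mxE.
have -> : (fun s => col_mx (X s) (Y s) i j) =
   (fun s => match fintype.split i with inl h => X s h j | inr h => Y s h j end).
  by apply/funext => s; rewrite mxE.
by case: fintype.split.
Qed.

(** The linearised constraint holds throughout the time interval and can be differentiated once
    more; with the linearised force equation this supplies the hypotheses of [Bmx_row]. *)
Lemma tangent_row_der t i : T t ->
  mxder (tangent_row i) t (tangent_row i t *m evol_mx t).
Proof.
move=> Tt; have [_ sdm1 cg uE fE cE] := lin i Tt; have os := shell Tt.
have gg := os_sphere os; have sw : skew (w t) := skew_angm bI (m t).
pose u1 := crd (angm bI (dm1 i t)).
have Du : mxder (u i) t u1.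
  have l : linear (fun X => crd (angm bI X)).
    by move=> a X Y; rewrite angm_linear crd_linear.
  exact: mxder_lin l (Ddm i Tt).
have DJT := mxderT (DJ Tt).
have Dz := mxderM Du DJT.
have z1E : u1 *m (Jm (g t))^T + u i t *m (- eps *: Jy t)^T =
    u1 *m (Jm (g t))^T - eps *: (u i t *m (Jy t)^T).
  by rewrite linearZ /= -scalemxAr scaleNr.
rewrite z1E in Dz.
have c1E : (c1 i t)^T = - eps *: (u i t *m (Jm (g t))^T) + eps *: ((c i t)^T *m w t) by [].
(* Two terms in z Jy cancel: - eps z Jy from the motion of gamma and + eps z Jy from the derivative
   of [c]. What remains besides z' J defines the [N1] slot of [evol_mx]. *)
have u1E : u1 = (u1 *m (Jm (g t))^T - eps *: (u i t *m (Jy t)^T)) *m Jm (g t)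
    - (c i t)^T *m (eps *: (w t *m Jy t) + Jm (y1 t)).
  have D1 := mxderB (mxderM Dz (DJ Tt)) (mxderM (mxderT (Dc i Tt)) (DJy Tt)).
  have D2 : mxder (u i) t _ := mxder_near _ D1.
  rewrite [LHS](mxder_unique Du (D2 _)); last first.
    by apply: filterS (near_T Tt) => s Ts; exact/esym/(ln_constraint (lin i Ts)).
  rewrite c1E -addrA; congr (_ + _).
  set z := u i t *m _; set cT := (c i t)^T.
  rewrite -(scalemxAr (- eps) z) scaleNr [in LHS]mulmxDl -(scalemxAl (- eps) z) scaleNr.
  rewrite -(scalemxAl eps (cT *m w t)) -(mulmxA cT) (mulmxDr cT) -(scalemxAr eps cT).
  by rewrite -[in LHS]addrA opprD opprK addrA addNr add0r.
have z0 : mxder (tangent_row i) t (row_mx (be i t *m B0 t + u i t *m Q t)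
    (row_mx (u1 *m (Jm (g t))^T - eps *: (u i t *m (Jy t)^T)) (c1 i t)^T)).
  by apply: mxder_row; [exact: Dbe|apply: mxder_row; [exact: Dz|exact: mxderT (Dc i Tt)]].
apply: mxder_eq z0 _; rewrite c1E; apply/esym; apply: Bmx_row => //.
- exact: Am_posdef.
- exact: sphereJ.
- exact: gJm.
- by rewrite /Jy JmC.
- by rewrite -crd_angm_Am // fE mulmxN.
Qed.

Hypothesis dims : (r + (N + N) = k + (1 + 1))%N.

(* Completed to a square matrix, up to a cast, by the two normals of T S^n in R^N x R^N. *)
Definition frame_mx t : 'M[R]_(k + (1 + 1), r + (N + N)) :=
  col_mx (\matrix_(i < k) tangent_row i t)
    (col_mx (row_mx 0 (row_mx (g t)^T 0)) (row_mx 0 (row_mx 0 (g t)^T))).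

Lemma frame_mx_der t : T t -> mxder frame_mx t (frame_mx t *m evol_mx t).
Proof.
move=> Tt; have os := shell Tt; have gg := os_sphere os.
have sw : skew (w t) := skew_angm bI (m t).
have gT : mxder (fun s => (g s)^T) t (- eps *: (y t)^T).
  by apply: mxder_eq; [exact: mxderT (Dg Tt)|rewrite (g1E Tt) linearZ].
rewrite /frame_mx !mul_col_mx; apply: mxder_col.
  move=> i j; have := tangent_row_der i Tt 0 j.
  have -> : (fun s => tangent_row i s 0 j) = (fun s => (\matrix_(i < k) tangent_row i s) i j).
    by apply/funext => s; rewrite mxE.
  suff -> : (tangent_row i t *m evol_mx t) 0 j =
    ((\matrix_(i < k) tangent_row i t) *m evol_mx t) i j by [].
  by rewrite !mxE; apply: eq_bigr => l _; rewrite [in RHS]mxE.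
apply: mxder_col.
  rewrite /evol_mx Bmx_z //; last exact: gJm.
  exact: (mxder_row (mxderC 0 t) (mxder_row gT (mxderC 0 t))).
rewrite /evol_mx Bmx_c //.
exact: (mxder_row (mxderC 0 t) (mxder_row (mxderC 0 t) gT)).
Qed.

Definition frame_det t := \det (castmx (erefl (k + (1 + 1))%N, dims) (frame_mx t)).

Let sg t := sigma A (adm (w t)) (Jm (g t)) (g t).

Lemma frame_det_der t : T t -> is_derive t (1 : R) frame_det (- sg t * frame_det t).
Proof.
move=> Tt; have os := shell Tt; have gg := os_sphere os.
have sw : skew (w t) := skew_angm bI (m t).
have := der_det_cast dims (frame_mx_der Tt).
rewrite /evol_mx tr_Bmx //.
- exact: Am_sym.
- exact: Am_posdef.
- exact: adm_anti (os_skew os).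
- exact: sphereJ.
- exact: gJm.
- exact: B0tr.
Qed.

Lemma Hm_der t : T t ->
  is_derive t (1 : R) (fun s => \det (Hm bI (g s))) (2 * eps * sg t * \det (Hm bI (g t))).
Proof.
move=> Tt; have os := shell Tt; have gg := os_sphere os.
have sw : skew (w t) := skew_angm bI (m t).
have Dgg : mxder (fun s => g s *m (g s)^T) t (- eps *: (y t *m (g t)^T + g t *m (y t)^T)).
  apply: mxder_eq; first exact: (mxderM (Dg Tt) (mxderT (Dg Tt))).
  by rewrite (g1E Tt) linearZ /= -scalemxAl -scalemxAr scalerDr.
have DH : mxder (fun s => Hm bI (g s)) t (Hmx' eps A (Jm (g t)) (Jy t) (g t) (y t)).
  apply: mxder_eq.
    exact: (mxderD (mxderM (mxderM (DJ Tt) (mxderC A t)) (mxderT (DJ Tt))) Dgg).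
  rewrite /Hmx' mulmx0 addr0 linearZ /= -!scalemxAl -scalemxAr.
  by rewrite -!scalerDr !addrA.
apply: is_derive_eq; first exact: der_det DH.
have Hu : Hm bI (g t) \in unitmx.
  by apply: Hunit; [exact: Am_posdef|exact: sphereJ].
have -> : \adj (Hm bI (g t)) = \det (Hm bI (g t)) *: invmx (Hm bI (g t)).
  have dn : \det (Hm bI (g t)) != 0 by move: Hu; rewrite unitmxE unitfE.
  by rewrite /invmx Hu scalerA divff // scale1r.
have trH : \tr (Hmx' eps A (Jm (g t)) (Jy t) (g t) (y t) *m invmx (Hm bI (g t))) = 2 * eps * sg t.
  exact: (tr_Hmx' eps (Am_sym bIs) (Am_posdef bIp) (adm_anti sw) sw gg (erefl (y t))
    (Jm_adm (g t) sw) (sphereJ gg) (gJm (g t))).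
by rewrite -scalemxAr mxtraceZ trH mulrC.
Qed.

Lemma det_Am_gt0 : 0 < \det A. Proof. exact/posdef_det/Am_posdef. Qed.

(** The exponent 1/(2 eps) cancels the factor 2 eps of [Hm_der], leaving a logarithmic derivative
    opposite to that of [frame_det]. *)
Lemma mu_der t : T t -> is_derive t (1 : R) (fun s => mu bI eps (g s)) (sg t * mu bI eps (g t)).
Proof.
move=> Tt; have gg := os_sphere (shell Tt).
pose e := (2 * eps)^-1; pose h s := \det (Hm bI (g s)) / \det A.
have h0 : 0 < h t.
  rewrite divr_gt0 ?det_Am_gt0 //; apply: posdef_det.
  by apply: posdef_Hmx; [exact: Am_posdef|exact: sphereJ].
have Dh : is_derive t (1 : R) h (2 * eps * sg t * h t).
  by apply: is_derive_eq; [exact: (derM (Hm_der Tt) (derC _ t))|rewrite mulr0 addr0 mulrA].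
have D : is_derive t (1 : R) (fun s => h s `^ e) (sg t * h t `^ e).
  have D1 := is_derive1_powR e h0.
  have D2 : is_derive t (1 : R) ((fun x => x `^ e) \o h) (e * h t `^ (e - 1) * (2 * eps * sg t * h t)).
    exact: is_derive1_comp.
  apply: is_derive_eq D2 _.
  have -> : h t `^ e = h t `^ (e - 1) * h t.
    have hn : h t != 0 by rewrite gt_eqF.
    by rewrite -[X in _ * X](powRr1 (ltW h0)) -powRD ?subrK // hn implybT.
  rewrite /e; field.
  by rewrite eps0.
rewrite (mu_Hm bIp eps gg); apply: near_eq_is_derive D.
apply: filterS (near_T Tt) => s Ts; rewrite (mu_Hm bIp eps) //.
exact: os_sphere (shell Ts).
Qed.

Lemma mu_frame_det_const s t : T s -> T t ->
  mu bI eps (g s) * frame_det s = mu bI eps (g t) * frame_det t.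
Proof.
apply: (der_const_itv (f := fun s => mu bI eps (g s) * frame_det s) Titv) => x Tx.
apply: is_derive_eq; first exact: (derM (mu_der Tx) (frame_det_der Tx)).
by rewrite mulNr mulrN [X in _ - X]mulrCA [X in _ - X]mulrA subrr.
Qed.

(** The two completing rows are unit vectors, orthogonal to each other and to the tangent rows, so
    the Gram matrix splits off an identity block. *)
Lemma frame_det_sqr t : T t ->
  frame_det t ^+ 2 = \det ((\matrix_(i < k) tangent_row i t) *m (\matrix_(i < k) tangent_row i t)^T).
Proof.
move=> Tt; have gg := os_sphere (shell Tt).
rewrite /frame_det det_cast_sqr /frame_mx; set Wm := \matrix_i _.
have W0 (x : 'rV[R]_(r + (N + N))) : (forall i, tangent_row i t *m x^T = 0) -> Wm *m x^T = 0.
  by move=> H; apply/row_matrixP => i; rewrite row_mul rowK H row0.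
have gz : Wm *m (row_mx 0 (row_mx (g t)^T 0))^T = 0.
  apply: W0 => i; rewrite !tr_row_mx !mul_row_col !trmx0 !mulmx0 add0r addr0 trmxK.
  by rewrite -mulmxA -[_ *m g t]trmxK trmx_mul trmxK gJm trmx0 mulmx0.
have gc : Wm *m (row_mx 0 (row_mx 0 (g t)^T))^T = 0.
  apply: W0 => i; rewrite !tr_row_mx !mul_row_col !trmx0 !mulmx0 !add0r trmxK.
  by have [_ _ -> _ _ _] := lin i Tt.
set z := row_mx 0 (row_mx (g t)^T 0) in gz *; set c' := row_mx 0 _ in gc *.
have zz : z *m z^T = 1%:M.
  by rewrite /z !tr_row_mx !mul_row_col !trmx0 !mulmx0 add0r addr0 trmxK.
have cc : c' *m c'^T = 1%:M.
  by rewrite /c' !tr_row_mx !mul_row_col !trmx0 !mulmx0 !add0r trmxK.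
have zc : z *m c'^T = 0.
  by rewrite /c' !tr_row_mx !mul_row_col !trmx0 !mulmx0 !mul0mx !add0r.
have cz : c' *m z^T = 0 by rewrite -[LHS]trmxK trmx_mul trmxK zc trmx0.
have zW : z *m Wm^T = 0 by rewrite -[LHS]trmxK trmx_mul trmxK gz trmx0.
have cW : c' *m Wm^T = 0 by rewrite -[LHS]trmxK trmx_mul trmxK gc trmx0.
rewrite !tr_col_mx mul_col_mx !mul_mx_row mul_col_mx gz gc zW cW row_mx0 col_mx0.
rewrite -block_mxEv det_lblock !mul_col_mx zz zc cz cc.
by rewrite -block_mxEh det_lblock !det1 !mulr1.
Qed.

Lemma evolution_sqr s t : T s -> T t ->
  let G t := (\matrix_(i < k) tangent_row i t) *m (\matrix_(i < k) tangent_row i t)^T in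
  mu bI eps (g s) ^+ 2 * \det (G s) = mu bI eps (g t) ^+ 2 * \det (G t).
Proof.
move=> Ts Tt G; have := congr1 (fun z => z ^+ 2) (mu_frame_det_const Ts Tt).
by rewrite !exprMn (frame_det_sqr Ts) (frame_det_sqr Tt).
Qed.

End Evolution.

(** * The volume form on the constraint manifold *)

Section Gram.
Context {R : realType} {n r k : nat}.
Local Notation N := n.+1.
Local Notation d := #|{: ltpair N}|.
Local Notation q := #|{: ltpair n}|.
Variables (g : 'cV[R]_N) (F : 'M[R]_(N, n)).
Hypotheses (gg : g^T *m g = 1%:M) (FF : F^T *m F = 1%:M) (Fg : F^T *m g = 0).

Lemma orth_row_mx : (row_mx g F : 'M[R]_N)^T *m (row_mx g F : 'M[R]_N) = 1%:M.
Proof.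
have gF : g^T *m F = 0 by rewrite -[LHS]trmxK trmx_mul trmxK Fg trmx0.
by rewrite (tr_row_mx g F) (mul_col_row g^T F^T g F) gg FF Fg gF -scalar_mx_block.
Qed.

Lemma frame_complete : F *m F^T = 1%:M - g *m g^T.
Proof.
have := mulmx1C orth_row_mx; rewrite (tr_row_mx g F) (mul_row_col g F) => <-.
by rewrite addrAC subrr add0r.
Qed.

Lemma det_frame_sqr : \det (row_mx g F : 'M[R]_N) ^+ 2 = 1.
Proof. by rewrite expr2 -{1}det_tr -det_mulmx orth_row_mx det1. Qed.

(** The orthogonal splitting of so(N) into h_gamma, read in the frame as so(n), and v_gamma, read
    through X |-> X gamma. In the trace, F F^T = 1 - g g^T is expanded; the term with two factors g
    g^T vanishes because g^T Y g = 0. *)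
Lemma parseval X Y : skew X -> skew Y ->
  crd X *m (crd Y)^T = crd (F^T *m X *m F) *m (crd (F^T *m Y *m F))^T + (X *m g)^T *m (Y *m g).
Proof.
move=> sX sY.
have sF (Z : 'M[R]_N) : skew Z -> skew (F^T *m Z *m F).
  by move=> sZ; rewrite /skew !trmx_mul trmxK sZ !(mulNmx, mulmxN) !mulmxA.
rewrite [LHS]mx11_scalar [X in _ = X + _]mx11_scalar -!pairingE //; try exact: sF.
rewrite [(X *m g)^T *m _]mx11_scalar -raddfD; congr (_%:M); rewrite /pairing.
set s := _ 0 0.
have e1 : \tr (g^T *m X *m Y *m g) = - s.
  by rewrite trace_mx11 /s trmx_mul sX mulmxN !mulNmx [X in _ = - X]mxE opprK !mulmxA.
have sE : \tr (g^T *m Y *m X *m g) = - s.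
  by rewrite -mxtrace_tr !trmx_mul trmxK sX sY !(mulmxN, mulNmx) opprK !mulmxA e1.
have xg (Z : 'M[R]_N) : skew Z -> g^T *m Z *m g = 0.
  by move=> sZ; apply: mx11_anti; rewrite !trmx_mul trmxK sZ !(mulNmx, mulmxN) !mulmxA.
have -> : \tr (F^T *m X *m F *m (F^T *m Y *m F)) = \tr (X *m Y) + s + s.
  have -> : \tr (F^T *m X *m F *m (F^T *m Y *m F)) = \tr (X *m (F *m F^T) *m Y *m (F *m F^T)).
    by rewrite !mulmxA [RHS]mxtrace_mulC !mulmxA.
  have E4 : X *m (F *m F^T) *m Y *m (F *m F^T) =
      X *m Y - X *m g *m (g^T *m Y) - X *m Y *m g *m g^T + X *m g *m (g^T *m Y *m g) *m g^T.
    rewrite frame_complete !(mulmxBr, mulmxBl, mulmx1, mulmxA, opprB).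
    by rewrite addrA addrAC.
  rewrite E4 xg // mulmx0 mul0mx addr0 !raddfB /=.
  rewrite [\tr (_ *m (g^T *m Y))]mxtrace_mulC [\tr (_ *m g^T)]mxtrace_mulC !mulmxA sE e1.
  by rewrite !opprK.
by field.
Qed.

Lemma skew_conj (U : 'M[R]_n) : skew U -> skew (F *m U *m F^T).
Proof. by move=> sU; rewrite /skew !trmx_mul trmxK sU mulNmx mulmxN mulmxA. Qed.

Lemma conj_frame (U : 'M[R]_n) : F^T *m (F *m U *m F^T) *m F = U.
Proof. by rewrite !mulmxA FF mul1mx -mulmxA FF mulmx1. Qed.

Lemma parseval_frame X (U : 'M[R]_n) : skew X -> skew U ->
  crd X *m (crd (F *m U *m F^T))^T = crd (F^T *m X *m F) *m (crd U)^T.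
Proof.
move=> sX sU; rewrite parseval //; last exact: skew_conj.
by rewrite conj_frame -[F *m U *m F^T *m g]mulmxA Fg !mulmx0 addr0.
Qed.

Lemma schur_det p p' (S : 'M[R]_p) (B : 'M[R]_(p, p')) :
  \det (block_mx S B B^T 1%:M) = \det (S - B *m B^T).
Proof.
have -> : block_mx S B B^T 1%:M =
    block_mx 1%:M B 0 1%:M *m block_mx (S - B *m B^T) 0 B^T 1%:M.
  rewrite mulmx_block !mul1mx !mul0mx !mulmx1 !add0r.
  by rewrite subrK.
by rewrite det_mulmx det_ublock det_lblock !det1 !mulr1 mul1r.
Qed.

Lemma det_gram_mulr p p' (e : p' = p) (M : 'M[R]_(p, p')) (D : 'M[R]_p') :
  \det ((M *m D) *m (M *m D)^T) = \det D ^+ 2 * \det (M *m M^T).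
Proof.
case: p / e M => M; rewrite !det_mulmx !det_tr !det_mulmx; ring.
Qed.

Variables (A : 'M[R]_d) (Sh : 'M[R]_(r, d)).
Variables (be : 'I_k -> 'rV[R]_r) (X : 'I_k -> 'M[R]_N) (c : 'I_k -> 'cV[R]_N).
Hypothesis sX : forall i, skew (X i).

(** The bivector e_i /\ e_j of h_gamma for the l-th pair of columns of [F]. *)
Definition hvec (l : 'I_q) : 'M[R]_N := F *m uncrd (delta_mx 0 l) *m F^T.

Definition vec_coord (b : 'rV[R]_r) (Y : 'M[R]_N) (z : 'cV[R]_N) : 'rV[R]_(r + (d + n)) :=
  row_mx b (row_mx (crd Y) (z^T *m F)).

Definition coord_mx : 'M[R]_(k + q, r + (d + n)) :=
  col_mx (\matrix_(i < k) vec_coord (be i) (X i) (c i))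
    (\matrix_(l < q) vec_coord 0 (hvec l) 0).

(** Passes from (beta, angular velocity, c) to (beta, momentum, c). The shear [Sh] will absorb the
    term by which the chart of T^*SO shifts the momentum. *)
Definition scale_mx : 'M[R]_(r + (d + n)) :=
  block_mx 1%:M (row_mx (- Sh) 0) 0 (block_mx A 0 0 1%:M).

Lemma vec_coord_scale b Y z : vec_coord b Y z *m scale_mx =
  row_mx b (row_mx (crd Y *m A - b *m Sh) (z^T *m F)).
Proof.
rewrite /vec_coord mul_row_block mulmx0 mulmx1 addr0 mul_mx_row mul_row_block.
by rewrite !mulmx0 mulmx1 addr0 add0r add_row_mx add0r mulmxN addrC.
Qed.

Lemma det_scale_mx : \det scale_mx = \det A.
Proof. by rewrite /scale_mx det_ublock det1 mul1r det_lblock det1 mulr1. Qed.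

(** The normal rows are orthonormal, and the Schur complement subtracts from each Gram entry the
    product of the h_gamma parts; by [parseval] the products of the vectors X gamma remain. *)
Lemma det_coord_mx : (forall i, (c i)^T *m g = 0) ->
  let W := \matrix_(i < k) (row_mx (be i) (row_mx (crd (X i) *m (Jm g)^T) (c i)^T) : 'rV_(r + (N + N))) in
  \det (coord_mx *m coord_mx^T) = \det (W *m W^T).
Proof.
move=> cg W; rewrite /coord_mx tr_col_mx mul_col_row.
set V := \matrix_(i < k) _; set U := \matrix_(l < q) _.
have sU (l : 'I_q) : skew (uncrd (delta_mx 0 l) : 'M[R]_n) by exact: skew_uncrd.
pose B : 'M[R]_(k, q) := \matrix_(i < k) crd (F^T *m X i *m F).
have VU : V *m U^T = B.
  apply/matrixP => i l.
  have -> : (V *m U^T) i l = (row i V *m (row l U)^T) 0 0.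
    by rewrite !mxE; apply: eq_bigr => j _; rewrite !mxE.
  rewrite !rowK /vec_coord !tr_row_mx !mul_row_col trmx_mul trmx0 !trmx0 !mulmx0 !addr0 add0r.
  rewrite parseval_frame ?crdK // trmx_delta -colE [LHS]mxE.
  by rewrite [RHS]mxE.
have UU : U *m U^T = 1%:M.
  apply/matrixP => l l'.
  have -> : (U *m U^T) l l' = (row l U *m (row l' U)^T) 0 0.
    by rewrite !mxE; apply: eq_bigr => j _; rewrite !mxE.
  rewrite !rowK /vec_coord !tr_row_mx !mul_row_col !trmx_mul !trmx0 !mulmx0 ?mul0mx ?addr0 add0r.
  rewrite parseval_frame ?crdK //; last exact: skew_conj.
  by rewrite conj_frame crdK trmx_delta -colE !mxE eqxx eq_sym.
have UV : U *m V^T = B^T by rewrite -[LHS]trmxK trmx_mul trmxK VU.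
rewrite VU UV UU schur_det; congr (\det _).
apply/matrixP => i j.
have -> : (V *m V^T - B *m B^T) i j =
    (row i V *m (row j V)^T) 0 0 - (row i B *m (row j B)^T) 0 0.
  by rewrite !mxE; congr (_ - _); apply: eq_bigr => l _; rewrite !mxE.
have -> : (W *m W^T) i j = (row i W *m (row j W)^T) 0 0.
  by rewrite !mxE; apply: eq_bigr => l _; rewrite !mxE.
rewrite !rowK /vec_coord !tr_row_mx !mul_row_col parseval // !crd_mul_Jm // trmxK.
have -> : (c i)^T *m F *m ((c j)^T *m F)^T = (c i)^T *m c j.
  rewrite trmx_mul trmxK mulmxA -(mulmxA _ F) frame_complete mulmxBr mulmx1 mulmxA cg.
  by rewrite !mul0mx subr0.
rewrite trmxK ![(_ + _ : 'M[R]_1) 0 0]mxE; ring.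
Qed.

End Gram.

(** * Evaluating a restricted form on tangent and normal vectors *)

Section StaticForms.
Context {R : realType}.

Lemma bigwedge_linear_form (V : lmodType R) (I : finType) (l : I -> V -> R) :
  (forall i a x y, l i (a *: x + y) = a * l i x + l i y) -> is_form (bigwedge l).
Proof. by move=> ll; apply: bigwedge_is_form => i a x y; rewrite ll. Qed.

(** [theta] is specified only through its wedge with the dphi. Completing tangent vectors, which the
    dphi annihilate, by a family [u] dual to the dphi isolates theta v up to [wedge_const]. *)
Lemma static_sqr (V : lmodType R) (n r d k p : nat)
    (e : p = (k + #|{: ltpair n}|)%N) (e0 : p = (r + (d + n))%N)
    (f : form V p) (mu0 : R) (theta : form V k) (dphi : ltpair n -> V -> R)
    (v : 'I_k -> V) (u : 'I_#|{: ltpair n}| -> V) (b : 'I_(r + (d + n)) -> V)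
    (M : 'M[R]_(k + #|{: ltpair n}|, r + (d + n))) :
  is_form f -> is_form theta ->
  (forall i a x y, dphi i (a *: x + y) = a * dphi i x + dphi i y) ->
  fcast e (fun w => mu0 * f w) (joinf v u) = fwedge theta (bigwedge dphi) (joinf v u) ->
  (forall I i, dphi I (v i) = 0) ->
  (forall l l', dphi (enum_val l) (u l') = (l == l')%:R) ->
  (forall i, joinf v u i = \sum_j M i j *: b j) ->
  (wedge_const k #|{: ltpair n}| * theta v) ^+ 2 =
  mu0 ^+ 2 * (\det (M *m M^T) * (fcast e0 f b) ^+ 2).
Proof.
move=> ff ft dl E dv du vu.
rewrite -(form_gram e e0 ff vu) -exprMn; congr (_ ^+ 2).
rewrite -[RHS]/(fcast e (fun w => mu0 * f w) (joinf v u)) E.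
have fb : is_form (bigwedge dphi) by exact: bigwedge_linear_form.
rewrite fwedge_joinf //; last first.
  move=> w j i wj; rewrite /bigwedge (expand_det_col _ j) big1 // => l _.
  by rewrite mxE wj dv mul0r.
suff -> : bigwedge dphi u = 1 by rewrite mulr1.
rewrite /bigwedge -[RHS](det1 R #|{: ltpair n}|); congr (\det _).
by apply/matrixP => l l'; rewrite !mxE du.
Qed.

Lemma is_derive_line0 (V W : normedModType R) (f : V -> W) (x v : V) d :
  is_derive (0 : R) (1 : R) (fun s => f (s *: v + x)) d -> is_derive x v f d.
Proof.
have E : (fun h : R => h^-1 *: (f ((h *: (1 : R) + 0) *: v + x) - f (0 *: v + x))) =
         (fun h : R => h^-1 *: (f (h *: v + x) - f x)).
  by apply/funext => h; rewrite addr0 scale0r add0r [h *: (1 : R)]mulr1.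
case=> fd fE; apply: DeriveDef.
  by move: fd; rewrite /derivable /= E.
by rewrite -fE /derive /= E.
Qed.

Lemma is_derive_ray (V : normedModType R) (x v : V) :
  is_derive (0 : R) (1 : R) (fun s => s *: v + x) v.
Proof. by apply: (@is_derive_line _ _ _ id); exact: is_derive_id. Qed.

Lemma derive_along (V : normedModType R) (f : V -> R) (x v : V) (c : R -> V) (K : R) :
  differentiable f x -> is_derive (0 : R) (1 : R) c v -> c 0 = x ->
  (\forall s \near (0 : R), f (c s) = s * K + f x) -> 'D_v f x = K.
Proof.
move=> fd dc c0 fc.
have D1 : is_derive (0 : R) (1 : R) (fun s => f (c s)) ('D_v f x).
  by rewrite -c0; apply: is_derive_chain => //; rewrite c0.
have D2 : is_derive (0 : R) (1 : R) (fun s => f (c s)) K.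
  apply: (@near_eq_is_derive _ _ _ (fun s : R => s * K + f x)).
    by apply: filterS fc => s ->.
  have D3 := derD (derM (is_derive_id (0 : R) (1 : R)) (derC K 0)) (derC (f x) 0).
  apply: is_derive_eq D3 _.
  by rewrite mulr0 !addr0 mul1r.
by case: D1 D2 => _ <- [_ <-].
Qed.

Lemma derive_linear_dir (V : normedModType R) (f : V -> R) (x : V) a v w :
  differentiable f x -> 'D_(a *: v + w) f x = a * 'D_v f x + 'D_w f x.
Proof. by move=> fd; rewrite !deriveE // linearP. Qed.

End StaticForms.

(** * Differentials of the constraint functions *)

Section Constraint.
Context {R : realType} {n : nat}.
Local Notation N := n.+1.
Local Notation d := #|{: ltpair N}|.
Local Notation q := #|{: ltpair n}|.
Variables (bI : 'End(so R N)).
Hypotheses (bIs : so_symmetric bI) (bIp : so_posdef bI).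

Lemma differentiable_bigsum (V : normedModType R) k (f : 'I_k -> V -> R) x :
  (forall i, differentiable (f i) x) -> differentiable (fun y => \sum_i f i y) x.
Proof.
move=> fd; have -> : (fun y => \sum_i f i y) = \sum_i f i.
  by apply/funext => y; rewrite fct_sumE.
exact: differentiable_sum.
Qed.

Lemma ang_vel_linear : linear (fun m : 'M[R]_N => ang_vel bI m).
Proof. by move=> a x y; rewrite /ang_vel (linearP (@vsproj _ _ (so_space R N))) linearP. Qed.

Lemma differentiable_entry (V : normedModType R) p p' (f : V -> 'M[R]_(p, p')) x i j :
  differentiable f x -> differentiable (fun y => f y i j) x.
Proof.
move=> fd; apply: (@differentiable_comp _ _ _ _ f (fun X : 'M[R]_(p, p') => X i j)) => //.
exact: differentiable_coord.
Qed.

Lemma differentiable_ang_vel (V : normedModType R) (f : V -> 'M[R]_N) x i j :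
  differentiable f x -> differentiable (fun y => vsval (ang_vel bI (f y)) i j) x.
Proof.
move=> fd.
have E X : vsval (ang_vel bI X) i j = \sum_k \sum_l X k l * vsval (ang_vel bI (delta_mx k l)) i j.
  pose F : {linear 'M[R]_N -> so R N} := HB.pack (fun m : 'M[R]_N => ang_vel bI m)
    (GRing.isLinear.Build _ _ _ _ _ ang_vel_linear).
  rewrite -[ang_vel bI X]/(F X) {1}(matrix_sum_delta X) !linear_sum summxE.
  apply: eq_bigr => k _; rewrite !linear_sum summxE.
  by apply: eq_bigr => l _; rewrite !linearZ mxE.
have -> : (fun y => vsval (ang_vel bI (f y)) i j) =
  (fun y => \sum_k \sum_l f y k l * vsval (ang_vel bI (delta_mx k l)) i j).
  by apply/funext => y; rewrite E.
apply: differentiable_bigsum => k; apply: differentiable_bigsum => l.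
apply: differentiableM; last exact: differentiable_cst.
exact: differentiable_entry.
Qed.

Lemma so_dot_vwedge (w : so R N) x y : so_dot w (vwedge x y) = (x^T *m vsval w *m y) 0 0.
Proof.
rewrite so_dotE /scrd vwedgeE -mulT_Jm trmx_mul trmxK mulmxA.
rewrite crd_mul_Jm; last exact: so_skew.
by rewrite -[LHS]trace_mx11 -mxtrace_tr trmx_mul trmxK trace_mx11 mulmxA.
Qed.

(** The projections [pm] and [pg] let one statement serve both ambient spaces. *)
Lemma phi_c_differentiable (V : normedModType R) (pm : V -> 'M[R]_N) (pg : V -> 'cV[R]_N) x e ij :
  differentiable pm x -> differentiable pg x -> local_frame (pg x) e ->
  differentiable (fun y => phi_c bI e ij (pm y, pg y)) x.
Proof.
move=> dpm dpg [U [oU Ug es _]].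
have -> : (fun y => phi_c bI e ij (pm y, pg y)) = (fun y =>
    \sum_l (\sum_k e (val ij).1 (pg y) k 0 * vsval (ang_vel bI (pm y)) k l) * e (val ij).2 (pg y) l 0).
  apply/funext => y; rewrite /phi_c so_dot_vwedge mxE; apply: eq_bigr => l _; congr (_ * _).
  by rewrite mxE; apply: eq_bigr => k _; rewrite mxE.
have de i k : differentiable (fun y => e i (pg y) k 0) x.
  apply: differentiable_entry.
  apply: (@differentiable_comp _ _ _ _ pg (e i)) => //.
  by have [d _] := es i 1%N; exact: d.
apply: differentiable_bigsum => l; apply: differentiableM; last exact: de.
apply: differentiable_bigsum => k; apply: differentiableM; first exact: de.
exact: differentiable_ang_vel.
Qed.

Definition frame_of (e : 'I_n -> 'cV[R]_N -> 'cV[R]_N) g : 'M[R]_(N, n) :=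
  \matrix_(k, i) e i g k 0.

Lemma frame_ofP e g : local_frame g e -> g^T *m g = 1%:M ->
  (frame_of e g)^T *m frame_of e g = 1%:M /\ (frame_of e g)^T *m g = 0.
Proof.
move=> [U [_ Ug _ H]] gg; have [H1 H2] := H g Ug gg; split; apply/matrixP => i j.
  have := congr1 (fun M : 'M[R]_1 => M 0 0) (H1 i j); rewrite !mxE eqxx mulr1n => H3; rewrite -[RHS]H3.
  by apply: eq_bigr => k _; rewrite !mxE.
rewrite (ord1 j); have := congr1 (fun M : 'M[R]_1 => M 0 0) (H2 i); rewrite !mxE => H3; rewrite -[RHS]H3.
by apply: eq_bigr => k _; rewrite !mxE.
Qed.

Lemma hvec_frame e g (l : 'I_q) :
  vsval (vwedge (e (val (enum_val l)).1 g) (e (val (enum_val l)).2 g)) = hvec (frame_of e g) l.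
Proof.
rewrite vwedgeE /hvec /uncrd (bigD1 l) //= big1 => [|l' l'l]; last first.
  by rewrite mxE (negbTE l'l) andbF scale0r.
rewrite mxE !eqxx scale1r addr0 mulmxBr mulmxBl.
have E i j : frame_of e g *m delta_mx i j *m (frame_of e g)^T = e i g *m (e j g)^T.
  rewrite -(mul_delta_mx (0 : 'I_1)) mulmxA -colE -mulmxA -rowE -tr_col.
  by congr (_ *m _^T); apply/colP => k; rewrite !mxE.
by rewrite !E.
Qed.

(** Applying the inertia makes the angular velocity of this momentum equal to e_i /\ e_j, whence the
    duality with the constraint differentials. *)
Definition normal_vec (F : 'M[R]_(N, n)) (l : 'I_q) : 'M[R]_N := vsval (bI (toso (hvec F l))).

Lemma skew_hvec (F : 'M[R]_(N, n)) (l : 'I_q) : skew (hvec F l).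
Proof. by rewrite /hvec; apply: skew_conj; exact: skew_uncrd. Qed.

Lemma skew_normal_vec (F : 'M[R]_(N, n)) (l : 'I_q) : skew (normal_vec F l).
Proof. exact: so_skew. Qed.

Lemma ang_vel_normal (F : 'M[R]_(N, n)) (l : 'I_q) : ang_vel bI (normal_vec F l) = toso (hvec F l).
Proof. by rewrite /ang_vel /normal_vec vsvalK bIK. Qed.

Lemma crd_normal_vec (F : 'M[R]_(N, n)) (l : 'I_q) : crd (normal_vec F l) = crd (hvec F l) *m Am bI.
Proof. by rewrite -[crd (hvec F l)]scrd_toso ?mul_Am //; exact: skew_hvec. Qed.

(** With gamma held fixed, [phi_c] is affine in m along this line, with slope the pairing of two
    orthonormal bivectors. *)
Lemma dphi_normal (V : normedModType R) (pm : V -> 'M[R]_N) (pg : V -> 'cV[R]_N) x e (u : V) l l' :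
  differentiable pm x -> differentiable pg x -> local_frame (pg x) e ->
  (pg x)^T *m pg x = 1%:M ->
  (forall s, pm (s *: u + x) = s *: normal_vec (frame_of e (pg x)) l' + pm x) ->
  (forall s, pg (s *: u + x) = pg x) ->
  'D_u (fun y => phi_c bI e (enum_val l) (pm y, pg y)) x = (l == l')%:R.
Proof.
move=> dpm dpg fr gg pmu pgu; have [FF Fg] := frame_ofP fr gg.
apply: (derive_along (phi_c_differentiable (enum_val l) dpm dpg fr) (is_derive_ray x u)).
  by rewrite scale0r add0r.
apply: filterE => s; rewrite pmu pgu /phi_c ang_vel_linear so_dotE !linearP /= mulmxDl mxE.
rewrite -so_dotE; congr (_ + _); rewrite -scalemxAl mxE; congr (_ * _).
rewrite ang_vel_normal scrd_toso /scrd ?hvec_frame; last exact: skew_hvec.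
set F := frame_of e (pg x).
have -> : crd (hvec F l') *m (crd (hvec F l))^T =
    crd (F^T *m hvec F l' *m F) *m (crd (uncrd (delta_mx 0 l) : 'M[R]_n))^T.
  exact: (parseval_frame gg FF Fg (skew_hvec F l') (skew_uncrd _)).
by rewrite /hvec conj_frame // !crdK trmx_delta -colE !mxE eqxx.
Qed.

(** On [M] the velocity is y /\ gamma, so [phi_c] vanishes wherever the frame is orthonormal; a
    curve in [M] stays over the domain of the frame for small parameters. *)
Lemma dphi_tangent (V : normedModType R) (pm : V -> 'M[R]_N) (pg : V -> 'cV[R]_N)
    (M : set V) x e ij (v : V) :
  differentiable pm x -> differentiable pg x -> local_frame (pg x) e ->
  (forall y, M y -> [/\ skew (pm y), (pg y)^T *m pg y = 1%:M & pr_h (pg y) (ang_vel bI (pm y)) = 0]) ->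
  M x -> tangent M x v ->
  'D_v (fun y => phi_c bI e ij (pm y, pg y)) x = 0.
Proof.
move=> dpm dpg fr MP Mx [c [Mc c0 dc]].
have phi0 y : M y -> (forall i, (e i (pg y))^T *m pg y = 0) -> phi_c bI e ij (pm y, pg y) = 0.
  move=> /MP[sm gg /constraintE cE] eg; rewrite /phi_c so_dot_vwedge /= cE /wdg.
  rewrite mulmxBr mulmxBl !mulmxA eg !mul0mx subr0 -!mulmxA.
  have -> : (pg y)^T *m e (val ij).2 (pg y) = 0 by rewrite -[LHS]trmxK trmx_mul trmxK eg trmx0.
  by rewrite !mulmx0 mxE.
have [U [oU Ug es H]] := fr.
apply: (derive_along (phi_c_differentiable ij dpm dpg fr) dc c0).
have -> : phi_c bI e ij (pm x, pg x) = 0.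
  by apply: phi0 => // i; have [_ gg _] := MP _ Mx; have [_ ] := H _ Ug gg.
have C : {for 0, continuous (fun s => pg (c s))}.
  have [/derivable1_diffP cd _] := dc.
  apply: differentiable_continuous; apply: (@differentiable_comp _ _ _ _ c pg) => //.
  by rewrite c0.
have : \forall s \near (0 : R), U (pg (c s)).
  by apply: C; rewrite c0; apply: open_nbhs_nbhs; split.
apply: filterS => s Us; rewrite mulr0 addr0; apply: phi0 => // i.
by have [_ gg _] := MP _ (Mc s); have [_] := H _ Us gg.
Qed.

End Constraint.

(** * The ambient volume forms in linear coordinates *)

Section VolumeForms.
Context {R : realType}.

Lemma alt2_is_form (V : lmodType R) (B : V -> V -> R) :
  (forall a x y z, B (a *: x + y) z = a * B x z + B y z) ->
  (forall a x y z, B z (a *: x + y) = a * B z x + B z y) ->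
  is_form (fun v : 'I_2 -> V => B (v ord0) (v ord_max) - B (v ord_max) (v ord0)).
Proof.
move=> Bl Br.
have I2 (i : 'I_2) : i = ord0 \/ i = ord_max.
  by case: i => [[|[|//]] lt]; [left|right]; apply: val_inj.
split=> [v i c u w|v i j].
  by case: (I2 i) => ->; rewrite /upd !eqxx /= Bl Br; ring.
by case: (I2 i) => ->; case: (I2 j) => ->; rewrite ?eqxx // => _ ->; rewrite subrr.
Qed.

Lemma dgamma_is_form n (g : 'cV[R]_n.+1) : is_form (dgamma g).
Proof.
have liftE i k : exists i', lift (rshift 1 i : 'I_(1 + n)) k = i' /\ i' != rshift 1 i.
  by exists (lift (rshift 1 i) k); rewrite eq_sym neq_lift.
split=> [v i c u w|v i j ij vij]; rewrite /dgamma -det_tr; last first.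
  apply: (determinant_alternate (i1 := rshift 1 i) (i2 := rshift 1 j)).
    by rewrite (inj_eq (@rshift_inj _ _)).
  by move=> k; rewrite !mxE !(unsplitK (inr _)) !mxE vij.
rewrite -[in RHS]det_tr -[X in _ = _ + X]det_tr -[X in _ = _ + X]mul1r.
apply: (determinant_multilinear (i0 := rshift 1 i)).
- apply/rowP => k; rewrite !mxE !(unsplitK (inr _)) !mxE /upd eqxx !mxE mul1r.
  by [].
- apply/matrixP => k l; have [i' [E i'i]] := liftE i k; rewrite !mxE E.
  case: (split_ordP i') => j ji //.
  rewrite !mxE /upd; case: eqP => // jE.
  by move: i'i; rewrite ji jE eqxx.
apply/matrixP => k l; have [i' [E i'i]] := liftE i k; rewrite !mxE E.
case: (split_ordP i') => j ji //.
rewrite !mxE /upd; case: eqP => // jE.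
by move: i'i; rewrite ji jE eqxx.
Qed.

Lemma dgamma_frame n (g : 'cV[R]_n.+1) (F : 'M[R]_(n.+1, n)) (z : 'I_n -> 'rV[R]_n) :
  dgamma g (fun j => F *m (z j)^T) =
  \det (row_mx g F : 'M[R]_n.+1) * \det (\matrix_(i < n, j < n) z j 0 i).
Proof.
rewrite /dgamma; pose Y : 'M[R]_n := \matrix_(i < n, j < n) z j 0 i; rewrite -/Y.
have -> : row_mx g (\matrix_(i < n.+1, j < n) (F *m (z j)^T) i 0) =
    row_mx g F *m (block_mx 1%:M 0 0 Y : 'M[R]_(1 + n)).
  rewrite mul_row_block mulmx1 !mulmx0 addr0 add0r; congr row_mx.
  apply/matrixP => i j; rewrite !mxE; apply: eq_bigr => l _.
  by rewrite !mxE.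
by rewrite det_mulmx (det_ublock (1%:M : 'M[R]_1)) det1 mul1r.
Qed.

Lemma dm_is_form n : is_form (@dm R n).
Proof.
apply: (@bigwedge_linear_form _ 'M[R]_n.+1 _
  (fun (ij : {ij : 'I_n.+1 * 'I_n.+1 | (ij.1 < ij.2)%N}) a => a (val ij).1 (val ij).2)).
by move=> i a x y; rewrite !mxE.
Qed.

Lemma der_pairing N (X Y : R -> 'M[R]_N) t X' Y' : mxder X t X' -> mxder Y t Y' ->
  is_derive t (1 : R) (fun s => pairing (X s) (Y s)) (pairing X' (Y t) + pairing (X t) Y').
Proof.
move=> dX dY; have D := mxderM dX dY.
have DT : is_derive t (1 : R) (fun s => \tr (X s *m Y s)) (\tr (X' *m Y t + X t *m Y')).
  by rewrite /mxtrace; apply: der_sum => i; exact: D.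
have DP := derM (derC (- 2^-1) t) DT.
have -> : (fun s => pairing (X s) (Y s)) = (fun s => - 2^-1 * \tr (X s *m Y s)).
  by apply/funext => s; rewrite /pairing mulNr.
apply: is_derive_eq DP _.
by rewrite mul0r add0r /pairing mxtraceD mulrDr !mulNr.
Qed.

Lemma pairing_linearl N (a : R) (x y z : 'M[R]_N) :
  pairing (a *: x + y) z = a * pairing x z + pairing y z.
Proof. by rewrite /pairing mulmxDl -scalemxAl mxtraceD mxtraceZ; ring. Qed.

Lemma pairing_linearr N (a : R) (x y z : 'M[R]_N) :
  pairing z (a *: x + y) = a * pairing z x + pairing z y.
Proof. by rewrite /pairing mulmxDr -scalemxAr mxtraceD mxtraceZ; ring. Qed.

Section Omega.
Variable n : nat.
Local Notation N := n.+1.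
Local Notation V := ('M[R]_N * 'M[R]_N)%type.

(** The second term appears because the trivialisation x.2^T w.2 of a constant field varies with
    x.2. *)
Definition dliouville (x : V) (v w : V) : R :=
  pairing v.1 (x.2^T *m w.2) + pairing x.1 (v.2^T *m w.2).

Lemma derive_liouville (x v w : V) : 'D_v (fun y => liouville y w) x = dliouville x v w.
Proof.
have D1 := mxder_fst (is_derive_ray x v); have D2 := mxder_snd (is_derive_ray x v).
have D := der_pairing D1 (mxderM (mxderT D2) (mxderC w.2 0)).
have [_ ->] : is_derive x v (fun y => liouville y w) (dliouville x v w); last by [].
apply: is_derive_line0; apply: is_derive_eq D _.
by rewrite /dliouville mulmx0 addr0 scale0r add0r.
Qed.

Lemma OmegaE (x : V) : Omega x =
  (fun v => dliouville x (v ord0) (v ord_max) - dliouville x (v ord_max) (v ord0)).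
Proof. by apply/funext => v; rewrite /Omega /extd !derive_liouville. Qed.

Lemma Omega_is_form (x : V) : is_form (Omega x).
Proof.
rewrite OmegaE; apply: alt2_is_form => a u v w; rewrite /dliouville /=.
  rewrite linearP /= mulmxDl -scalemxAl pairing_linearl pairing_linearr; ring.
by rewrite !mulmxDr -!scalemxAr !pairing_linearr; ring.
Qed.

(* The shear by [1/2 [m, beta]] removes the magnetic term [<m, [beta1, beta2]>]. *)
Lemma Omega_shear (m g a1 a2 b1 b2 : 'M[R]_N) (v : 'I_2 -> V) :
  g^T *m g = 1%:M -> skew b1 -> skew b2 ->
  v ord0 = (a1 + 2^-1 *: lie m b1, g *m b1) ->
  v ord_max = (a2 + 2^-1 *: lie m b2, g *m b2) ->
  Omega (m, g) v = pairing a1 b2 - pairing a2 b1.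
Proof.
move=> gg s1 s2 v0 v1; rewrite OmegaE v0 v1 /dliouville /=.
have ge (z : 'M[R]_N) : g^T *m (g *m z) = z by rewrite mulmxA gg mul1mx.
rewrite !trmx_mul -!(mulmxA _ g^T) !ge s1 s2.
have lieE (x z : 'M[R]_N) : pairing (lie m x) z = - (2^-1 * (\tr (m *m x *m z) - \tr (m *m z *m x))).
  rewrite /pairing /lie mulmxBl linearB /=; congr (- (_ * (_ - _))).
  by rewrite -(mulmxA x) (mxtrace_mulC x).
have negE (x z : 'M[R]_N) : pairing m (- x *m z) = 2^-1 * \tr (m *m x *m z).
  by rewrite /pairing mulNmx mulmxN linearN /= mulrN opprK mulmxA.
rewrite [a1 + _]addrC [a2 + _]addrC !pairing_linearl !lieE !negE.
move: (pairing a1 b2) (pairing a2 b1) (\tr (m *m b1 *m b2)) (\tr (m *m b2 *m b1)).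
by move=> t1 t2 t3 t4; field.
Qed.

End Omega.

Section Coords.
Context {n r : nat}.
Local Notation N := n.+1.
Local Notation d := #|{: ltpair N}|.
Local Notation q := #|{: ltpair n}|.

Definition cbeta (t : 'rV[R]_(r + (d + n))) : 'rV[R]_r := lsubmx t.
Definition calpha (t : 'rV[R]_(r + (d + n))) : 'rV[R]_d := lsubmx (rsubmx t).
Definition cgamma (t : 'rV[R]_(r + (d + n))) : 'rV[R]_n := rsubmx (rsubmx t).

Lemma cbetaE b a c : cbeta (row_mx b (row_mx a c)) = b.
Proof. exact: row_mxKl. Qed.

Lemma calphaE b a c : calpha (row_mx b (row_mx a c)) = a.
Proof. by rewrite /calpha row_mxKr row_mxKl. Qed.

Lemma cgammaE b a c : cgamma (row_mx b (row_mx a c)) = c.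
Proof. by rewrite /cgamma !row_mxKr. Qed.

Lemma cbeta_linear : linear cbeta.
Proof. by move=> a x y; rewrite /cbeta linearP. Qed.

Lemma calpha_linear : linear calpha.
Proof. by move=> a x y; rewrite /calpha !linearP. Qed.

Lemma cgamma_linear : linear cgamma.
Proof. by move=> a x y; rewrite /cgamma !linearP. Qed.

Lemma joinf_coord (V : lmodType R) k (L : 'rV[R]_(r + (d + n)) -> V) (v : 'I_k -> V) (u : 'I_q -> V)
    F A (Sh : 'M[R]_(r, d)) be X c :
  linear L ->
  (forall i, v i = L (vec_coord F (be i) (X i) (c i) *m scale_mx A Sh)) ->
  (forall l, u l = L (vec_coord F 0 (hvec F l) 0 *m scale_mx A Sh)) ->
  forall i, joinf v u i =
    \sum_j (coord_mx F be X c *m scale_mx A Sh) i j *: L (delta_mx 0 j).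
Proof.
move=> Ll vE uE i; pose f : {linear 'rV[R]_(r + (d + n)) -> V} :=
  HB.pack L (GRing.isLinear.Build _ _ _ _ _ Ll).
have -> : \sum_j (coord_mx F be X c *m scale_mx A Sh) i j *: L (delta_mx 0 j) =
    L (row i (coord_mx F be X c) *m scale_mx A Sh).
  rewrite -row_mul -[RHS]/(f _) (row_sum_delta (row i _)) linear_sum.
  by apply: eq_bigr => j _; rewrite linearZ /= [row i _ 0 j]mxE.
case: (split_ordP i) => l ->.
  rewrite joinfl vE; congr (L (_ *m _)); apply/rowP => j.
  by rewrite /coord_mx [RHS]mxE col_mxEu mxE.
rewrite joinfr uE; congr (L (_ *m _)); apply/rowP => j.
by rewrite /coord_mx [RHS]mxE col_mxEd mxE.
Qed.

End Coords.

End VolumeForms.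

(** * Squares of the volume forms as Gram determinants *)

Section Volumes.
Context {R : realType} {n : nat}.
Local Notation N := n.+1.
Local Notation d := #|{: ltpair N}|.
Local Notation q := #|{: ltpair n}|.
Local Notation E0 := ('M[R]_N * 'cV[R]_N)%type.
Local Notation E := ('M[R]_N * 'M[R]_N * 'cV[R]_N)%type.
Variables (bI : 'End(so R N)) (eps : R).
Hypotheses (bIs : so_symmetric bI) (bIp : so_posdef bI).
Local Notation A := (Am bI).

Lemma tangent_sub (V : normedModType R) (M M' : set V) x v :
  M `<=` M' -> tangent M x v -> tangent M' x v.
Proof. by move=> MM' [c [Mc c0 dc]]; exists c; split=> // s; exact/MM'. Qed.

Lemma tangent_ambient0 (x v : E0) :
  tangent ambient0 x v -> skew v.1 /\ v.2^T *m x.2 = 0.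
Proof.
move=> [c [Mc <- dc]]; have D1 := mxder_fst dc; have D2 := mxder_snd dc; split.
  apply: mxder_skew D1; apply: filterE => s; have [cs _] := Mc s.
  by apply/eqP; rewrite -so_spaceE.
by apply: mxder_sphere D2; apply: filterE => s; have [_] := Mc s.
Qed.

Lemma mxder_fst1 (X : R -> E) t v : is_derive t (1 : R) X v -> mxder (fun s => (X s).1.1) t v.1.1.
Proof.
move=> dX i j; apply: (@is_derive_functional _ E (fun y => y.1.1 i j) R X t 1 v _ dX).
exact: (@functional_fst _ ('M[R]_N * 'M[R]_N)%type _ _ (@functional_fst _ _ _ _ (functional_coord i j))).
Qed.

Lemma mxder_snd1 (X : R -> E) t v : is_derive t (1 : R) X v -> mxder (fun s => (X s).1.2) t v.1.2.
Proof.
move=> dX i j; apply: (@is_derive_functional _ E (fun y => y.1.2 i j) R X t 1 v _ dX).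
exact: (@functional_fst _ ('M[R]_N * 'M[R]_N)%type _ _ (@functional_snd _ _ _ _ (functional_coord i j))).
Qed.

Lemma differentiable_fst1 (x : E) : differentiable (fun y : E => y.1.1) x.
Proof.
apply: (@differentiable_comp _ _ _ _ (fun y : E => y.1) (fun z : 'M[R]_N * 'M[R]_N => z.1)).
  by apply: linear_differentiable => y; exact: cvg_fst.
by apply: linear_differentiable => y; exact: cvg_fst.
Qed.

Lemma G0_ambient0 : G0 bI `<=` ambient0. Proof. by move=> x []. Qed.

Lemma G_ambient : G bI `<=` ambient. Proof. by move=> x []. Qed.

(** The empty first block makes this the case r = 0 of [tangent_row]. *)
Definition row_G0 (x v : E0) : 'rV[R]_(0 + (N + N)) :=
  row_mx 0 (row_mx (crd (angm bI v.1) *m (Jm x.2)^T) v.2^T).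

Definition chart0 (F : 'M[R]_(N, n)) (t : 'rV[R]_(0 + (d + n))) : E0 :=
  (uncrd (calpha t), F *m (cgamma t)^T).

Lemma chart0_linear F : linear (chart0 F).
Proof.
move=> a x y; rewrite /chart0 calpha_linear cgamma_linear uncrd_linear.
by rewrite linearP /= mulmxDr -scalemxAr.
Qed.

(** Only its independence of the point and of the frame is used. *)
Definition ref0 : R :=
  fwedge (fun v : _ -> 'rV[R]_(0 + (d + n)) => dm (fun i => uncrd (calpha (v i))))
    (fun v : _ -> 'rV[R]_(0 + (d + n)) => \det (\matrix_(i < n, j < n) cgamma (v j) 0 i))
    (fun i => delta_mx 0 i).

Lemma vol_G0_sqr x theta (v : 'I_(n + n) -> E0) :
  G0 bI x -> vol_G0 bI eps x theta -> (forall i, tangent (G0 bI) x (v i)) ->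
  let W := \matrix_(i < n + n) row_G0 x (v i) in
  (wedge_const (n + n) q * theta v) ^+ 2 =
  mu bI eps x.2 ^+ 2 * (\det A ^+ 2 * \det (W *m W^T) * ref0 ^+ 2).
Proof.
move=> Gx [e fr [ft ThetaE]] vT W.
have [[mso gg] _] := Gx; rewrite /sphere /= in gg.
have sm : skew x.1 by apply/eqP; rewrite -so_spaceE.
have [FF Fg] := frame_ofP fr gg; set F := frame_of e x.2 in FF Fg.
have d1 : differentiable (fun y : E0 => y.1) x by apply: linear_differentiable => y; exact: cvg_fst.
have d2 : differentiable (fun y : E0 => y.2) x by apply: linear_differentiable => y; exact: cvg_snd.
have vA i : skew (v i).1 /\ (v i).2^T *m x.2 = 0.
  by apply: tangent_ambient0; apply: tangent_sub (vT i); exact: G0_ambient0.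
pose u (l : 'I_q) : E0 := (normal_vec bI F l, 0).
have uT l : tangent ambient0 x (u l).
  exists (fun s => s *: u l + x); split; [|by rewrite scale0r add0r|exact: is_derive_ray].
  move=> s; split; last by rewrite /sphere /= scaler0 add0r.
  by rewrite /= rpredD // rpredZ // subvsP.
pose L := chart0 F; pose Sh : 'M[R]_(0, d) := 0.
have vE i : v i = L (vec_coord F 0 (angm bI (v i).1) (v i).2 *m scale_mx A Sh).
  have [s1 s2] := vA i; rewrite vec_coord_scale mulmx0 subr0 /L /chart0 calphaE cgammaE.
  rewrite -crd_angm_Am // uncrdK // trmx_mul trmxK mulmxA (frame_complete gg FF Fg) mulmxBl mul1mx -mulmxA.
  have -> : x.2^T *m (v i).2 = 0 by rewrite -[LHS]trmxK trmx_mul trmxK s2 trmx0.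
  by rewrite mulmx0 subr0 -surjective_pairing.
have uE l : u l = L (vec_coord F 0 (hvec F l) 0 *m scale_mx A Sh).
  rewrite vec_coord_scale mulmx0 subr0 /L /chart0 calphaE cgammaE -crd_normal_vec.
  by rewrite trmx0 mul0mx trmx0 mulmx0 uncrdK //; exact: skew_normal_vec.
pose f : form E0 (d + n) := fwedge (pull fst dm) (pull snd (dgamma x.2)).
have ff : is_form f.
  by apply: fwedge_is_form; apply: form_pull; [exact: dm_is_form|exact: dgamma_is_form].
have dl ij a y z : 'D_(a *: y + z) (phi_c bI e ij) x =
    a * 'D_y (phi_c bI e ij) x + 'D_z (phi_c bI e ij) x.
  by apply: derive_linear_dir; exact: (phi_c_differentiable bI ij d1 d2 fr).
have dv I i : 'D_(v i) (phi_c bI e I) x = 0.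
  apply: (dphi_tangent (M := G0 bI) I d1 d2 fr _ Gx (vT i)).
  by move=> y [[yso yS] yp]; split=> //; apply/eqP; rewrite -so_spaceE.
have du l l' : 'D_(u l') (phi_c bI e (enum_val l)) x = (l == l')%:R.
  apply: (dphi_normal bIp l d1 d2 fr gg) => s; first by [].
  by rewrite /= scaler0 add0r.
have T i : tangent ambient0 x (joinf v u i).
  case: (split_ordP i) => l ->; rewrite ?joinfl ?joinfr //.
  by apply: tangent_sub (vT l); exact: G0_ambient0.
have J := joinf_coord (chart0_linear F) vE uE.
pose e0 : (d + n = 0 + (d + n))%N := erefl.
rewrite (@static_sqr _ _ n 0 d _ _ deg0 e0 f _ _ _ _ _ _ _ ff ft dl (ThetaE _ T) dv du J).
have e1 : (0 + (d + n) = n + n + q)%N := deg0.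
rewrite (det_gram_mulr e1).
rewrite det_scale_mx (det_coord_mx gg FF Fg _ (fun i => skew_angm bI (v i).1) (fun i => (vA i).2)).
congr (_ * (_ * _)).
(* In the chart only the sphere factor still sees the frame, through a determinant equal to 1 or -1
   that the square removes. *)
have -> : fcast e0 f (fun j => L (delta_mx 0 j)) = \det (row_mx x.2 F : 'M[R]_N) * ref0.
  apply: fwedge_ext => h; rewrite /pull /=; first by congr dm; apply/funext => i; rewrite cast_ord_id.
  by rewrite -dgamma_frame; congr dgamma; apply/funext => i; rewrite cast_ord_id.
by rewrite exprMn det_frame_sqr // mul1r.
Qed.

Lemma tangent_ambient (x v : E) : tangent ambient x v ->
  [/\ skew v.1.1, v.2^T *m x.2 = 0 & skew (x.1.2^T *m v.1.2)].
Proof.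
move=> [c [Mc <- dc]]; have D1 := mxder_fst1 dc; have D2 := mxder_snd1 dc; have D3 := mxder_snd dc.
split.
- apply: mxder_skew D1; apply: filterE => s; have [[cs _] _] := Mc s.
  by apply/eqP; rewrite -so_spaceE.
- by apply: mxder_sphere D3; apply: filterE => s; have [[_ cs] _] := Mc s.
have H : \forall s \near (0 : R), ((c s).1.2)^T *m (c s).1.2 = 1%:M.
  by apply: filterE => s; have [_ []] := Mc s.
have := mxder_orth H D2; rewrite /skew trmx_mul trmxK => /eqP.
by rewrite addr_eq0 => /eqP.
Qed.

Definition row_G (x v : E) : 'rV[R]_(d + (N + N)) :=
  row_mx (crd (x.1.2^T *m v.1.2)) (row_mx (crd (angm bI v.1.1) *m (Jm x.2)^T) v.2^T).

(** The shift by half of [m, beta] is that of [Omega_shear]; it turns the symplectic form into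
    [ref_Omega], the same at all points. *)
Definition chart (x : E) (F : 'M[R]_(N, n)) (t : 'rV[R]_(d + (d + n))) : E :=
  ((uncrd (calpha t) + 2^-1 *: lie x.1.1 (uncrd (cbeta t)), x.1.2 *m uncrd (cbeta t)),
   F *m (cgamma t)^T).

Lemma chart_linear x F : linear (chart x F).
Proof.
move=> a y z; rewrite /chart calpha_linear cbeta_linear cgamma_linear !uncrd_linear.
have -> (U V : 'M[R]_N) B C : a *: U + V + 2^-1 *: lie x.1.1 (a *: B + C) =
    a *: (U + 2^-1 *: lie x.1.1 B) + (V + 2^-1 *: lie x.1.1 C).
  rewrite lie_linearr; move: (lie x.1.1 B) (lie x.1.1 C) => X Y.
  by rewrite !scalerDr !scalerA (mulrC a) addrACA.
by rewrite !linearP.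
Qed.

Definition ref_Omega : form 'rV[R]_(d + (d + n)) 2 := fun w =>
  pairing (uncrd (calpha (w ord0))) (uncrd (cbeta (w ord_max))) -
  pairing (uncrd (calpha (w ord_max))) (uncrd (cbeta (w ord0))).

Lemma dimE : (d * 2 + n = d + (d + n))%N. Proof. by rewrite muln2 -addnn addnA. Qed.

Definition ref1 : R :=
  fwedge (fpow ref_Omega d)
    (fun v : _ -> 'rV[R]_(d + (d + n)) => \det (\matrix_(i < n, j < n) cgamma (v j) 0 i))
    (fun i => delta_mx 0 (cast_ord dimE i)).

Lemma vol_G_sqr x theta (v : 'I_(d + (n + n)) -> E) :
  G bI x -> vol_G bI eps x theta -> (forall i, tangent (G bI) x (v i)) ->
  let W := \matrix_(i < d + (n + n)) row_G x (v i) in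
  (wedge_const (d + (n + n)) q * theta v) ^+ 2 =
  mu bI eps x.2 ^+ 2 * (\det A ^+ 2 * \det (W *m W^T) * ref1 ^+ 2).
Proof.
move=> Gx [e fr [ft ThetaE]] vT W.
have [[[mso gg] [oo _]] _] := Gx; rewrite /= in mso; rewrite /sphere /= in gg.
have [FF Fg] := frame_ofP fr gg; set F := frame_of e x.2 in FF Fg.
have d1 : differentiable (fun y : E => y.1.1) x by exact: differentiable_fst1.
have d2 : differentiable (fun y : E => y.2) x by apply: linear_differentiable => y; exact: cvg_snd.
have vA i := tangent_ambient (tangent_sub G_ambient (vT i)).
pose u (l : 'I_q) : E := ((normal_vec bI F l, 0), 0).
have uT l : tangent ambient x (u l).
  exists (fun s => s *: u l + x); split; [|by rewrite scale0r add0r|exact: is_derive_ray].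
  move=> s; split; last by rewrite /SO /= scaler0 add0r; have [_ []] := Gx.1.
  split; last by rewrite /sphere /= scaler0 add0r.
  by rewrite /= rpredD // rpredZ // subvsP.
(* This shear subtracts half of [m, beta] from the momentum, and the chart adds it back. *)
pose L := chart x F; pose Sh : 'M[R]_d := 2^-1 *: adm x.1.1.
have vE i : v i = L (vec_coord F (crd (x.1.2^T *m (v i).1.2)) (angm bI (v i).1.1) (v i).2
    *m scale_mx A Sh).
  have [s1 s2 s3] := vA i; rewrite vec_coord_scale /L /chart calphaE cgammaE cbetaE.
  set be := x.1.2^T *m (v i).1.2 in s3 *.
  have aE : uncrd (crd (angm bI (v i).1.1) *m A - crd be *m Sh) = (v i).1.1 - 2^-1 *: lie x.1.1 be.
    rewrite -crd_angm_Am // /Sh -scalemxAr mul_adm // linearB linearZ /= !uncrdK //.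
    by apply: skew_lie => //; apply/eqP; rewrite -so_spaceE.
  rewrite aE (uncrdK s3) subrK {1}/be mulmxA (mulmx1C oo) mul1mx.
  rewrite trmx_mul trmxK mulmxA (frame_complete gg FF Fg) mulmxBl mul1mx -mulmxA.
  have -> : x.2^T *m (v i).2 = 0 by rewrite -[LHS]trmxK trmx_mul trmxK s2 trmx0.
  by rewrite mulmx0 subr0 -!surjective_pairing.
have uE l : u l = L (vec_coord F 0 (hvec F l) 0 *m scale_mx A Sh).
  rewrite vec_coord_scale mul0mx subr0 /L /chart calphaE cgammaE cbetaE -crd_normal_vec.
  rewrite linear0 mulmx0 /lie mulmx0 mul0mx subr0 scaler0 addr0.
  by rewrite trmx0 mul0mx trmx0 mulmx0 uncrdK //; exact: skew_normal_vec.
pose f : form E (d * 2 + n) := fwedge (pull fst (fpow (Omega x.1) d)) (pull snd (dgamma x.2)).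
have ff : is_form f.
  apply: fwedge_is_form; apply: form_pull; last exact: dgamma_is_form.
  by apply: fpow_is_form; exact: Omega_is_form.
have pd ij := phi_c_differentiable bI ij d1 d2 fr.
have dl ij a y z : 'D_(a *: y + z) (phi_c bI e ij \o red) x =
    a * 'D_y (phi_c bI e ij \o red) x + 'D_z (phi_c bI e ij \o red) x.
  by apply: derive_linear_dir; exact: pd.
have dv I i : 'D_(v i) (phi_c bI e I \o red) x = 0.
  apply: (dphi_tangent (M := G bI) I d1 d2 fr _ Gx (vT i)).
  by move=> y [[[yso yS] _] yp]; split=> //; apply/eqP; rewrite -so_spaceE.
have du l l' : 'D_(u l') (phi_c bI e (enum_val l) \o red) x = (l == l')%:R.
  apply: (dphi_normal bIp l d1 d2 fr gg) => s; first by [].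
  by rewrite /= scaler0 add0r.
have T i : tangent ambient x (joinf v u i).
  case: (split_ordP i) => l ->; rewrite ?joinfl ?joinfr //.
  by apply: tangent_sub (vT l); exact: G_ambient.
have J := joinf_coord (chart_linear x F) vE uE.
rewrite (@static_sqr _ _ n d d _ _ deg dimE f _ _ _ _ _ _ _ ff ft dl (ThetaE _ T) dv du J).
have e1 : (d + (d + n) = d + (n + n) + q)%N by rewrite -dimE deg.
rewrite (det_gram_mulr e1).
have cg i : (v i).2^T *m x.2 = 0 by have [] := vA i.
rewrite det_scale_mx (det_coord_mx gg FF Fg _ (fun i => skew_angm bI (v i).1.1) cg).
congr (_ * (_ * _)).
have -> : fcast dimE f (fun j => L (delta_mx 0 j)) = \det (row_mx x.2 F : 'M[R]_N) * ref1.
  apply: fwedge_ext => h; last by rewrite -dgamma_frame.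
  rewrite /pull; apply: fpow_ext => h'.
  rewrite [x.1]surjective_pairing.
  by apply: Omega_shear => //; exact: skew_uncrd.
by rewrite exprMn det_frame_sqr // mul1r.
Qed.

End Volumes.

(** * Invariance of the measures *)

Section Invariance.
Context {R : realType} {n : nat}.
Local Notation N := n.+1.
Local Notation d := #|{: ltpair N}|.
Local Notation q := #|{: ltpair n}|.
Local Notation E0 := ('M[R]_N * 'cV[R]_N)%type.
Local Notation E := ('M[R]_N * 'M[R]_N * 'cV[R]_N)%type.
Variables (bI : 'End(so R N)) (eps : R).
Hypotheses (bIs : so_symmetric bI) (bIp : so_posdef bI) (eps0 : eps != 0).

Lemma norm_eq_sqr (w a b : R) : w != 0 -> (w * a) ^+ 2 = (w * b) ^+ 2 -> `|a| = `|b|.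
Proof.
move=> w0 E; have : `|w * a| = `|w * b| by rewrite -!sqrtr_sqr E.
by rewrite !normrM; apply: mulfI; rewrite normr_eq0.
Qed.

Lemma mulr_swap (a b m1 m2 P1 P2 : R) :
  m1 * P1 = m2 * P2 -> m2 * (a * P2 * b) = m1 * (a * P1 * b).
Proof. by move=> H; rewrite [a * P2]mulrC [a * P1]mulrC !mulrA H. Qed.

Lemma open_slice (V : normedModType R) (W : set (R * V)) x : open W -> open [set s | W (s, x)].
Proof.
move=> oW; apply: (@open_comp _ _ (fun s : R => (s, x)) W) => // s _.
apply: (@differentiable_continuous _ R (R * V)%type).
by apply: differentiable_pair.
Qed.

Lemma rank_dims r : (r + (N + N) = r + (n + n) + (1 + 1))%N.
Proof. by rewrite -addnA; congr addn; rewrite addSn addnS -[(1 + 1)%N]/2%N addn2. Qed.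

Lemma invariant_reduced :
  invariant_measure (G0 bI) (reduced_system bI eps) (vol_G0 bI eps).
Proof.
move=> W phi fl t x Gx Wtx theta theta' vx vx' v vT.
pose T := [set s : R | W (s, x)].
have oT : open T by exact: open_slice (flow_open fl).
have iT : is_interval T by exact: (flow_itv fl Gx).
have T0 : T 0 by exact: (flow_dom0 fl Gx).
pose y s := phi (s, x); pose vel s := velocity phi (s, x).
pose dv i s := tangent_map phi x s (v i); pose acc i s := 'D_(0, v i) (velocity phi) (s, x).
have Gy s : T s -> G0 bI (y s) by move=> Ts; exact: (flow_in fl Gx Ts).
have shell s : T s -> on_shell bI eps (y s).1 (y s).2 (vel s).1 (vel s).2.
  by move=> Ts; apply: (on_shellP bIp (Gy s Ts)); exact: (flow_velocity fl Gx Ts).2.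
have lin s i : T s ->
    linearized bI eps (y s).1 (y s).2 (vel s).1 (dv i s).1 (dv i s).2 (acc i s).1 (acc i s).2.
  move=> Ts; have [X [U [[X0 U0] XU dX dU]]] := variation fl Ts (vT i).
  rewrite /y /vel -X0 -U0; apply: (linearize bIp (m := fun s => (X s).1) (g := fun s => (X s).2)
    (m1 := fun s => (U s).1) (g1 := fun s => (U s).2)).
  - by apply: filterS XU => r [GX sX]; exact: (on_shellP bIp).
  - exact: mxder_fst dX.
  - exact: mxder_snd dX.
  - exact: mxder_fst dU.
  - exact: mxder_snd dU.
have dy s : T s -> is_derive s (1 : R) y (vel s) by move=> Ts; exact: (flow_velocity fl Gx Ts).1.
have Ddm s i : T s -> mxder (fun r => (dv i r).1) s (acc i s).1.
  move=> Ts j l; apply: (tangent_map_der fl (l := fun z => z.1 j l) (v i) _ Ts).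
  exact: (@functional_fst _ _ _ _ (functional_coord j l)).
have Dc s i : T s -> mxder (fun r => (dv i r).2) s (acc i s).2.
  move=> Ts j l; apply: (tangent_map_der fl (l := fun z => z.2 j l) (v i) _ Ts).
  exact: (@functional_snd _ _ _ _ (functional_coord j l)).
(* There is no group component here: rows of width 0. *)
pose be (i : 'I_(n + n)) (s : R) : 'rV[R]_0 := 0.
have Dbe s i : T s -> mxder (be i) s (be i s *m (0 : 'M[R]_0) + crd (angm bI (dv i s).1) *m (0 : 'M[R]_(d, 0))).
  by move=> Ts j [].
have ev := @evolution_sqr R n 0 (n + n) bI eps bIs bIp eps0 T (fun s => (y s).1) (fun s => (vel s).1)
  (fun s => (y s).2) (fun s => (vel s).2) (fun i s => (dv i s).1) (fun i s => (acc i s).1)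
  (fun i s => (dv i s).2) (fun i s => (acc i s).2) be (fun=> 0) (fun=> 0) oT iT shell lin
  (fun s Ts => mxder_fst (dy s Ts)) (fun s Ts => mxder_snd (dy s Ts)) Ddm Dc Dbe
  (fun _ _ => mxtrace0 _ _) (rank_dims 0) 0 t T0 Wtx.
have dT i : tangent (G0 bI) (y t) (dv i t) by exact: (tangent_map_tangent fl Gx Wtx (vT i)).
apply: (norm_eq_sqr (wedge_const_neq0 (n + n) q)).
rewrite (vol_G0_sqr bIp (Gy t Wtx) vx' dT) (vol_G0_sqr bIp Gx vx vT).
have y0 : y 0 = x by exact: (flow_init fl Gx).
have dv0 i : dv i 0 = v i by exact: (tangent_map0 fl Gx (vT i)).
have W0 : \matrix_(i < n + n) row_G0 bI x (v i) =
    \matrix_(i < n + n) tangent_row bI (fun s => (y s).2) (fun i s => (dv i s).1)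
      (fun i s => (dv i s).2) be i 0.
  by apply/row_matrixP => i; rewrite !rowK /tangent_row dv0 y0.
by rewrite W0; apply: mulr_swap; move: ev; rewrite /= y0.
Qed.

(** For beta = g^-1 dg, the equation g' = g omega varies to beta' = [beta, omega] + d omega. *)
Lemma crd_left_velocity (G D : R -> 'M[R]_N) (G1 D1 w dw : 'M[R]_N) s :
  (G s)^T *m G s = 1%:M -> skew w -> skew ((G s)^T *m D s) -> skew dw ->
  mxder G s G1 -> mxder D s D1 ->
  G1 = G s *m w -> D1 = D s *m w + G s *m dw ->
  mxder (fun r => crd ((G r)^T *m D r)) s
    (crd ((G s)^T *m D s) *m (- adm w) + crd dw *m 1%:M).
Proof.
move=> oG sw sb sdw dG dD G1E D1E.
have dB := mxderM (mxderT dG) dD.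
apply: mxder_eq; first exact: (mxder_lin (@crd_linear R N) dB).
rewrite mulmxN mul_adm // mulmx1 -linearN -linearD; congr crd.
rewrite G1E D1E trmx_mul sw mulmxDr !mulmxA oG mul1mx mulNmx mulNmx /lie !mulmxA.
by rewrite opprB addrA [X in X + dw]addrC.
Qed.

Lemma invariant_full :
  invariant_measure (G bI) (full_system bI eps) (vol_G bI eps).
Proof.
move=> W phi fl t x Gx Wtx theta theta' vx vx' v vT.
pose T := [set s : R | W (s, x)].
have oT : open T by exact: open_slice (flow_open fl).
have iT : is_interval T by exact: (flow_itv fl Gx).
have T0 : T 0 by exact: (flow_dom0 fl Gx).
pose y s := phi (s, x); pose vel s := velocity phi (s, x).
pose dv i s := tangent_map phi x s (v i); pose acc i s := 'D_(0, v i) (velocity phi) (s, x).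
have Gy s : T s -> G bI (y s) by move=> Ts; exact: (flow_in fl Gx Ts).
have G0red z : G bI z -> G0 bI (red z) by move=> [[]].
have sys s : T s -> full_system bI eps (y s) (vel s).
  by move=> Ts; exact: (flow_velocity fl Gx Ts).2.
have shell s : T s -> on_shell bI eps (y s).1.1 (y s).2 (vel s).1.1 (vel s).2.
  by move=> Ts; exact: (on_shellP bIp (G0red _ (Gy s Ts)) (sys s Ts).1).
have vari s i : T s ->
    linearized bI eps (y s).1.1 (y s).2 (vel s).1.1 (dv i s).1.1 (dv i s).2 (acc i s).1.1 (acc i s).2 /\
    (acc i s).1.2 = (dv i s).1.2 *m angm bI (y s).1.1 + (y s).1.2 *m angm bI (dv i s).1.1.
  move=> Ts; have [X [U [[X0 U0] XU dX dU]]] := variation fl Ts (vT i).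
  rewrite /y /vel -X0 -U0; split.
    apply: (linearize bIp (m := fun s => (X s).1.1) (g := fun s => (X s).2)
      (m1 := fun s => (U s).1.1) (g1 := fun s => (U s).2)).
    - by apply: filterS XU => r [GX sX]; exact: (on_shellP bIp (G0red _ GX) sX.1).
    - exact: mxder_fst1 dX.
    - exact: mxder_snd dX.
    - exact: mxder_fst1 dU.
    - exact: mxder_snd dU.
  have D1 := mxderM (mxder_snd1 dX) (mxder_lin (@angm_linear _ _ bI) (mxder_fst1 dX)).
  apply: (mxder_unique (mxder_snd1 dU)); apply: (mxder_near _ D1).
  apply: filterS XU => r [GX [_ ->]]; congr (_ *m _).
  by rewrite angmE //; have [[[mso _] _] _] := GX; apply/eqP; rewrite -so_spaceE.
have lin s i Ts := (vari s i Ts).1.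
have dy s : T s -> is_derive s (1 : R) y (vel s) by move=> Ts; exact: (flow_velocity fl Gx Ts).1.
have Ddm s i : T s -> mxder (fun r => (dv i r).1.1) s (acc i s).1.1.
  move=> Ts j l; apply: (tangent_map_der fl (l := fun z => z.1.1 j l) (v i) _ Ts).
  exact: (@functional_fst _ ('M[R]_N * 'M[R]_N)%type _ _ (@functional_fst _ _ _ _ (functional_coord j l))).
have DdG s i : T s -> mxder (fun r => (dv i r).1.2) s (acc i s).1.2.
  move=> Ts j l; apply: (tangent_map_der fl (l := fun z => z.1.2 j l) (v i) _ Ts).
  exact: (@functional_fst _ ('M[R]_N * 'M[R]_N)%type _ _ (@functional_snd _ _ _ _ (functional_coord j l))).
have Dc s i : T s -> mxder (fun r => (dv i r).2) s (acc i s).2.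
  move=> Ts j l; apply: (tangent_map_der fl (l := fun z => z.2 j l) (v i) _ Ts).
  exact: (@functional_snd _ _ _ _ (functional_coord j l)).
have dT s i : T s -> tangent (G bI) (y s) (dv i s).
  by move=> Ts; exact: (tangent_map_tangent fl Gx Ts (vT i)).
pose be (i : 'I_(d + (n + n))) (s : R) : 'rV[R]_d := crd ((y s).1.2^T *m (dv i s).1.2).
pose w s := angm bI (y s).1.1.
have Dbe s i : T s -> mxder (be i) s (be i s *m (- adm (w s)) + crd (angm bI (dv i s).1.1) *m 1%:M).
  move=> Ts; have [_ _ sb] := tangent_ambient (tangent_sub (@G_ambient _ _ bI) (dT s i Ts)).
  have [[_ [oG _]] _] := Gy s Ts.
  apply: (crd_left_velocity oG (skew_angm bI _) sb (skew_angm bI _) (mxder_snd1 (dy s Ts)) (DdG s i Ts)).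
    by rewrite (sys s Ts).2 angmE //; exact: os_skew (shell s Ts).
  exact: (vari s i Ts).2.
(* Unimodularity of so(N) keeps the group block out of the trace. *)
have B0tr s : T s -> \tr (- adm (w s)) = 0.
  by move=> Ts; rewrite linearN /= (tr_anti (adm_anti (skew_angm bI _))) oppr0.
have ev := @evolution_sqr R n d (d + (n + n)) bI eps bIs bIp eps0 T (fun s => (y s).1.1) (fun s => (vel s).1.1)
  (fun s => (y s).2) (fun s => (vel s).2) (fun i s => (dv i s).1.1) (fun i s => (acc i s).1.1)
  (fun i s => (dv i s).2) (fun i s => (acc i s).2) be (fun s => - adm (w s)) (fun=> 1%:M) oT iT shell lin
  (fun s Ts => mxder_fst1 (dy s Ts)) (fun s Ts => mxder_snd (dy s Ts)) Ddm Dc Dbe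
  B0tr (rank_dims d) 0 t T0 Wtx.
apply: (norm_eq_sqr (wedge_const_neq0 (d + (n + n)) q)).
rewrite (vol_G_sqr bIp (Gy t Wtx) vx' (fun i => dT t i Wtx)) (vol_G_sqr bIp Gx vx vT).
have y0 : y 0 = x by exact: (flow_init fl Gx).
have dv0 i : dv i 0 = v i by exact: (tangent_map0 fl Gx (vT i)).
have W0 : \matrix_(i < d + (n + n)) row_G bI x (v i) =
    \matrix_(i < d + (n + n)) tangent_row bI (fun s => (y s).2) (fun i s => (dv i s).1.1)
      (fun i s => (dv i s).2) be i 0.
  by apply/row_matrixP => i; rewrite !rowK /tangent_row /be dv0 y0.
by rewrite W0; apply: mulr_swap; move: ev; rewrite /= y0.
Qed.

End Invariance.

Theorem theorem4 (R : realType) (n : nat) (II : 'End(so R n.+1))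
    (D rho sigma eps : R)
    (IIsym : so_symmetric II) (IIpos : so_posdef II)
    (D_gt0 : 0 < D) (rho_gt0 : 0 < rho) (sigma_gt0 : 0 < sigma)
    (epsE : eps = sigma / (sigma + rho) \/
            sigma != rho /\ eps = sigma / (sigma - rho)) :
  let bI : 'End(so R n.+1) := II + D *: \1%VF in
  invariant_measure (G bI) (full_system bI eps) (vol_G bI eps) /\
  invariant_measure (G0 bI) (reduced_system bI eps) (vol_G0 bI eps).
Proof.
move=> bI.
have bIE x : bI x = D *: x + II x by rewrite /bI add_lfunE scale_lfunE id_lfunE addrC.
have bIs : so_symmetric bI.
  move=> x y; rewrite !bIE so_dot_sym !so_dot_linr so_dot_sym; congr (_ + _).
  by rewrite so_dot_sym IIsym.
have bIp : so_posdef bI.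
  move=> x x0; rewrite bIE so_dot_sym so_dot_linr (so_dot_sym x (II x)).
  by rewrite ltr_wpDl ?IIpos // mulr_ge0 ?(ltW D_gt0) // so_dotE mul_rV_self_ge0.
have eps0 : eps != 0.
  have s0 : sigma != 0 by rewrite gt_eqF.
  case: epsE => [->|[sr ->]]; rewrite mulf_neq0 // invr_eq0.
    by rewrite gt_eqF // addr_gt0.
  by rewrite subr_eq0.
by split; [exact: invariant_full|exact: invariant_reduced].
Qed.
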